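(* Let conditions (A), (B) and (C) of the context hold, and let $g(y)=f(e^y)$, $G(y)=\int_0^y g(z)\,dz$, $y\in\mathbb{R}$. Then $$\mathrm{E} g(X_T)=(2\pi)^{-\frac12}\int_{\mathbb{R}}G(x)\,\mathrm{E}\left(\frac{x-m_Y}{\sigma_Y^3}\exp\left\{-\frac{(x-m_Y)^2}{2\sigma_Y^2}\right\}\right)dx=(2\pi)^{-\frac12}\,\mathrm{E}\left(\sigma_Y^{-1}\int_{\mathbb{R}}G(x\sigma_Y+m_Y)\,x\,e^{-\frac{x^2}{2}}dx\right).$$
   Context: Model. Fix $T>0$, $H\in(\tfrac12,1)$, $b\in\mathbb{R}$, $\alpha>0$ and deterministic $S_0>0$, $Y_0\in\mathbb{R}$. $W$ is a standard Wiener process on $[0,T]$ and $B^H$ is a fractional Brownian motion on $[0,T]$ with Hurst index $H$ (centered Gaussian, covariance $\frac12(s^{2H}+t^{2H}-|t-s|^{2H})$, with continuous paths), independent of $W$. $Y_t=Y_0e^{-\alpha t}+\int_0^te^{-\alpha(t-s)}dB^H_s$ (the solution of $dY_t=-\alpha Y_tdt+dB^H_t$), and $S_t=S_0\exp\{bt+\int_0^t\sigma(Y_s)dW_s-\frac12\int_0^t\sigma^2(Y_s)ds\}$ (the solution of $dS_t=bS_tdt+\sigma(Y_t)S_tdW_t$). Put $X_t=\log S_t$, $X_0=\log S_0$. Condition (A), on $f:\mathbb{R}^+\to\mathbb{R}^+$: (i) $f$ is measurable and $f(x)\le C_f(1+x^p)$, $x\ge0$, for some constants $C_f>0$, $p>0$;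 (ii) $f$ is locally Riemann integrable, possibly having discontinuities of the first kind. Condition (B), on $\sigma:\mathbb{R}\to\mathbb{R}$: there is $C_\sigma>0$ such that (i) $\sigma(x)\ge\sigma_{\min}>0$ for all $x$; (ii) there is $q\in(0,1)$ with $\sigma(x)\le C_\sigma(1+|x|^q)$, $x\in\mathbb{R}$; (iii) there is $r\in(0,1]$ with $|\sigma(x)-\sigma(y)|\le C_\sigma|x-y|^r$, $x,y\in\mathbb{R}$; (iv) $\sigma\in C(\mathbb{R})$ is differentiable Lebesgue-a.e. and there is $q'>0$ with $|\sigma'(x)|\le C_\sigma(1+|x|^{q'})$ for Lebesgue-a.e. $x$. Notation: $\sigma_Y^2=\int_0^T\sigma^2(Y_s)ds$ (with $\sigma_Y>0$ its positive square root), $m_Y=X_0+bT-\frac12\sigma_Y^2$, $\sigma_Z^2=\int_0^T\sigma^{-2}(Y_s)ds$, $\Delta=\sigma_Y^2\sigma_Z^2-T^2$. Condition (C): $\Delta>0$ with probability 1. *)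

(* Defs.v *)
From mathcomp Require Import all_boot all_order all_algebra.
From mathcomp Require Import all_classical all_reals all_analysis.

Set Implicit Arguments.
Unset Strict Implicit.
Unset Printing Implicit Defensive.

Import Order.TTheory GRing.Theory Num.Theory.
Import numFieldNormedType.Exports.

Local Open Scope classical_set_scope.
Local Open Scope ring_scope.

Section riemann_stieltjes.
Context {R : realType}.

(* The partition a = x_0 < x_1 < ... < x_n = b is stored, as in
   [itv_partition a b s], as s = [:: x_1; ...; x_n]. *)
Definition node (a : R) (s : seq R) (i : nat) : R := nth a (a :: s) i.

(* c i is the tag of [x_i, x_(i+1)], and dlt bounds the mesh. *)
Definition tagged_partition (a b : R) (s : seq R) (c : nat -> R) (dlt : R) :=
  itv_partition a b s /\
  forall i, (i < size s)%N ->
    (node a s i <= c i <= node a s i.+1) /\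
    (node a s i.+1 - node a s i < dlt).

Definition RS_sum (h k : R -> R) (a : R) (s : seq R) (c : nat -> R) : R :=
  \sum_(i < size s) h (c i) * (k (node a s i.+1) - k (node a s i)).

Definition is_RS_integral (h k : R -> R) (a b I : R) :=
  forall eps : R, 0 < eps -> exists2 dlt : R, 0 < dlt &
    forall s c, tagged_partition a b s c dlt -> `|RS_sum h k a s c - I| < eps.

Definition riemann_integrable (h : R -> R) (a b : R) :=
  exists I, is_RS_integral h id a b I.

Definition primitive0 (h : R -> R) (y : R) : R :=
  if 0 <= y then (\int[lebesgue_measure]_(z in `[0, y]) h z)%R
  else - (\int[lebesgue_measure]_(z in `[y, 0]) h z)%R.

End riemann_stieltjes.

Section processes.
Context {R : realType} {d : measure_display} {Omega : measurableType d}.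
Variable P : probability Omega R.

Definition proc_events (X : R -> Omega -> R) (J : set R) : set (set Omega) :=
  \bigcup_(t in J) preimage_set_system setT (X t) measurable.

Definition indep_systems (G1 G2 : set (set Omega)) :=
  forall A B, G1 A -> G2 B -> P (A `&` B) = (P A * P B)%E.

Definition indep_processes (X Y : R -> Omega -> R) (J : set R) :=
  indep_systems <<s proc_events X J >> <<s proc_events Y J >>.

(* [normal_prob m 0] is a uniform law by convention, so the degenerate
   Gaussian law has to be singled out. *)
Definition gaussian_law (m s : R) : set R -> \bar R :=
  if s == 0 then dirac m else normal_prob m s.

Definition gaussian_rv (X : {RV P >-> R}) :=
  exists m s : R, 0 <= s /\
    forall A : set R, measurable A -> distribution P X A = gaussian_law m s A.

Definition gaussian_process (X : R -> {RV P >-> R}) (J : set R) :=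
  forall (n : nat) (t : 'I_n -> R) (a : 'I_n -> R) (L : {RV P >-> R}),
    (forall i, J (t i)) ->
    (forall w, L w = \sum_(i < n) a i * X (t i) w) ->
    gaussian_rv L.

Definition wiener (T : R) (W : R -> {RV P >-> R}) :=
  [/\ {ae P, forall w, W 0 w = 0},
      {ae P, forall w, {within `[0, T], continuous (fun t => W t w)}},
      (forall s t, 0 <= s -> s < t -> t <= T ->
        indep_systems
          <<s proc_events (fun u => W u : Omega -> R) `[0, s] >>
          (preimage_set_system setT (fun w => W t w - W s w) measurable)) &
      (forall s t, 0 <= s -> s < t -> t <= T ->
        forall A : set R, measurable A ->
          P ((fun w => W t w - W s w) @^-1` A)
          = normal_prob 0 (Num.sqrt (t - s)) A)].

Definition fbm (T H : R) (B : R -> {RV P >-> R}) :=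
  [/\ gaussian_process B `[0, T],
      (forall t, 0 <= t <= T -> ('E_P[B t] = 0)%E),
      (forall s t, 0 <= s <= T -> 0 <= t <= T ->
        covariance P (B s) (B t)
        = (2^-1 * (s `^ (2 * H) + t `^ (2 * H) - `|t - s| `^ (2 * H)))%:E) &
      (forall w, {within `[0, T], continuous (fun t => B t w)})].

(* The integral with respect to B is the pathwise Riemann-Stieltjes one. *)
Definition fractional_OU (T alpha Y0 : R) (B : R -> {RV P >-> R})
    (Y : R -> Omega -> R) :=
  forall t w, 0 <= t <= T ->
    is_RS_integral (fun s => expR (- alpha * (t - s))) (fun s => B s w) 0 t
      (Y t w - Y0 * expR (- alpha * t)).

(* The natural filtration of the pair (W, B). *)
Definition joint_filtration (W B : R -> {RV P >-> R}) (t : R) :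
    set (set Omega) :=
  <<s proc_events (fun u => W u : Omega -> R) `[0, t]
      `|` proc_events (fun u => B u : Omega -> R) `[0, t] >>.

(* (s, xi) stands for the process equal to xi_i on ]x_i, x_(i+1)]. *)
Definition elementary (F : R -> set (set Omega)) (t : R)
    (s : seq R) (xi : nat -> Omega -> R) :=
  itv_partition 0 t s /\
  forall i, (i < size s)%N ->
    (exists M : R, forall w, `|xi i w| <= M) /\
    (forall A : set R, measurable A -> F (node 0 s i) (xi i @^-1` A)).

Definition elem_proc (s : seq R) (xi : nat -> Omega -> R)
    (u : R) (w : Omega) : R :=
  \sum_(i < size s) xi i w * \1_(`]node 0 s i, node 0 s i.+1]%classic) u.

Definition elem_int (W : R -> Omega -> R) (s : seq R)
    (xi : nat -> Omega -> R) (w : Omega) : R :=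
  \sum_(i < size s) xi i w * (W (node 0 s i.+1) w - W (node 0 s i) w).

Definition ito_approx (F : R -> set (set Omega)) (phi : R -> Omega -> R)
    (t : R) (s : nat -> seq R) (xi : nat -> nat -> Omega -> R) :=
  (forall n, elementary F t (s n) (xi n)) /\
  (fun n => \int[P]_w \int[lebesgue_measure]_(u in `[0%R, t])
     ((elem_proc (s n) (xi n) u w - phi u w) ^+ 2)%:E)%E @ \oo --> 0%E.

(* I is the Ito integral of phi over [0, t]: the L^2(P)-limit of the integrals
   of elementary F-adapted processes converging to phi in L^2(du x P).  By the
   Ito isometry the limit does not depend on the approximating sequence, and a
   sequence exists whenever phi is progressively measurable and
   square-integrable. *)
Definition is_ito_integral (F : R -> set (set Omega)) (W : R -> Omega -> R)
    (phi : R -> Omega -> R) (t : R) (I : {RV P >-> R}) :=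
  (exists s xi, ito_approx F phi t s xi) /\
  (forall s xi, ito_approx F phi t s xi ->
    (fun n => \int[P]_w ((elem_int W (s n) (xi n) w - I w) ^+ 2)%:E)%E
      @ \oo --> 0%E).

End processes.

Section conditions.
Context {R : realType}.

(* Only the restriction of f to [0, +oo[ matters; the discontinuities of f are
   not restricted beyond what Riemann integrability imposes. *)
Definition condition_A (f : R -> R) :=
  [/\ (forall x, 0 <= x -> 0 <= f x),
      measurable_fun (`[0, +oo[ : set R) f,
      (exists C p : R, [/\ 0 < C, 0 < p &
         forall x, 0 <= x -> f x <= C * (1 + x `^ p)]) &
      (forall a b, 0 <= a -> a <= b -> riemann_integrable f a b)].

Definition condition_B (sigma : R -> R) :=
  exists2 C : R, 0 < C &
  [/\ (exists2 smin : R, 0 < smin & forall x, smin <= sigma x),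
      (exists2 q : R, 0 < q < 1 &
         forall x, sigma x <= C * (1 + `|x| `^ q)),
      (exists2 r : R, 0 < r <= 1 &
         forall x y, `|sigma x - sigma y| <= C * `|x - y| `^ r) &
      [/\ continuous sigma,
          {ae lebesgue_measure, forall x : R, derivable sigma x 1} &
          exists2 q' : R, 0 < q' &
            {ae lebesgue_measure, forall x : R,
              `|derive1 sigma x| <= C * (1 + `|x| `^ q')}]].

End conditions.

Section functionals.
Context {R : realType} {Omega : Type}.
Variables (T b S0 : R) (sigma : R -> R) (Y : R -> Omega -> R).

Definition sigmaY2 (t : R) (w : Omega) : R :=
  (\int[lebesgue_measure]_(s in `[0, t]) (sigma (Y s w) ^+ 2))%R.

Definition sigmaY (w : Omega) : R := Num.sqrt (sigmaY2 T w).

Definition sigmaZ2 (w : Omega) : R :=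
  (\int[lebesgue_measure]_(s in `[0, T]) (sigma (Y s w) ^- 2))%R.

Definition mY (w : Omega) : R := ln S0 + b * T - 2^-1 * sigmaY2 T w.

Definition DeltaYZ (w : Omega) : R := sigmaY2 T w * sigmaZ2 w - T ^+ 2.

End functionals.

(* Main.v *)
(** Conditionally on [B] the volatility path is deterministic and [W] is still a
    Wiener process, so [X_T] has the law of [m_Y + sigma_Y Z] with [Z] standard
    normal and independent of [B].  For elementary integrands that depend on [B]
    only, this is obtained by peeling off the increments of [W] one at a time,
    using the rotation invariance of the Gaussian law.  The general case follows
    by L^2-approximation, since a law on the line is determined by its integrals
    of bounded Lipschitz functions.  Pathwise Gaussian integration by parts then
    replaces [g] by its primitive [G], which gives the last expression, and Fubini
    turns it into the middle one.

    The integrability behind these steps is [E exp(c sigma_Y^2) < oo] for every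
    [c]: as [sigma] grows sublinearly, [sigma(y)^2 <= A + e y^2] with [e]
    arbitrarily small; Jensen moves the exponential inside the time integral, and
    [E exp(l B_t^2)] is finite for small [l].  Integration by parts in the
    Riemann-Stieltjes integral expresses [Y] explicitly through the path of [B]. *)

From HB Require Import structures.
Require Import Defs.
From mathcomp Require Import all_boot all_order all_algebra.
From mathcomp Require Import all_classical all_reals all_analysis.
From mathcomp Require Import measurable_realfun ring lra.

Set Implicit Arguments.
Unset Strict Implicit.
Unset Printing Implicit Defensive.

Import Order.TTheory GRing.Theory Num.Theory.
Import numFieldNormedType.Exports.
Import HBNNSimple.

Local Open Scope classical_set_scope.
Local Open Scope ring_scope.

(** * Gaussian integrals *)

(** No conditional law is ever formed. Nonnegativity keeps them free of integrability questions.
    Moments enter only for the square integrability of the volatility and for the last Fubini, where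
    signs matter. The Ito integral is known only through sequences adapted to the pair of [W] and
    [B], whereas the peeling wants integrands that are functions of [B] alone. Truncated samples of
    the volatility on uniform grids are both, since Y_t is a function of [B] up to time t. Given
    [B], the variance of their integral is the time integral of the squared step path, so the L^2
    distance that controls the Ito integral also controls the standard deviation, by the reverse
    triangle inequality. An offset [U] depending on [B] accompanies the integral throughout: m_Y and
    sigma_Y depend on the same path, so the law of the integral alone would not determine that of
    X_T. *)

Section integral_tools.
Local Open Scope ereal_scope.
Context {R : realType}.
Notation leb := (@lebesgue_measure R).

(** Simple functions increasing to [f] and monotone convergence on both sides leave indicators of
    measurable sets, where the claim is the hypothesis on [nu]. *)
Lemma ge0_integral_density d (T : measurableType d)
    (mu nu : {measure set T -> \bar R}) (p : T -> R) (f : T -> \bar R) :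
  measurable_fun [set: T] p -> (forall x, (0 <= p x)%R) ->
  (forall A, measurable A -> nu A = \int[mu]_(x in A) (p x)%:E) ->
  measurable_fun [set: T] f -> (forall x, 0 <= f x) ->
  \int[nu]_x f x = \int[mu]_x (f x * (p x)%:E).
Proof.
move=> mp p0 nuE mf f0.
have mpE : measurable_fun [set: T] (EFin \o p) by exact/measurable_EFinP.
pose f_ := nnsfun_approx measurableT mf.
transitivity (limn (fun n => \int[nu]_x (f_ n x)%:E)).
  rewrite -monotone_convergence//=.
  - apply: eq_integral => x _; apply/esym/cvg_lim => //=.
    by apply: cvg_nnsfun_approx.
  - by move=> n; exact/measurable_EFinP.
  - by move=> n x _; rewrite lee_fin.
  - by move=> x _ m n mn; rewrite lee_fin; exact/lefP/nd_nnsfun_approx.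
transitivity (limn (fun n => \int[mu]_x ((f_ n x)%:E * (p x)%:E))); last first.
  rewrite -monotone_convergence//=.
  - apply: eq_integral => x _; apply/cvg_lim => //=.
    by apply: cvgeZr => //; exact: cvg_nnsfun_approx.
  - by move=> n; apply: emeasurable_funM => //; exact/measurable_EFinP.
  - by move=> n x _; rewrite mule_ge0 ?lee_fin.
  - move=> x _ m n mn; apply: lee_wpmul2r; rewrite ?lee_fin//.
    exact/lefP/nd_nnsfun_approx.
congr (limn _); apply/funext => n.
under eq_integral do rewrite fimfunE -fsumEFin//.
rewrite ge0_integral_fsum//; last 2 first.
  - by move=> r; exact/measurable_EFinP/measurable_funM.
  - by move=> r x _; rewrite nnfun_muleindic_ge0.
under [RHS]eq_integral.
  move=> x _; rewrite fimfunE -fsumEFin// ge0_mule_fsuml; last first.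
    by move=> r; rewrite nnfun_muleindic_ge0.
  over.
rewrite [RHS]ge0_integral_fsum//; last 2 first.
  - move=> r; apply: emeasurable_funM => //.
    by exact/measurable_EFinP/measurable_funM.
  - by move=> r x _; rewrite mule_ge0 ?lee_fin//; exact: nnfun_muleindic_ge0.
apply: eq_fsbigr => r _.
have mA : measurable (f_ n @^-1` [set r]) by exact: measurable_funPTI.
rewrite integralZl_indic_nnsfun// integral_indic// setIT nuE//.
(* A nonnegative simple function has no negative value, so both sides vanish here. *)
have [r0|r0] := ltP r 0%R.
  rewrite preimage_nnfun0// integral_set0 mule0.
  by rewrite integral0_eq// => x _; rewrite indic0 mulr0 mul0e.
rewrite integral_mkcond -ge0_integralZl//; last 2 first.
  - apply/(measurable_restrictT _ mA).1 => //.
    exact: measurable_funTS.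
  - by move=> x _; rewrite patchE; case: ifP => // _; rewrite lee_fin.
apply: eq_integral => x _; rewrite patchE indicE; case: ifP => _.
  by rewrite mulr1.
by rewrite mulr0 mule0 mul0e.
Qed.

(** The measure [s] times the image of Lebesgue measure under z -> m + s z gives every interval ]a,
    b] its length, so it is Lebesgue measure. *)
Lemma ge0_integral_affine (m s : R) (f : R -> \bar R) : (0 < s)%R ->
  measurable_fun [set: R] f -> (forall x, 0 <= f x) ->
  \int[leb]_x f x = s%:E * \int[leb]_z f (m + s * z)%R.
Proof.
move=> s0 mf f0.
have mphi : measurable_fun [set: measurableTypeR R]
    (fun z : measurableTypeR R => (m + s * z)%R : measurableTypeR R).
  by apply: measurable_funD => //; exact: measurable_funM.
pose pnu := (mscale (NngNum (ltW s0)) (pushforward leb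
  (fun z : measurableTypeR R => (m + s * z)%R : measurableTypeR R))
  : {measure set (measurableTypeR R) -> \bar R}).
pose nu := pnu mphi.
have nuE (A : set R) : measurable A -> leb A = nu A.
  apply: (@lebesgue_measure_unique R nu) => _ [[a b]] _ <-.
  change (leb `]a, b]%classic = s%:E * leb ((fun z : R => (m + s * z)%R) @^-1` `]a, b]%classic)).
  have -> : (fun z : R => (m + s * z)%R) @^-1` `]a, b] = `]((a - m) / s)%R, ((b - m) / s)%R]%classic.
    apply/seteqP; split => z /=; rewrite !in_itv/= ltr_pdivrMr// ler_pdivlMr// => /andP[];
      rewrite ?ltrBlDl ?lerBrDl [(z * s)%R]mulrC => -> ->//.
  rewrite !lebesgue_measure_itv/= !lte_fin ltr_pM2r ?invr_gt0// ltrD2r.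
  case: ifP => _; last by rewrite mule0.
  rewrite -!EFinB -EFinM; congr EFin; field; exact: lt0r_neq0.
rewrite (eq_measure_integral nu); last by move=> A mA _; exact: nuE.
rewrite ge0_integral_mscale//; congr (_ * _).
by rewrite ge0_integral_pushforward//= preimage_setT.
Qed.

Lemma integral_affine (m s : R) (f : R -> \bar R) : (0 < s)%R ->
  leb.-integrable [set: R] f ->
  \int[leb]_x f x = s%:E * \int[leb]_z f (m + s * z)%R.
Proof.
move=> s0 intf.
have mf := measurable_int _ intf.
have pf := integrable_pos_fin_num measurableT intf.
have nf := integrable_neg_fin_num measurableT intf.
rewrite integralE [in RHS]integralE muleBr//; last first.
  have/(_ s0) H := @ge0_integral_affine m s f^\+.
  have K : \int[leb]_z f^\+ (m + s * z)%R \is a fin_num.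
    move: pf; rewrite H//; last exact: measurable_funepos.
    rewrite !ge0_fin_numE ?mule_ge0 ?integral_ge0 ?lee_fin ?(ltW s0)//.
    by rewrite ltey => /eqP h; rewrite ltey; apply/eqP => h'; apply: h; rewrite h' gt0_muley// lte_fin.
  apply: fin_num_adde_defr.
  rewrite (_ : \int[_]_x _ = \int[leb]_z f^\+ (m + s * z)%R)//.
  by apply: eq_integral => z _; rewrite !funeposE.
congr (_ - _); rewrite (@ge0_integral_affine m s)//.
- by congr (_ * _); apply: eq_integral => z _; rewrite !funeposE.
- exact: measurable_funepos.
- by congr (_ * _); apply: eq_integral => z _; rewrite !funenegE.
- exact: measurable_funeneg.
Qed.

End integral_tools.
Section gaussian.
Context {R : realType}.
Notation leb := (@lebesgue_measure R).
Notation stdN := (@normal_prob R 0 1).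
Implicit Types (m s a b x z : R).

Lemma normal_pdf_expE m s x : 0 < s ->
  normal_pdf m s x
  = (2 * pi) `^ (- 2^-1) / s * expR (- ((x - m) ^+ 2 / (2 * s ^+ 2))).
Proof.
move=> s0; rewrite /normal_pdf gt_eqF// /normal_fun /normal_peak.
congr (_ * expR _); last by rewrite -[s ^+ 2 *+ 2]mulr_natl; field; exact: lt0r_neq0.
rewrite -mulrnAr sqrtrM ?sqr_ge0// sqrtr_sqr gtr0_norm// invfM mulrC.
by rewrite powRN powR12_sqrt ?mulr_ge0 ?pi_ge0// mulr_natl.
Qed.

Lemma normal_pdf_gauss z :
  normal_pdf 0 1 z = (2 * pi) `^ (- 2^-1) * expR (- (z ^+ 2 / 2)).
Proof. by rewrite normal_pdf_expE// divr1 subr0 expr1n mulr1. Qed.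

Lemma normal_pdf_affine m s z : 0 < s ->
  normal_pdf m s (m + s * z) = s^-1 * normal_pdf 0 1 z.
Proof.
move=> s0; rewrite normal_pdf_expE// normal_pdf_gauss [RHS]mulrA [X in _ = X * _]mulrC.
congr (_ * expR _); field; exact: lt0r_neq0.
Qed.

Local Open Scope ereal_scope.

Lemma ge0_integral_normal_pdf m s (f : R -> \bar R) :
  measurable_fun [set: R] f -> (forall x, 0 <= f x) ->
  \int[normal_prob m s]_x f x = \int[leb]_x (f x * (normal_pdf m s x)%:E).
Proof.
move=> mf f0; apply: ge0_integral_density => //.
- exact: measurable_normal_pdf.
- by move=> x; exact: normal_pdf_ge0.
Qed.

(** The Jacobian [s] of x = m + s z cancels the [s^-1] of [normal_pdf_affine], so Gaussian integrals
    can all be moved to the standard law. *)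
Lemma ge0_integral_normal_prob m s (f : R -> \bar R) : (0 < s)%R ->
  measurable_fun [set: R] f -> (forall x, 0 <= f x) ->
  \int[normal_prob m s]_x f x = \int[stdN]_z f (m + s * z)%R.
Proof.
move=> s0 mf f0; rewrite (ge0_integral_normal_pdf _ _ mf f0).
rewrite (@ge0_integral_normal_pdf 0 1 (fun z => f (m + s * z)%R)); last 2 first.
- by apply: measurableT_comp => //; apply: measurable_funD => //; exact: measurable_funM.
- by move=> z; exact: f0.
rewrite (@ge0_integral_affine _ m s)//; last 2 first.
- by apply: emeasurable_funM => //; apply/measurable_EFinP; exact: measurable_normal_pdf.
- by move=> x; rewrite mule_ge0// lee_fin normal_pdf_ge0.
rewrite -ge0_integralZl//=; last 3 first.
- apply: emeasurable_funM; last apply/measurable_EFinP.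
    by apply: measurableT_comp => //; apply: measurable_funD => //; exact: measurable_funM.
  apply: measurableT_comp; first exact: measurable_normal_pdf.
  by apply: measurable_funD => //; exact: measurable_funM.
- by move=> x _; rewrite mule_ge0// lee_fin normal_pdf_ge0.
- by rewrite lee_fin ltW.
apply: eq_integral => z _; rewrite normal_pdf_affine// muleCA -EFinM.
by rewrite mulrA divff ?mul1r// gt_eqF.
Qed.

(* Completing the square in [z]. *)
Lemma normal_pdfM a b z y : (0 < a)%R -> (0 < b)%R ->
  let c := Num.sqrt (a ^+ 2 + b ^+ 2)%R in
  (normal_pdf (a * z) b y * normal_pdf 0 1 z
   = normal_pdf 0 c y * normal_pdf (a * y / c ^+ 2) (b / c) z)%R.
Proof.
move=> a0 b0 c.
have ab0 : (0 < a ^+ 2 + b ^+ 2)%R by rewrite addr_gt0// exprn_gt0.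
have c0 : (0 < c)%R by rewrite sqrtr_gt0.
have cE : (c ^+ 2 = a ^+ 2 + b ^+ 2)%R by rewrite sqr_sqrtr// ltW.
rewrite !normal_pdf_expE ?divr_gt0//.
rewrite mulrACA [RHS]mulrACA -!expRD; congr (_ * expR _)%R.
  by field; rewrite !lt0r_neq0.
rewrite !expr_div_n cE; field; rewrite !lt0r_neq0//.
Qed.

(** With densities on both integrals, Tonelli exchanges them, [normal_pdfM] isolates a normal
    density in [z], and that density integrates to 1. Vanishing coefficients are split off first
    because they leave no density. *)
Lemma gauss_rotation a b (h : R -> \bar R) : (0 <= a)%R -> (0 <= b)%R ->
  measurable_fun [set: R] h -> (forall x, 0 <= h x) ->
  \int[stdN]_z \int[stdN]_y h (a * z + b * y)%R
  = \int[stdN]_z h (Num.sqrt (a ^+ 2 + b ^+ 2) * z)%R.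
Proof.
move=> a0 b0 mh h0.
have mh1 (c e : R) : measurable_fun [set: R] (fun z => h (e + c * z)%R).
  by apply: measurableT_comp => //; apply: measurable_funD => //; exact: measurable_funM.
move: a0; rewrite le_eqVlt => /predU1P[<-|a0].
  under eq_integral do under eq_integral do rewrite mul0r add0r.
  rewrite integral_cst//= probability_setT mule1 expr0n/= add0r sqrtr_sqr.
  by rewrite ger0_norm.
move: b0; rewrite le_eqVlt => /predU1P[<-|b0].
  under eq_integral do under eq_integral do rewrite mul0r addr0.
  rewrite expr0n/= addr0 sqrtr_sqr gtr0_norm//.
  by apply: eq_integral => z _; rewrite integral_cst//= probability_setT mule1.
set c := Num.sqrt _.
have c0 : (0 < c)%R by rewrite sqrtr_gt0 addr_gt0// exprn_gt0.
transitivity (\int[stdN]_z \int[leb]_y (h y * (normal_pdf (a * z) b y)%:E)).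
  apply: eq_integral => z _.
  by rewrite -(ge0_integral_normal_prob (a * z) b0 mh h0) (ge0_integral_normal_pdf _ _ mh h0).
have mpdf : measurable_fun [set: R * R] (fun p : R * R => normal_pdf (a * p.1) b p.2).
  apply: (eq_measurable_fun (fun p : R * R => (2 * pi) `^ (- 2^-1) / b
      * expR (- ((p.2 - a * p.1) ^+ 2 / (2 * b ^+ 2))))%R) => [p _|].
    by rewrite normal_pdf_expE.
  apply: measurable_funM => //; apply: measurableT_comp => //.
  apply: measurableT_comp => //; apply: measurable_funM => //.
  apply: measurable_funX; apply: measurable_funB => //.
  exact: measurable_funM.
have mF : measurable_fun [set: R * R] (fun p : R * R => h p.2 * (normal_pdf (a * p.1) b p.2)%:E).
  by apply: emeasurable_funM; [exact: measurableT_comp|exact/measurable_EFinP].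
have F0 (p : R * R) : 0 <= h p.2 * (normal_pdf (a * p.1) b p.2)%:E.
  by rewrite mule_ge0// lee_fin normal_pdf_ge0.
rewrite (@ge0_integral_normal_pdf _ _ (fun z => \int[leb]_y (h y * (normal_pdf (a * z) b y)%:E))); last 2 first.
- exact: (@measurable_fun_fubini_tonelli_F _ _ _ _ _ leb _ mF F0).
- by move=> z; apply: integral_ge0 => y _; exact: (F0 (z, y)).
transitivity (\int[leb]_z \int[leb]_y
    (h y * (normal_pdf (a * z) b y)%:E * (normal_pdf 0 1 z)%:E)).
  apply: eq_integral => z _; rewrite ge0_integralZr//.
  - exact: (measurableT_comp mF (pair1_measurable z)).
  - by move=> y _; exact: (F0 (z, y)).
  - by rewrite lee_fin normal_pdf_ge0.
transitivity (\int[leb]_y \int[leb]_z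
    (h y * (normal_pdf (a * z) b y)%:E * (normal_pdf 0 1 z)%:E)).
  apply: (@fubini_tonelli _ _ _ _ _ leb leb (fun p : R * R =>
    h p.2 * (normal_pdf (a * p.1) b p.2)%:E * (normal_pdf 0 1 p.1)%:E)).
    apply: emeasurable_funM => //; apply/measurable_EFinP.
    by apply: measurableT_comp => //; exact: measurable_normal_pdf.
  by move=> p; rewrite mule_ge0// lee_fin normal_pdf_ge0.
transitivity (\int[leb]_y (h y * (normal_pdf 0 c y)%:E)); last first.
  rewrite -(ge0_integral_normal_pdf _ _ mh h0) (ge0_integral_normal_prob _ c0 mh h0).
  by under eq_integral do rewrite add0r.
apply: eq_integral => y _ /=.
transitivity (\int[leb]_z (h y * (normal_pdf 0 c y)%:E * (normal_pdf (a * y / c ^+ 2) (b / c) z)%:E)).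
  by apply: eq_integral => z _; rewrite -!muleA -!EFinM normal_pdfM.
rewrite ge0_integralZl//=.
- by rewrite integral_normal_pdf mule1.
- by apply/measurable_EFinP; exact: measurable_normal_pdf.
- by move=> z _; rewrite lee_fin normal_pdf_ge0.
- by rewrite mule_ge0// lee_fin normal_pdf_ge0.
Qed.

(** Tilting by exp(a z) turns the standard normal density into exp(a^2 / 2) times the density with
    mean [a]. *)
Lemma gauss_integral_expR a :
  \int[stdN]_z (expR (a * z))%:E = (expR (a ^+ 2 / 2))%:E.
Proof.
rewrite ge0_integral_normal_pdf//; last first.
  by apply/measurable_EFinP; apply: measurableT_comp => //; exact: measurable_funM.
transitivity (\int[leb]_z ((expR (a ^+ 2 / 2))%:E * (normal_pdf a 1 z)%:E)).
  apply: eq_integral => z _; rewrite -!EFinM; congr EFin.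
  rewrite !normal_pdf_expE// divr1 mulrCA -expRD [RHS]mulrCA -expRD.
  by congr (_ * expR _)%R; field.
rewrite ge0_integralZl//=.
- by rewrite integral_normal_pdf mule1.
- by apply/measurable_EFinP; exact: measurable_normal_pdf.
- by move=> z _; rewrite lee_fin normal_pdf_ge0.
Qed.

Lemma gauss_integral_expR_norm a :
  \int[stdN]_z (expR (a * `|z|))%:E <= (2 * expR (a ^+ 2 / 2))%:E.
Proof.
have mE (c : R) : measurable_fun [set: R] (fun z => (expR (c * z))%:E).
  by apply/measurable_EFinP; apply: measurableT_comp => //; exact: measurable_funM.
apply: (@le_trans _ _ (\int[stdN]_z ((expR (a * z))%:E + (expR (- a * z))%:E))).
  apply: ge0_le_integral => //.
  - by apply/measurable_EFinP; apply: measurableT_comp => //; apply: measurable_funM => //; exact: measurableT_comp.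
  - by apply: emeasurable_funD; exact: mE.
  - move=> z _; rewrite -EFinD lee_fin; have [z0|z0] := leP 0%R z.
      by rewrite ger0_norm// lerDl expR_ge0.
    by rewrite ltr0_norm// mulrN -mulNr lerDr expR_ge0.
rewrite ge0_integralD//; [|exact: mE|exact: mE].
by rewrite !gauss_integral_expR sqrrN -EFinD lee_fin mulr_natl mulr2n.
Qed.

(** The factor exp(z^2 / 4) halves the Gaussian exponent, which leaves the density of variance 2;
    the square root of 2 is the ratio of the two peaks. *)
Lemma gauss_integral_expR_sqr :
  \int[stdN]_z (expR (z ^+ 2 / 4))%:E = (Num.sqrt 2)%:E.
Proof.
have s2 : (0 < Num.sqrt 2 :> R)%R by rewrite sqrtr_gt0.
rewrite ge0_integral_normal_pdf//; last first.
  apply/measurable_EFinP; apply: measurableT_comp => //; apply: measurable_funM => //.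
transitivity (\int[leb]_z ((Num.sqrt 2)%:E * (normal_pdf 0 (Num.sqrt 2) z)%:E)).
  apply: eq_integral => z _; rewrite -!EFinM; congr EFin.
  rewrite !normal_pdf_expE// divr1 sqr_sqrtr// [LHS]mulrCA -expRD [RHS]mulrA.
  rewrite (mulrC (Num.sqrt 2)) divfK ?gt_eqF//.
  by congr (_ * expR _)%R; field.
rewrite ge0_integralZl//=.
- by rewrite integral_normal_pdf mule1.
- by apply/measurable_EFinP; exact: measurable_normal_pdf.
- by move=> z _; rewrite lee_fin normal_pdf_ge0.
Qed.

End gaussian.

(** * Gaussian integration by parts *)

Section gauss_ibp.
Context {R : realType}.
Notation leb := (@lebesgue_measure R).
Local Notation gss := (fun z : R => expR (- (z ^+ 2 / 2))).
Local Notation gs z := (expR (- (z ^+ 2 / 2))).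

Lemma measurable_gss : measurable_fun [set: R] gss.
Proof.
apply: measurableT_comp => //; apply: measurableT_comp => //.
by apply: measurable_funM => //; exact: measurable_funX.
Qed.

Lemma is_derive_gss (z : R) : is_derive z 1 (fun x => - gs x) (z * gs z).
Proof.
have h1 : is_derive z 1 (fun x : R => - (x ^+ 2 / 2)) (- z).
  have -> : (fun x : R => - (x ^+ 2 / 2)) = (- 2^-1) \*: (@id R ^+ 2).
    by apply/funext => x; rewrite /= exprfctE /GRing.scale/= mulNr mulrC.
  have := is_deriveZ (- 2^-1) (is_deriveX 2 (is_derive_id z 1)).
  by congr is_derive; rewrite /GRing.scale/= expr1; field.
have h2 : is_derive z 1 gss (gs z * - z).
  exact: (@is_derive1_comp _ expR (fun x : R => - (x ^+ 2 / 2)) z _ _ (is_derive_expR _) h1).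
have := is_deriveN h2; rewrite mulrN opprK mulrC; exact.
Qed.

Lemma cvg_gss : gs z @[z --> +oo] --> (0 : R).
Proof.
apply: (cvg_comp (fun x : R => x ^+ 2 / 2) (fun x => expR (- x))); last exact: cvgr_expR.
apply: gt0_cvgMly => //; exact: cvgr_expr2.
Qed.

Lemma continuous_gss : continuous gss.
Proof.
move=> z; apply: (cvg_comp _ expR); last exact: continuous_expR.
apply: cvgN; apply: cvgM; last exact: cvg_cst.
exact: exprn_continuous.
Qed.

Lemma continuous_gss_mul : continuous (fun z : R => z * gs z).
Proof.
by move=> z; apply: cvgM; [exact: cvg_id|exact: continuous_gss].
Qed.

Local Open Scope ereal_scope.

Lemma integral_gss_tail (y : R) : (0 <= y)%R ->
  \int[leb]_(z in `[y, +oo[) (z * gs z)%:E = (gs y)%:E.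
Proof.
move=> y0; rewrite (@ge0_continuous_FTC2y _ _ (fun x => - gs x)%R y 0).
- by rewrite add0e EFinN oppeK.
- by move=> z yz; rewrite mulr_ge0 ?expR_ge0// (le_trans y0).
- exact/continuous_subspaceT/continuous_gss_mul.
- by rewrite -oppr0; apply: cvgN; exact: cvg_gss.
- by move=> z _; exact: (@ex_derive _ _ _ _ _ _ _ (is_derive_gss z)).
- by apply: cvg_at_right_filter; apply: cvgN; exact: continuous_gss.
- by move=> z _; rewrite derive1E; exact: (@derive_val _ _ _ _ _ _ _ (is_derive_gss z)).
Qed.

(** Writing exp(-y^2 / 2) as its tail integral over z >= y and exchanging integrals on the triangle
    0 <= y <= z proves integration by parts without any continuity of [h], so payoffs with jumps are
    covered. *)
Lemma ge0_gauss_ibp_half (h : R -> R) :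
  measurable_fun [set: R] h -> (forall x, (0 <= h x)%R) ->
  \int[leb]_(z in `[0%R, +oo[)
     ((\int[leb]_(y in `[0%R, z]) (h y)%:E) * (z * gs z)%:E)
  = \int[leb]_(y in `[0%R, +oo[) (h y * gs y)%:E.
Proof.
move=> mh h0.
pose F (p : R * R) := ((if (0 <= p.2 <= p.1)%R then h p.2 * (p.1 * gss p.1) else 0)%R)%:E.
have F0 p : 0 <= F p.
  rewrite lee_fin; case: ifP => // /andP[p0 p12].
  by rewrite !mulr_ge0 ?expR_ge0// (le_trans p0).
have mF : measurable_fun [set: R * R] F.
  apply/measurable_EFinP; apply: measurable_fun_ifT => //.
    by apply: measurable_and; apply: measurable_fun_ler.
  apply: measurable_funM; first exact: measurableT_comp.
  by apply: measurable_funM => //; apply: (measurableT_comp measurable_gss).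
transitivity (\int[leb]_z \int[leb]_y F (z, y)).
  rewrite integral_mkcond; apply: eq_integral => z _; rewrite patchE.
  case: ifPn => [|]; rewrite ?inE ?notin_setE/= in_itv/= andbT => zP; last first.
    rewrite integral0_eq// => y _; rewrite /F/=; case: ifP => // /andP[y0 yz].
    by exfalso; apply: zP; exact: le_trans yz.
  rewrite -ge0_integralZr//; last 3 first.
  - by apply/measurable_EFinP/measurable_funTS.
  - by move=> y _; rewrite lee_fin.
  - by rewrite lee_fin mulr_ge0 ?expR_ge0.
  rewrite integral_mkcond; apply: eq_integral => y _; rewrite patchE /F/= mem_setE in_itv/=.
  by case: ifP.
rewrite (@fubini_tonelli _ _ _ _ _ leb leb)//.
rewrite [RHS]integral_mkcond; apply: eq_integral => y _; rewrite patchE.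
case: ifPn => [|]; rewrite ?inE ?notin_setE/= in_itv/= andbT => yP; last first.
  by rewrite integral0_eq// => z _; rewrite /F/=; case: ifP => // /andP[y0 _].
transitivity (\int[leb]_(z in `[y, +oo[) ((h y)%:E * (z * gs z)%:E)).
  rewrite [RHS]integral_mkcond; apply: eq_integral => z _; rewrite patchE /F/= mem_setE in_itv/= andbT yP/=.
  by case: ifP.
rewrite ge0_integralZl//.
- by rewrite integral_gss_tail.
- apply/measurable_EFinP/measurable_funTS; apply: measurable_funM => //.
  exact: measurable_gss.
- move=> z; rewrite /= in_itv/= andbT => yz; rewrite lee_fin mulr_ge0 ?expR_ge0//.
  exact: le_trans yz.
- by rewrite lee_fin.
Qed.

Lemma ge0_integral_fold (f : R -> \bar R) :
  measurable_fun [set: R] f -> (forall x, 0 <= f x) ->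
  \int[leb]_x f x
  = \int[leb]_(x in `[0%R, +oo[) f x + \int[leb]_(x in `[0%R, +oo[) f (- x)%R.
Proof.
move=> mf f0.
rewrite (ge0_integration_by_substitution0 (f := fun x => f (- x)%R))//; last first.
  exact: measurableT_comp.
under [X in _ + X]eq_integral do rewrite opprK.
rewrite -(integral_itv_obnd_cbnd (measurable_funTS mf)) addeC -ge0_integral_setU//.
- by rewrite -itv_bndbnd_setU// set_itvE.
- exact: measurable_funTS.
- apply/disj_set2P; rewrite -subset0 => x [] /=; rewrite !in_itv/= andbT => x0.
  by rewrite ltNge x0.
Qed.

Lemma integral_gss_odd : \int[leb]_z (z * gs z)%:E = 0.
Proof.
pose p (z : R) := (z * gs z)%:E.
have mz : measurable_fun [set: R] p.
  by apply/measurable_EFinP; apply: measurable_funM => //; exact: measurable_gss.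
change (\int[leb]_z p z = 0).
have Hp := ge0_integral_fold (measurable_funepos mz) (funepos_ge0 _).
have Hn := ge0_integral_fold (measurable_funeneg mz) (funeneg_ge0 _).
have E1 : \int[leb]_(x in `[0%R, +oo[) p^\+ x = \int[leb]_(x in `[0%R, +oo[) p^\- (- x)%R.
  by apply: eq_integral => x _; rewrite funeposE funenegE /p sqrrN mulNr EFinN oppeK.
have E2 : \int[leb]_(x in `[0%R, +oo[) p^\+ (- x)%R = \int[leb]_(x in `[0%R, +oo[) p^\- x.
  by apply: eq_integral => x _; rewrite funeposE funenegE /p sqrrN mulNr EFinN.
(* Equal positive and negative parts cancel only if they are finite; the half-line integral is 1 by
   [integral_gss_tail]. *)
rewrite integralE Hp Hn E1 E2 [X in X - _]addeC subee//.
suff : \int[leb]_x p^\- x \is a fin_num by rewrite Hn addeC.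
rewrite Hn -E1 addeC.
have K : \int[leb]_(x in `[0%R, +oo[) p^\+ x = 1.
  transitivity (\int[leb]_(x in `[0%R, +oo[) (x * gs x)%:E).
    apply: eq_integral => x; rewrite inE/= in_itv/= andbT => x0.
    by rewrite funeposE /p; apply/max_idPl; rewrite lee_fin mulr_ge0 ?expR_ge0.
  by rewrite integral_gss_tail// expr0n/= mul0r oppr0 expR0.
have K' : \int[leb]_(x in `[0%R, +oo[) p^\- x = 0.
  apply: integral0_eq => x; rewrite /= in_itv/= andbT => x0.
  rewrite funenegE /p; apply/max_idPr; rewrite -EFinN lee_fin oppr_le0.
  by rewrite mulr_ge0 ?expR_ge0.
by rewrite K K' adde0.
Qed.

End gauss_ibp.

(** * Increments of the primitive as integrals over [0, z] *)

Section primitive.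
Context {R : realType}.
Notation leb := (@lebesgue_measure R).
Variable g : R -> R.
Hypothesis mg : measurable_fun [set: R] g.
Hypothesis g0 : forall x, 0 <= g x.
Hypothesis ig : forall a b : R, leb.-integrable `[a, b] (EFin \o g).

Lemma Rintegral_chasles (a c b : R) : a <= c -> c <= b ->
  (\int[leb]_(x in `[a, b]) g x
   = \int[leb]_(x in `[a, c]) g x + \int[leb]_(x in `[c, b]) g x)%R.
Proof.
move=> ac cb.
have := @Rintegral_itvB R g (BLeft a) (BRight b) c (ig a b).
rewrite !bnd_simp => /(_ ac cb) H.
rewrite -[X in (_ = _ + X)%R]Rintegral_itv_obnd_cbnd; last first.
  apply: (integrableS _ _ _ (ig a b)) => //.
  by apply: subset_itvr; rewrite bnd_simp.
by rewrite -H addrC subrK.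
Qed.

Lemma primitive0B (a b : R) : a <= b ->
  (primitive0 g b - primitive0 g a = \int[leb]_(x in `[a, b]) g x)%R.
Proof.
move=> ab; rewrite /primitive0; have [a0|a0] := leP 0 a.
  by rewrite (le_trans a0 ab) (@Rintegral_chasles 0 a b)// addrAC subrr add0r.
have [b0|b0] := leP 0 b.
  by rewrite (@Rintegral_chasles a 0 b)// ?(ltW a0)// opprK addrC.
by rewrite (@Rintegral_chasles a b 0)// ?(ltW b0)// opprK addrC addrK.
Qed.

(** This is the form in which [ge0_gauss_ibp_half] applies: up to the factor [s], the increment is
    the integral over [0, z] of h(y) = g(m + s y). *)
Lemma primitive0_affine (m s z : R) : 0 < s -> 0 <= z ->
  (primitive0 g (m + s * z) - primitive0 g m)%:E
  = (s%:E * \int[leb]_(y in `[0%R, z]) (g (m + s * y))%:E)%E.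
Proof.
move=> s0 z0; rewrite primitive0B; last by rewrite lerDl mulr_ge0// ltW.
rewrite /Rintegral fineK; last exact: integrable_fin_num.
rewrite integral_mkcond (@ge0_integral_affine _ m s)//; last 2 first.
- apply/(measurable_restrictT _ _).1 => //.
  by apply: measurable_funTS; exact/measurable_EFinP.
- by move=> x; rewrite patchE; case: ifP => // _; rewrite lee_fin.
congr (_ * _)%E; rewrite [RHS]integral_mkcond; apply: eq_integral => y _.
rewrite !patchE !mem_setE !in_itv/= lerDl lerD2l pmulr_rge0// ler_pM2l//.
Qed.

End primitive.

Lemma Rintegral_oppr {R : realType} (g : R -> R) (a b : R) :
  measurable_fun [set: R] g -> (forall x, 0 <= g x) ->
  (\int[lebesgue_measure]_(x in `[a, b]) g (- x)
   = \int[lebesgue_measure]_(x in `[(- b), (- a)]) g x)%R.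
Proof.
move=> mg g0; rewrite /Rintegral; congr fine.
rewrite [RHS](eq_measure_integral (pushforward lebesgue_measure
  (-%R : _ -> measurableTypeR R))); last first.
  by move=> A mA _; exact/esym/lebesgue_measureN.
rewrite ge0_integral_pushforward//=.
- by rewrite opp_preimage_itvbndbnd/= !opprK.
- by apply: measurable_funTS; exact/measurable_EFinP.
- by move=> x _; rewrite lee_fin.
Qed.
(** The half-line z <= 0, obtained from [primitive0_affine] for the reflected function [g \o -%R] at
    [- m]. *)
Lemma primitive0_affineN {R : realType} (g : R -> R) (m s z : R) :
  measurable_fun [set: R] g -> (forall x, 0 <= g x) ->
  (forall a b : R, lebesgue_measure.-integrable `[a, b] (EFin \o g)) ->
  0 < s -> 0 <= z ->
  (primitive0 g m - primitive0 g (m - s * z))%:E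
  = (s%:E * \int[lebesgue_measure]_(y in `[0%R, z]) (g (m - s * y))%:E)%E.
Proof.
move=> mg g0 ig s0 z0.
have mgN : measurable_fun [set: R] (g \o -%R) by exact: measurableT_comp.
have igN (a b : R) : lebesgue_measure.-integrable `[a, b] (EFin \o (g \o -%R)).
  apply/integrableP; split.
    by apply: measurable_funTS; exact/measurable_EFinP.
  have /integrableP[_] := ig (- b) (- a).
  rewrite (eq_measure_integral (pushforward lebesgue_measure
    (-%R : _ -> measurableTypeR R))); last first.
    by move=> A mA _; exact/esym/lebesgue_measureN.
  rewrite ge0_integral_pushforward//=.
  - by rewrite opp_preimage_itvbndbnd/= !opprK.
  - apply: measurable_funTS; apply/measurable_EFinP.
    exact: (measurableT_comp (@normr_measurable R setT)).
have := @primitive0_affine R (g \o -%R) mgN (fun x => g0 (- x)) igN (- m) s z s0 z0.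
rewrite primitive0B//; last by rewrite lerDl mulr_ge0// ltW.
rewrite Rintegral_oppr// opprD !opprK -primitive0B//; last first.
  by rewrite gerBl mulr_ge0// ltW.
by move=> ->; congr (_ * _)%E; apply: eq_integral => y _ /=; rewrite opprD opprK.
Qed.

(** * From the payoff to its primitive, along one path *)

Section payoff.
Context {R : realType}.
Notation leb := (@lebesgue_measure R).
Notation stdN := (@normal_prob R 0 1).
Local Notation gss := (fun z : R => expR (- (z ^+ 2 / 2))).
Local Notation gs z := (expR (- (z ^+ 2 / 2))).
Local Notation c0 := ((2 * pi) `^ (- 2^-1) : R).
Variables (g : R -> R) (C a : R).
Hypothesis mg : measurable_fun [set: R] g.
Hypothesis g0 : forall x, 0 <= g x.
Hypothesis C0 : 0 <= C.
Hypothesis a0 : 0 <= a.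
Hypothesis g_le : forall x, g x <= C * expR (a * `|x|).
Local Notation G := (primitive0 g).

Lemma growth_le_itv (u v x : R) : x \in `[u, v] ->
  g x <= C * expR (a * Num.max `|u| `|v|).
Proof.
rewrite in_itv/= => /andP[ux xv]; apply: (le_trans (g_le x)).
rewrite ler_wpM2l// ler_expR ler_wpM2l// le_max !ler_norml.
have [x0|x0] := leP 0 x.
  by apply/orP; right; rewrite ger0_norm ?(le_trans x0)// xv (le_trans _ x0)// lerNl oppr0 (le_trans x0).
apply/orP; left; rewrite ltr0_norm ?(le_lt_trans ux)// opprK ux/= (le_trans (ltW x0))//.
by rewrite oppr_ge0 (le_trans ux)// ltW.
Qed.

Lemma growth_integrable (u v : R) : leb.-integrable `[u, v] (EFin \o g).
Proof.
apply: measurable_bounded_integrable => //.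
- rewrite -[X in (X < _)%E]/(leb `[u, v]%classic) lebesgue_measure_itv/=.
  by case: ifP => _; rewrite -?EFinB ltry.
- exact: measurable_funTS.
- exists (C * expR (a * Num.max `|u| `|v|)); split; first exact: num_real.
  move=> x xC y /= yuv; rewrite ger0_norm//; apply: (le_trans _ (ltW xC)).
  exact: growth_le_itv.
Qed.

Lemma primitive0_homo : {homo (G : R -> R) : x y / x <= y}.
Proof.
move=> x y xy; rewrite -subr_ge0 (primitive0B growth_integrable xy).
by apply: Rintegral_ge0.
Qed.

Lemma measurable_primitive0 : measurable_fun [set: R] (G : R -> R).
Proof. by apply: nondecreasing_measurable => //; exact: primitive0_homo. Qed.

Lemma primitive00 : (G : R -> R) 0 = 0.
Proof. by rewrite /primitive0 lexx set_itv1 Rintegral_set1. Qed.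

(** Between 0 and [x] the function [g] is at most C exp(a |x|); the length |x| of the interval is
    absorbed by exp(|x|), whence [a + 1]. *)
Lemma primitive0_le (x : R) : `|(G : R -> R) x| <= C * expR ((a + 1) * `|x|).
Proof.
have key (u v : R) : u <= v -> \int[leb]_(y in `[u, v]) g y <=
    C * expR (a * Num.max `|u| `|v|) * (v - u).
  move=> uv; have -> : v - u = fine (leb `[u, v]%classic).
    rewrite lebesgue_measure_itv/= lte_fin; case: ltP => //= vu.
    by apply/eqP; rewrite subr_eq0 eq_le vu uv.
  rewrite -Rintegral_cst//; apply: le_Rintegral => //.
  - exact: growth_integrable.
  - apply: continuous_compact_integrable; first exact: segment_compact.
    by apply: continuous_subspaceT => y; exact: cvg_cst.
  - by move=> y; exact: growth_le_itv.
have fin (y : R) : 0 <= y -> C * expR (a * y) * y <= C * expR ((a + 1) * y).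
  move=> y0; rewrite mulrDl mul1r expRD mulrA ler_wpM2l ?mulr_ge0 ?expR_ge0//.
  by rewrite (le_trans _ (expR_ge1Dx y))// lerDr.
have [x0|x0] := leP 0 x.
  rewrite -[G x]subr0 -primitive00 (primitive0B growth_integrable x0).
  rewrite ger0_norm ?Rintegral_ge0//; apply: (le_trans (key _ _ x0)).
  by rewrite subr0 normr0 (max_idPr _)// ger0_norm//; exact: fin.
rewrite -normrN -[- _]add0r -primitive00 (primitive0B growth_integrable (ltW x0)).
rewrite ger0_norm ?Rintegral_ge0//; apply: (le_trans (key _ _ (ltW x0))).
rewrite sub0r normr0 (max_idPl _)// ltr0_norm//; apply: fin.
by rewrite oppr_ge0 ltW.
Qed.

Lemma c0_gt0 : 0 < c0.
Proof. by rewrite powR_gt0// mulr_gt0// pi_gt0. Qed.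

Local Open Scope ereal_scope.

Lemma integral_expR_gss (c : R) :
  \int[leb]_z (expR (c * `|z|) * gs z)%:E <= (c0^-1 * (2 * expR (c ^+ 2 / 2)))%:E.
Proof.
have mE : measurable_fun [set: R] (fun z : R => expR (c * `|z|)).
  by apply: measurableT_comp => //; apply: measurable_funM => //; exact: measurableT_comp.
have := gauss_integral_expR_norm c; rewrite ge0_integral_normal_pdf; last 2 first.
- exact/measurable_EFinP.
- by move=> z; rewrite lee_fin expR_ge0.
rewrite (_ : \int[_]_x _ = \int[leb]_z (c0%:E * (expR (c * `|z|) * gs z)%:E)); last first.
  by apply: eq_integral => z _; rewrite normal_pdf_gauss -!EFinM mulrCA.
rewrite ge0_integralZl//; last 2 first.
- by apply/measurable_EFinP; apply: measurable_funM => //; exact: measurable_gss.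
- by rewrite lee_fin ltW// c0_gt0.
by move=> ?; rewrite EFinM lee_pdivlMl// c0_gt0.
Qed.

Let mGs (m s : R) : measurable_fun [set: R] (fun z : R => (G (z * s + m) * z * gs z)%R).
Proof.
apply: measurable_funM; last exact: measurable_gss.
apply: measurable_funM => //; apply: (measurableT_comp measurable_primitive0).
by apply: measurable_funD => //; exact: measurable_funM.
Qed.

(** Uses |z s + m| <= |z| s + |m| and |z| <= exp(|z|). The dependence on [m] and [s] stays explicit
    because both become random and the bound is then integrated over the probability space. *)
Lemma primitive_gss_bound (m s : R) : (0 < s)%R ->
  \int[leb]_z `|(G (z * s + m) * z * gs z)%:E|
  <= (C * expR ((a + 1) * `|m|)
      * (c0^-1 * (2 * expR (((a + 1) * s + 1) ^+ 2 / 2))))%:E.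
Proof.
move=> s0.
apply: (@le_trans _ _ (\int[leb]_z ((C * expR ((a + 1) * `|m|))%:E *
   (expR (((a + 1) * s + 1) * `|z|) * gs z)%:E))).
  apply: ge0_le_integral => //.
  - by apply: measurableT_comp => //; apply/measurable_EFinP; exact: mGs.
  - apply: emeasurable_funM => //; apply/measurable_EFinP; apply: measurable_funM.
      by apply: measurableT_comp => //; apply: measurable_funM => //; exact: measurableT_comp.
    exact: measurable_gss.
  - move=> z _; rewrite -EFinM lee_fin !normrM (ger0_norm (expR_ge0 _)) [leRHS]mulrA.
    apply: ler_wpM2r; first exact: expR_ge0.
    apply: (@le_trans _ _ (C * expR ((a + 1) * `|z * s + m|) * expR `|z|)%R).
      apply: ler_pM => //; first exact: primitive0_le.
      by rewrite (le_trans _ (expR_ge1Dx _))// lerDr.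
    rewrite -!mulrA ler_wpM2l// -!expRD ler_expR.
    have : (`|z * s + m| <= `|z| * s + `|m|)%R.
      by rewrite (le_trans (ler_normD _ _))// normrM (gtr0_norm s0).
    have : (0 <= a + 1)%R by rewrite addr_ge0.
    move=> /ler_wpM2l h /h{h}; lra.
rewrite ge0_integralZl//; last 2 first.
- apply/measurable_EFinP; apply: measurable_funM; last exact: measurable_gss.
  by apply: measurableT_comp => //; apply: measurable_funM => //; exact: measurableT_comp.
- by rewrite lee_fin mulr_ge0 ?expR_ge0.
rewrite [leRHS]EFinM; apply: lee_wpmul2l; last exact: integral_expR_gss.
by rewrite lee_fin mulr_ge0 ?expR_ge0.
Qed.

Lemma primitive_gss_integrable (m s : R) : (0 < s)%R ->
  leb.-integrable setT (fun z => (G (z * s + m) * z * gs z)%:E).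
Proof.
move=> s0; apply/integrableP; split; first by apply/measurable_EFinP; exact: mGs.
by apply: (le_lt_trans (primitive_gss_bound m s0)); rewrite ltry.
Qed.

Lemma gss_mul_integrable : leb.-integrable setT (fun z => (z * gs z)%:E).
Proof.
apply/integrableP; split.
  by apply/measurable_EFinP; apply: measurable_funM => //; exact: measurable_gss.
apply: (@le_lt_trans _ _ (\int[leb]_z (expR (1 * `|z|) * gs z)%:E)).
  apply: ge0_le_integral => //.
  - apply: measurableT_comp => //; apply/measurable_EFinP.
    by apply: measurable_funM => //; exact: measurable_gss.
  - apply/measurable_EFinP; apply: measurable_funM; last exact: measurable_gss.
    by apply: measurableT_comp => //; apply: measurable_funM => //; exact: measurableT_comp.
  - move=> z _; rewrite lee_fin normrM (ger0_norm (expR_ge0 _)) mul1r.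
    by rewrite ler_wpM2r ?expR_ge0// (le_trans _ (expR_ge1Dx _))// lerDr.
by apply: (le_lt_trans (integral_expR_gss 1)); rewrite ltry.
Qed.

(** The constant [G m] is subtracted at no cost, since z exp(-z^2 / 2) is odd. As [G] is
    nondecreasing, the increment of [G] from [m] has the sign of z, so the integrand becomes
    nonnegative and each half-line falls under [ge0_gauss_ibp_half]. *)
Lemma payoff_ibp (m s : R) : (0 < s)%R ->
  \int[stdN]_z (g (m + s * z))%:E
  = c0%:E * (s^-1%:E * \int[leb]_x (G (x * s + m) * x * gs x)%:E).
Proof.
move=> s0; have ig := growth_integrable.
have mgs (c : R) : measurable_fun [set: R] (fun z : R => g (m + c * z)).
  by apply: measurableT_comp => //; apply: measurable_funD => //; exact: measurable_funM.
have mgss (c : R) : measurable_fun [set: R] (fun z : R => (g (m + c * z) * gs z)%:E).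
  by apply/measurable_EFinP; apply: measurable_funM => //; exact: measurable_gss.
have mG (c : R) : measurable_fun [set: R] (fun z : R => (G (m + c * z) - G m) * (z * gs z))%R.
  apply: measurable_funM; last by apply: measurable_funM => //; exact: measurable_gss.
  apply: measurable_funB => //; apply: (measurableT_comp measurable_primitive0).
  by apply: measurable_funD => //; exact: measurable_funM.
have G0 z : (0 <= (G (m + s * z) - G m) * (z * gs z))%R.
  have [z0|z0] := leP 0%R z.
    rewrite mulr_ge0 ?mulr_ge0 ?expR_ge0// subr_ge0; apply: primitive0_homo.
    by rewrite lerDl mulr_ge0// ltW.
  rewrite mulr_le0// ?subr_le0; last by rewrite mulr_le0_ge0 ?expR_ge0// ltW.
  by apply: primitive0_homo; rewrite gerDl mulr_ge0_le0// ltW.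
rewrite ge0_integral_normal_pdf; last 2 first.
- exact/measurable_EFinP.
- by move=> z; rewrite lee_fin.
rewrite (_ : \int[_]_x _ = \int[leb]_z (c0%:E * (g (m + s * z) * gs z)%:E)); last first.
  by apply: eq_integral => z _; rewrite normal_pdf_gauss -!EFinM mulrCA.
rewrite ge0_integralZl//; last 3 first.
- exact: mgss.
- by move=> z _; rewrite lee_fin mulr_ge0 ?expR_ge0.
- by rewrite lee_fin ltW// c0_gt0.
congr (_ * _).
transitivity (s^-1%:E * \int[leb]_z ((G (m + s * z) - G m) * (z * gs z))%:E); last first.
  congr (_ * _).
  rewrite (_ : \int[leb]_z _ =
      \int[leb]_z ((G (z * s + m) * z * gs z)%:E - (G m)%:E * (z * gs z)%:E)); last first.
    by apply: eq_integral => z _; rewrite -EFinM -EFinB mulrBl [(m + _)%R]addrC [(s * z)%R]mulrC mulrA.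
  rewrite integralB//; last 2 first.
  - exact: primitive_gss_integrable.
  - by apply: integrableZl => //; exact: gss_mul_integrable.
  by rewrite integralZl//; [rewrite integral_gss_odd mule0 sube0|exact: gss_mul_integrable].
rewrite (ge0_integral_fold (mgss s)); last first.
  by move=> z; rewrite lee_fin mulr_ge0 ?expR_ge0.
rewrite [in RHS]ge0_integral_fold//; last by apply/measurable_EFinP; exact: mG.
rewrite ge0_muleDr ?integral_ge0//; last 2 first.
- by move=> z _; rewrite lee_fin; exact: (G0 z).
- by move=> z _; rewrite lee_fin; exact: (G0 (- z)%R).
(* Common form of the two half-lines: [h] is the payoff read outwards from [m], and [D] the
   corresponding increment of [G]. *)
have half (h : R -> R) (D : R -> R) : measurable_fun [set: R] h -> (forall x, (0 <= h x)%R) ->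
    measurable_fun [set: R] D ->
    (forall z, (0 <= z)%R -> (D z)%:E = s%:E * \int[leb]_(y in `[0%R, z]) (h y)%:E) ->
    \int[leb]_(z in `[0%R, +oo[) (h z * gs z)%:E =
    s^-1%:E * \int[leb]_(z in `[0%R, +oo[) (D z * (z * gs z))%:E.
  move=> mh h0 mD hD; rewrite -ge0_gauss_ibp_half// -ge0_integralZl//.
  - apply: eq_integral => z; rewrite inE/= in_itv/= andbT => z0.
    rewrite [in RHS]EFinM hD// !muleA -EFinM mulVf ?mul1e//.
    by rewrite gt_eqF.
  - apply/measurable_EFinP/measurable_funTS; apply: measurable_funM => //.
    by apply: measurable_funM => //; exact: measurable_gss.
  - move=> z; rewrite /= in_itv/= andbT => z0.
    rewrite EFinM hD// mule_ge0 ?mule_ge0 ?lee_fin ?mulr_ge0 ?expR_ge0 ?(ltW s0)//.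
    by apply: integral_ge0 => y _; rewrite lee_fin.
  - by rewrite lee_fin invr_ge0 ltW.
congr (_ + _).
  apply: half => //.
  - apply: measurable_funB => //; apply: (measurableT_comp measurable_primitive0).
    by apply: measurable_funD => //; exact: measurable_funM.
  - by move=> z z0; exact: (primitive0_affine mg g0 ig).
rewrite (_ : \int[leb]_(x in _) _ =
    \int[leb]_(z in `[0%R, +oo[) (g (m - s * z) * gs z)%:E); last first.
  by apply: eq_integral => z _; rewrite mulrN sqrrN.
rewrite (half (fun z => g (m - s * z)%R) (fun z => G m - G (m - s * z))%R).
- congr (_ * _); apply: eq_integral => z _; rewrite mulrN sqrrN mulNr.
  by rewrite mulrN -mulNr opprB.
- by under eq_fun do rewrite -mulNr; exact: mgs.
- by move=> z; exact: g0.
- apply: measurable_funB => //; apply: (measurableT_comp measurable_primitive0).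
  by apply: measurable_funB => //; exact: measurable_funM.
- by move=> z z0; exact: primitive0_affineN.
Qed.

(** Up to the factor (2 pi)^(1/2), this is minus the derivative in [x] of the normal density with
    mean [m] and standard deviation [s]. *)
Definition payoff_kernel (m s x : R) : R :=
  (x - m) / s ^+ 3 * expR (- ((x - m) ^+ 2 / (2 * s ^+ 2))).

Lemma measurable_payoff_kernel (m s : R) :
  measurable_fun [set: R] (fun x => payoff_kernel m s x).
Proof.
apply: measurable_funM; first by apply: measurable_funM => //; exact: measurable_funB.
apply: measurableT_comp => //; apply: measurableT_comp => //.
by apply: measurable_funM => //; apply: measurable_funX; exact: measurable_funB.
Qed.

Lemma payoff_kernel_affine (m s z : R) : (0 < s)%R ->
  payoff_kernel m s (m + s * z) = (s ^- 2 * (z * gs z))%R.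
Proof.
move=> s0; rewrite /payoff_kernel [RHS]mulrA; congr (_ * expR _)%R.
  by field; exact: lt0r_neq0.
by field; exact: lt0r_neq0.
Qed.

Let mGk (m s : R) : measurable_fun [set: R] (fun x => (G x * payoff_kernel m s x)%R).
Proof.
by apply: measurable_funM; [exact: measurable_primitive0|exact: measurable_payoff_kernel].
Qed.

(** The Jacobian [s] of x = m + s z meets the [s ^- 2] of [payoff_kernel_affine]. Absolute values
    are treated separately because they give integrability, in [payoff_affine] and later on the
    product with [P]. *)
Lemma payoff_affine_abs (m s : R) : (0 < s)%R ->
  \int[leb]_x `|(G x * payoff_kernel m s x)%:E|
  = s^-1%:E * \int[leb]_x `|(G (x * s + m) * x * gs x)%:E|.
Proof.
move=> s0; rewrite (@ge0_integral_affine _ m s)//; last first.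
  by apply: measurableT_comp => //; apply/measurable_EFinP; exact: mGk.
have -> : \int[leb]_z `|(G (m + s * z) * payoff_kernel m s (m + s * z))%:E|
    = (s ^- 2)%:E * \int[leb]_x `|(G (x * s + m) * x * gs x)%:E|.
  rewrite -ge0_integralZl//=.
  - apply: eq_integral => z _; rewrite -EFinM; congr EFin.
    rewrite payoff_kernel_affine// !normrM (@ger0_norm _ (s ^- 2)%R) ?invr_ge0 ?exprn_ge0 ?(ltW s0)//.
    have -> : (z * s + m = m + s * z)%R by rewrite addrC mulrC.
    by rewrite mulrCA !mulrA.
  - by apply/measurable_EFinP; apply: measurableT_comp => //; exact: mGs.
  - by rewrite lee_fin invr_ge0 exprn_ge0// ltW.
rewrite muleA -EFinM; congr (_%:E * _); field; exact: lt0r_neq0.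
Qed.

Lemma payoff_affine (m s : R) : (0 < s)%R ->
  \int[leb]_x (G x * payoff_kernel m s x)%:E
  = s^-1%:E * \int[leb]_x (G (x * s + m) * x * gs x)%:E.
Proof.
move=> s0; rewrite (@integral_affine _ m s)//; last first.
  apply/integrableP; split; first by apply/measurable_EFinP; exact: mGk.
  rewrite payoff_affine_abs//.
  apply: (@le_lt_trans _ _ (s^-1%:E * (C * expR ((a + 1) * `|m|)
      * (c0^-1 * (2 * expR (((a + 1) * s + 1) ^+ 2 / 2))))%:E)).
    by apply: lee_wpmul2l; [rewrite lee_fin invr_ge0 ltW|exact: primitive_gss_bound].
  by rewrite -EFinM ltry.
have -> : \int[leb]_z (G (m + s * z) * payoff_kernel m s (m + s * z))%:E
    = (s ^- 2)%:E * \int[leb]_x (G (x * s + m) * x * gs x)%:E.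
  rewrite -integralZl//=; last exact: primitive_gss_integrable.
  apply: eq_integral => z _; rewrite -EFinM; congr EFin.
  have -> : (z * s + m = m + s * z)%R by rewrite addrC mulrC.
  by rewrite payoff_kernel_affine// -(mulrA _ z) [LHS]mulrCA.
rewrite muleA -EFinM; congr (_%:E * _); field; exact: lt0r_neq0.
Qed.

(** With z = (x - m) / s, one has |z| <= 1 + z^2 / 2 <= exp(z^2 / 2). The bound is uniform in [x]
    and [m]. *)
Lemma payoff_kernel_le (m s x : R) : (0 < s)%R -> (`|payoff_kernel m s x| <= s ^- 2)%R.
Proof.
move=> s0; have -> : x = (m + s * ((x - m) / s))%R.
  by rewrite mulrC divfK ?gt_eqF// addrC subrK.
rewrite payoff_kernel_affine// normrM (@ger0_norm _ (s ^- 2)%R) ?invr_ge0 ?exprn_ge0 ?(ltW s0)//.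
rewrite ler_piMr ?invr_ge0 ?exprn_ge0 ?(ltW s0)//; set z := ((x - m) / s)%R.
rewrite normrM (ger0_norm (expR_ge0 _)) expRN -[leRHS](@divff _ (expR (z ^+ 2 / 2))) ?gt_eqF ?expR_gt0//.
rewrite ler_pM2r ?invr_gt0 ?expR_gt0//; apply: le_trans (expR_ge1Dx _).
rewrite -(@real_normK _ z) ?num_real//; have := sqr_ge0 (`|z| - 1)%R; nra.
Qed.

End payoff.

(** * Riemann-Stieltjes integrals against exponentials *)

Section clamp.
Context {R : realType}.
Variable T : R.
Hypothesis T0 : 0 <= T.

(* [f \o clamp] extends a path given on [0, T] to the whole line. *)
Definition clamp (t : R) : R := Num.max 0 (Num.min t T).

Lemma clamp_itv t : 0 <= clamp t <= T.
Proof. by rewrite /clamp le_max lexx/= ge_max T0/= ge_min lexx orbT. Qed.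

Lemma clamp_id t : 0 <= t <= T -> clamp t = t.
Proof. by move=> /andP[t0 tT]; rewrite /clamp (min_idPl tT) (max_idPr t0). Qed.

Lemma continuous_clamp : continuous clamp.
Proof.
move=> t; apply: (@continuous_max R R (fun=> 0) (fun u => Num.min u T) t).
  exact: cvg_cst.
by apply: (@continuous_min R R id (fun=> T) t); [exact: cvg_id|exact: cvg_cst].
Qed.

(** The values of [clamp] lie in [0, T], so the restriction built into the subspace topology is
    always met after composition. *)
Lemma continuous_comp_clamp (f : R -> R) :
  {within `[0, T], continuous f} -> continuous (f \o clamp).
Proof.
move=> /subspace_continuousP cf t.
have At : `[0, T]%classic (clamp t) by rewrite /= in_itv/= clamp_itv.
apply: (cvg_comp clamp f _ (cf _ At)) => A.
rewrite /within/= => H;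
have K : \forall u \near t, `[0, T]%classic (clamp u) -> A (clamp u).
  exact: (@continuous_clamp t _ H).
change (\forall u \near t, A (clamp u)).
by apply: filterS K => u; apply; rewrite /= in_itv/= clamp_itv.
Qed.

End clamp.

(** Heine-Cantor, with [y] free to leave [a, b]. Compactness enters as a near covering: a property
    that holds around each point for all small [dlt] holds on the whole interval for a common
    [dlt]. *)
Lemma itv_unif_continuous {R : realType} (f : R -> R) (a b e : R) :
  continuous f -> 0 < e -> exists2 dlt : R, 0 < dlt &
    forall x y, x \in `[a, b] -> `|y - x| < dlt -> `|f y - f x| < e.
Proof.
move=> cf e0; have e20 : 0 < e / 2 by rewrite divr_gt0.
have /compact_near_coveringP := @segment_compact R a b.
move=> /(_ R (0 : R)^'+ (fun dlt x => forall y, `|y - x| < dlt -> `|f y - f x| < e)).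
case => //=.
  move=> x _; have /cvgrPdist_lt/(_ _ e20) := cf x.
  move=> /nbhs_ballP[eta /= eta0 H].
  exists (ball x (eta / 2), [set dlt | dlt < eta / 2]).
    split => /=; first by apply: nbhsx_ballx; rewrite divr_gt0.
    by apply: nbhs_right_lt; rewrite divr_gt0.
  move=> [x' dlt] /= [xx' de] y yx'.
  have h1 : `|f x - f x'| < e / 2.
    by apply: H; apply: lt_trans xx' _; rewrite ltr_pdivrMr// mulr2n mulrDr mulr1 ltrDl.
  have h2 : `|f x - f y| < e / 2.
    apply: H; rewrite /ball/=.
    have : `|x - x'| + `|y - x'| < eta.
      by rewrite [ltRHS](splitr eta) ltrD// (lt_trans yx').
    apply: le_lt_trans; rewrite (_ : x - y = (x - x') - (y - x')); last by ring.
    exact: ler_normB.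
  rewrite (_ : f y - f x' = (f x - f x') - (f x - f y)); last by ring.
  by rewrite (le_lt_trans (ler_normB _ _))// [ltRHS](splitr e) ltrD.
move=> dlt /= dlt0 H; exists (dlt / 2); first by rewrite divr_gt0.
move=> x y xab yx; apply: (H (dlt / 2)) => //=.
- by rewrite sub0r normrN gtr0_norm ?divr_gt0// ltr_pdivrMr// mulr2n mulrDr mulr1 ltrDl.
- by rewrite divr_gt0.
Qed.

Section uniform_partition.
Context {R : realType}.

(** There are [n.+1] pieces, so that [n = 0] is allowed; the node 0 is left out, as in
    [itv_partition], hence the shift [i.+1]. *)
Definition upart (t : R) (n : nat) : seq R :=
  [seq t * i.+1%:R / n.+1%:R | i <- iota 0 n.+1].

Lemma size_upart t n : size (upart t n) = n.+1.
Proof. by rewrite size_map size_iota. Qed.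

Lemma node_upart t n i : (i <= n.+1)%N -> node 0 (upart t n) i = t * i%:R / n.+1%:R.
Proof.
case: i => [|i] in_; first by rewrite /node/= mulr0 mul0r.
by rewrite /node/= (nth_map 0%N) ?size_iota// nth_iota.
Qed.

Lemma itv_partition_upart t n : 0 < t -> itv_partition 0 t (upart t n).
Proof.
move=> t0; split.
  apply/(pathP 0) => i; rewrite size_upart => i_n.
  have -> : nth 0 (upart t n) i = node 0 (upart t n) i.+1 by [].
  rewrite -/(node 0 (upart t n) i) !node_upart//; last exact: ltnW.
  by rewrite ltr_pM2r ?invr_gt0// ltr_pM2l// ltr_nat.
rewrite (last_nth 0) size_upart -/(node 0 (upart t n) n.+1) node_upart//.
by rewrite mulfK.
Qed.

Lemma node_upart_itv t n i : 0 <= t -> (i <= n.+1)%N ->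
  0 <= node 0 (upart t n) i <= t.
Proof.
move=> t0 i_n; rewrite node_upart// divr_ge0 ?mulr_ge0//=.
by rewrite ler_pdivrMr// ler_wpM2l// ler_nat.
Qed.

Lemma node_upartB t n i : (i <= n)%N ->
  node 0 (upart t n) i.+1 - node 0 (upart t n) i = t / n.+1%:R.
Proof.
move=> i_n; rewrite !node_upart//; last exact: leqW.
by rewrite -mulrBl -mulrBr -natr1 addrAC subrr add0r mulr1.
Qed.

Lemma upart_mesh t (dlt : R) : 0 < dlt -> \forall n \near \oo, t / n.+1%:R < dlt.
Proof.
move=> dlt0; near=> n.
have : t / dlt < n%:R by near: n; exact: nbhs_infty_gtr.
rewrite ltr_pdivrMr// => H; rewrite ltr_pdivrMr// mulrC (lt_le_trans H)//.
by rewrite ler_wpM2r ?(ltW dlt0)// ler_nat.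
Unshelve. all: by end_near. Qed.

End uniform_partition.

Section riemann_stieltjes_expR.
Context {R : realType}.
Notation leb := (@lebesgue_measure R).
Variables (k : R -> R) (alpha : R).
Hypothesis ck : continuous k.
Hypothesis alpha0 : 0 < alpha.

Let e (s : R) := expR (alpha * s).
Let aek (s : R) := alpha * e s * k s.

Let ce : continuous e.
Proof.
move=> s; apply: (cvg_comp _ expR); last exact: continuous_expR.
by apply: cvgM; [exact: cvg_cst|exact: cvg_id].
Qed.

Let caek : continuous aek.
Proof.
by move=> s; apply: cvgM; [apply: cvgM; [exact: cvg_cst|exact: ce]|exact: ck].
Qed.

Let icont (f : R -> R) (a b : R) : continuous f -> leb.-integrable `[a, b] (EFin \o f).
Proof.
move=> cf; apply: continuous_compact_integrable; first exact: segment_compact.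
exact: continuous_subspaceT.
Qed.

Let de (s : R) : is_derive s 1 e (alpha * e s).
Proof.
have h1 : is_derive s 1 (fun u : R => alpha * u) alpha.
  by have := is_deriveZ alpha (is_derive_id s (1:R)); rewrite /GRing.scale/= mulr1.
rewrite mulrC; exact: (@is_derive1_comp _ expR (fun u : R => alpha * u) s _ _ (is_derive_expR _) h1).
Qed.

Let int_e (a b : R) : a <= b -> (\int[leb]_(s in `[a, b]) (alpha * e s) = e b - e a)%R.
Proof.
rewrite le_eqVlt => /predU1P[->|ab]; first by rewrite set_itv1 Rintegral_set1 subrr.
rewrite /Rintegral (@continuous_FTC2 _ _ e)//.
- apply: continuous_subspaceT => s; apply: cvgM; [exact: cvg_cst|exact: ce].
- split=> [s _||].
  + exact: (@ex_derive _ _ _ _ _ _ _ (de s)).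
  + by apply: cvg_at_right_filter; exact: ce.
  + by apply: cvg_at_left_filter; exact: ce.
- by move=> s _; rewrite derive1E; exact: (@derive_val _ _ _ _ _ _ _ (de s)).
Qed.

(* [Phi] has the Stieltjes differential [e dk], so Riemann-Stieltjes sums of [e]
   against [k] are compared with increments of [Phi]. *)
Let Phi (x : R) := e x * k x - \int[leb]_(s in `[0, x]) aek s.

(** The error is minus the integral over [x, y] of alpha e(s) (k y - k s): only the oscillation of
    [k] enters, and the resulting bound telescopes along a partition. *)
Let Phi_step (x y eps : R) : 0 <= x -> x <= y ->
  (forall s, x <= s <= y -> `|k y - k s| <= eps) ->
  `|e x * (k y - k x) - (Phi y - Phi x)| <= eps * (e y - e x).
Proof.
move=> x0 xy kle.
have -> : e x * (k y - k x) - (Phi y - Phi x)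
  = - (\int[leb]_(s in `[x, y]) (alpha * e s * (k y - k s))).
  have -> : \int[leb]_(s in `[x, y]) (alpha * e s * (k y - k s))
      = \int[leb]_(s in `[x, y]) (alpha * e s * k y - aek s).
    by apply: eq_Rintegral => s _; rewrite mulrBr.
  rewrite RintegralB//; last 2 first.
  - apply: (@icont (fun s => alpha * e s * k y)) => s.
    by apply: cvgM; [apply: cvgM; [exact: cvg_cst|exact: ce]|exact: cvg_cst].
  - exact: icont.
  rewrite RintegralZr//; last first.
    by apply: (@icont (fun s => alpha * e s)) => s; apply: cvgM; [exact: cvg_cst|exact: ce].
  rewrite int_e// /Phi (@Rintegral_chasles _ aek (fun a b => icont a b caek) 0 x y)//.
  by ring.
rewrite normrN; apply: (le_trans (le_normr_Rintegral _ _)) => //.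
  apply: (@icont (fun s => alpha * e s * (k y - k s))) => s.
  apply: cvgM; first by apply: cvgM; [exact: cvg_cst|exact: ce].
  by apply: cvgB; [exact: cvg_cst|exact: ck].
rewrite -int_e// -RintegralZl//; last first.
  by apply: (@icont (fun s => alpha * e s)) => s; apply: cvgM; [exact: cvg_cst|exact: ce].
apply: le_Rintegral => //.
- apply: (@icont (fun s => `|alpha * e s * (k y - k s)|)) => s.
  apply: cvg_norm; apply: cvgM; first by apply: cvgM; [exact: cvg_cst|exact: ce].
  by apply: cvgB; [exact: cvg_cst|exact: ck].
- apply: (@icont (fun s => eps * (alpha * e s))) => s.
  by apply: cvgM; [exact: cvg_cst|apply: cvgM; [exact: cvg_cst|exact: ce]].
- move=> s; rewrite /= in_itv/= => xsy.
  rewrite normrM ger0_norm ?mulr_ge0 ?expR_ge0// ?(ltW alpha0)//.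
  by rewrite mulrC ler_wpM2r ?mulr_ge0 ?expR_ge0// ?(ltW alpha0)//; exact: kle.
Qed.

(** On a fine uniform partition tagged at left endpoints, the sum is close to [I] by hypothesis and
    to exp(-alpha t) (Phi t - Phi 0) by [Phi_step]. Here [k'] is the given path and [k] a continuous
    function on the line that agrees with it on [0, t]. *)
Lemma RS_expR_byparts (k' : R -> R) (t I : R) : 0 <= t ->
  (forall s, 0 <= s <= t -> k' s = k s) ->
  is_RS_integral (fun s => expR (- alpha * (t - s))) k' 0 t I ->
  I = k t - expR (- alpha * t) * k 0
      - expR (- alpha * t) * \int[leb]_(s in `[0, t]) (alpha * expR (alpha * s) * k s).
Proof.
move=> t0 kk' RSI.
have et : expR (- alpha * t) * e t = 1 by rewrite -expRD mulNr addNr expR0.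
have -> : k t - expR (- alpha * t) * k 0
      - expR (- alpha * t) * \int[leb]_(s in `[0, t]) (alpha * expR (alpha * s) * k s)
    = expR (- alpha * t) * (Phi t - Phi 0).
  rewrite /Phi set_itv1 Rintegral_set1 /e mulr0 expR0 mul1r subr0 -/(e t).
  by rewrite mulrBr mulrBr mulrA et mul1r addrAC.
move: t0; rewrite le_eqVlt => /predU1P[t0|t0].
  (* At time 0 the empty partition is admissible and its sum is 0, which forces [I] to be 0. *)
  rewrite -t0 subrr mulr0; apply/eqP; rewrite -normr_eq0; apply/eqP.
  apply: le_anti; rewrite normr_ge0 andbT; apply/ler_addgt0Pr => eps eps0.
  have [dlt dlt0 /(_ [::] (fun=> 0))] := RSI _ eps0.
  rewrite /RS_sum big_ord0 sub0r normrN add0r => H; apply/ltW/H.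
  by rewrite -t0; split => //; split => //=.
apply/eqP; rewrite -subr_eq0 -normr_eq0; apply/eqP.
apply: le_anti; rewrite normr_ge0 andbT; apply/ler_addgt0Pr => eps eps0.
have eps20 : 0 < eps / 2 by rewrite divr_gt0.
rewrite add0r.
have [d1 d10 H1] := RSI _ eps20.
have [d2 d20 H2] := @itv_unif_continuous R k 0 t _ ck eps20.
have [n [/= n1 n2]] : exists n : nat, t / n.+1%:R < d1 /\ t / n.+1%:R < d2.
  have [N _ HN] := upart_mesh t d10; have [N' _ HN'] := upart_mesh t d20.
  exists (maxn N N'); split; [apply: HN|apply: HN'] => /=; [exact: leq_maxl|exact: leq_maxr].
set s := upart t n; pose x := node 0 s.
have xitv i : (i <= n.+1)%N -> 0 <= x i <= t by move=> ?; apply: node_upart_itv => //; exact: ltW.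
have xS i : (i <= n)%N -> x i.+1 - x i = t / n.+1%:R by exact: node_upartB.
have xle i : (i <= n)%N -> x i <= x i.+1.
  by move=> i_n; rewrite -subr_ge0 xS// divr_ge0// ltW.
have {H1} H1 : `|RS_sum (fun s => expR (- alpha * (t - s))) k' 0 s x - I| < eps / 2.
  apply: H1; split; first exact: itv_partition_upart.
  move=> i; rewrite size_upart ltnS => i_n; rewrite lexx xle//.
  by split => //; rewrite -/x xS.
have H3 : `|RS_sum (fun s => expR (- alpha * (t - s))) k' 0 s x
    - expR (- alpha * t) * (Phi t - Phi 0)| <= eps / 2.
  have -> : Phi t - Phi 0 = \sum_(i < n.+1) (Phi (x i.+1) - Phi (x i)).
    rewrite -(big_mkord xpredT (fun i => Phi (x i.+1) - Phi (x i))) telescope_sumr//.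
    by rewrite /x !node_upart// mulr0 mul0r mulfK.
  rewrite /RS_sum size_upart mulr_sumr -sumrB.
  apply: (le_trans (ler_norm_sum _ _ _)).
  apply: (@le_trans _ _ (\sum_(i < n.+1) expR (- alpha * t) * (eps / 2 * (e (x i.+1) - e (x i))))).
    apply: ler_sum => i _; have i_n : (i <= n)%N by rewrite -ltnS.
    rewrite -/x !kk'; [|exact: (xitv _ (leqW i_n))|exact: xitv].
    rewrite (_ : expR (- alpha * (t - x i)) = expR (- alpha * t) * e (x i)); last first.
      by rewrite -expRD; congr expR; ring.
    rewrite -mulrA -mulrBr normrM ger0_norm ?expR_ge0// ler_wpM2l ?expR_ge0//.
    apply: Phi_step; [by case/andP: (xitv _ (leqW i_n))|exact: xle|].
    move=> u /andP[xu ux]; rewrite distrC; apply/ltW/H2.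
      by rewrite in_itv/=; exact: xitv.
    apply: le_lt_trans n2; rewrite -(xS _ i_n) distrC ger0_norm ?subr_ge0//.
    by rewrite lerB.
  rewrite -mulr_sumr -mulr_sumr -(big_mkord xpredT (fun i => e (x i.+1) - e (x i))) telescope_sumr//.
  have -> : x n.+1 = t by rewrite /x node_upart// mulfK.
  (* The total weight exp(-alpha t) (e t - e 0) is 1 - exp(-alpha t), hence at most 1. *)
  rewrite mulrCA -[leRHS]mulr1 ler_pM2l// mulrBr et gerBl mulr_ge0 ?expR_ge0//.
set J := expR _ * _ in H3 *.
rewrite [leRHS](splitr eps); apply: (le_trans _ (lerD (ltW H1) H3)).
rewrite -[leLHS]normrN opprB.
rewrite (_ : J - I = (RS_sum (fun s => expR (- alpha * (t - s))) k' 0 s x - I) -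
  (RS_sum (fun s => expR (- alpha * (t - s))) k' 0 s x - J)); last by ring.
exact: ler_normB.
Qed.

End riemann_stieltjes_expR.

(** Exhibits the pathwise integral as a limit of finite combinations of values of [k]; its
    measurability in the path rests on this. *)
Lemma RS_sum_upart_cvg {R : realType} (h k : R -> R) (t I : R) : 0 < t ->
  is_RS_integral h k 0 t I ->
  RS_sum h k 0 (upart t n) (node 0 (upart t n)) @[n --> \oo] --> I.
Proof.
move=> t0 RSI; apply/cvgrPdist_lt => eps eps0; have [dlt dlt0 H] := RSI _ eps0.
near=> n; rewrite distrC; apply: H; split; first exact: itv_partition_upart.
move=> i; rewrite size_upart ltnS => i_n; rewrite lexx.
have E := node_upartB t i_n; rewrite -subr_ge0 E divr_ge0 ?(ltW t0)//; split => //.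
by near: n; exact: upart_mesh.
Unshelve. all: by end_near. Qed.

(** * Joint measurability and independence *)

(** [F] is the pointwise limit of its samples at grid points below [t], and preimages under a
    sampled process are countable unions of measurable rectangles. The third hypothesis settles
    negative times, where [Num.truncn] returns 0. *)
Lemma joint_measurable {R : realType} d (Omega : measurableType d) (F : R -> Omega -> R) :
  (forall t, 0 <= t -> measurable_fun [set: Omega] (F t)) ->
  (forall w, continuous (F ^~ w)) ->
  (forall t w, t <= 0 -> F t w = F 0 w) ->
  measurable_fun [set: R * Omega] (fun p : R * Omega => F p.1 p.2).
Proof.
move=> mF cF F0.
pose idx (n : nat) (t : R) : nat := Num.truncn (n.+1%:R * t).
pose Fn n (p : R * Omega) := F ((idx n p.1)%:R / n.+1%:R) p.2.
apply: (@measurable_fun_cvg _ _ _ _ Fn).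
  move=> n _ A mA; rewrite setTI.
  have -> : Fn n @^-1` A = \bigcup_k ((idx n @^-1` [set k]) `*`
      (F (k%:R / n.+1%:R) @^-1` A)).
    apply/seteqP; split => [[t w] /= H|[t w] [k _ [/= <-]]] //.
    by exists (idx n t).
  apply: bigcup_measurable => k _; apply: measurableX; last first.
    by rewrite -[X in measurable X]setTI; apply: mF => //; rewrite divr_ge0.
  have idxP t : (idx n t <= k)%N = (n.+1%:R * t < k.+1%:R) by rewrite /idx truncn_le_nat.
  have mle j : measurable [set t : R | n.+1%:R * t < j%:R].
    rewrite (_ : mkset _ = `]-oo, (j%:R / n.+1%:R)[%classic)//.
    by apply/seteqP; split => t /=; rewrite in_itv/= ltr_pdivlMr// mulrC.
  case: k idxP => [|k] idxP.
    rewrite (_ : _ @^-1` _ = [set t : R | n.+1%:R * t < 1%:R])//.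
    by apply/seteqP; split => t /=; rewrite -idxP leqn0 => /eqP.
  rewrite (_ : _ @^-1` _ = [set t : R | n.+1%:R * t < k.+2%:R] `\` [set t : R | n.+1%:R * t < k.+1%:R]).
    exact: measurableD.
  apply/seteqP; split => t /=.
    move=> E; rewrite -idxP E; split => //; apply/negP.
    by rewrite -truncn_le_nat -/(idx n t) E ltnn.
  rewrite -idxP => -[H1 /negP]; rewrite -truncn_le_nat -/(idx n t) -ltnNge => H2.
  by apply/eqP; rewrite eqn_leq H1 H2.
move=> [t w] _ /=; rewrite /Fn/=.
have [t0|t0] := leP t 0.
  have idx0 n : idx n t = 0%N.
    apply/eqP; rewrite -leqn0 /idx truncn_le_nat (le_lt_trans (y := 0))//.
    by rewrite mulr_ge0_le0.
  under eq_fun do rewrite idx0 mul0r; rewrite F0//; exact: cvg_cst.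
apply: (cvg_comp (fun n : nat => (idx n t)%:R / n.+1%:R : R) (F^~ w) _ (cF w t)).
apply/cvgrPdist_lt => eps eps0; near=> n.
have := @truncn_itv _ (n.+1%:R * t); rewrite mulr_ge0 ?(ltW t0)// => /(_ isT) /andP[h1 h2].
rewrite -/(idx n t) in h1 h2 *.
rewrite ger0_norm; last by rewrite subr_ge0 ler_pdivrMr// mulrC.
apply: (@lt_trans _ _ (n.+1%:R)^-1).
  by rewrite ltrBlDr -[X in X + _]mul1r -mulrDl ltr_pdivlMr// mulrC addrC natr1.
have : eps^-1 < n%:R by near: n; exact: nbhs_infty_gtr.
move=> H; rewrite -[eps]invrK ltf_pV2 ?posrE ?invr_gt0//.
by rewrite (lt_trans H)// ltr_nat.
Unshelve. all: by end_near. Qed.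

Lemma measurable_Rintegral_param {R : realType} d (Omega : measurableType d)
    (T : R) (F : R -> Omega -> R) :
  measurable_fun [set: R * Omega] (fun p : R * Omega => F p.1 p.2) ->
  (forall t w, 0 <= F t w) ->
  measurable_fun [set: Omega]
    (fun w => \int[lebesgue_measure]_(t in `[0, T]) F t w)%R.
Proof.
move=> mF F0; rewrite /Rintegral.
apply: measurableT_comp => //.
have mFE : measurable_fun [set: R * Omega]
    (fun p : R * Omega => if p.1 \in `[0, T] then (F p.1 p.2)%:E else 0%E).
  apply: measurable_fun_ifT.
  - apply: (@measurableT_comp _ _ _ _ _ _ (fun t : R => t \in `[0, T])) => //.
    by apply: measurable_and; exact: measurable_fun_ler.
  - exact/measurable_EFinP.
  - exact: measurable_cst.
have F0E (p : R * Omega) : (0 <= (if p.1 \in `[0%R, T] then (F p.1 p.2)%:E else 0))%E.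
  by case: ifP => // _; rewrite lee_fin.
have := @measurable_fun_fubini_tonelli_G _ _ _ _ R lebesgue_measure _ mFE F0E.
apply: eq_measurable_fun => w _; rewrite /fubini_G [RHS]integral_mkcond.
by apply: eq_integral => t _; rewrite patchE mem_setE.
Qed.
Section independence.
Context {R : realType} d (Omega : measurableType d) (P : probability Omega R).
Local Open Scope ereal_scope.

(** By uniqueness on rectangles, the joint law of [A] and [N] is the product of the law of [A] with
    [nu]; Tonelli then freezes [A]. This takes the place of conditioning. *)
Lemma indep_ge0_integral d1 d2 (T1 : measurableType d1) (T2 : measurableType d2)
    (nu : probability T2 R)
    (A : Omega -> T1) (N : Omega -> T2) (F : T1 * T2 -> \bar R) :
  measurable_fun [set: Omega] A -> measurable_fun [set: Omega] N ->
  (forall U V, measurable U -> measurable V ->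
     P (A @^-1` U `&` N @^-1` V) = P (A @^-1` U) * nu V) ->
  measurable_fun [set: T1 * T2] F -> (forall p, 0 <= F p) ->
  \int[P]_w F (A w, N w) = \int[P]_w \int[nu]_y F (A w, y).
Proof.
move=> mA mN AN mF F0.
have mAN : measurable_fun [set: Omega] (fun w => (A w, N w)) by exact: measurable_fun_pair.
pose XA : {mfun Omega >-> T1} := HB.pack A (isMeasurableFun.Build _ _ _ _ A mA).
pose XN : {mfun Omega >-> (T1 * T2)%type} :=
  HB.pack (fun w => (A w, N w)) (isMeasurableFun.Build _ _ _ _ _ mAN).
pose mu1 := distribution P XA.
pose mu2 := distribution P XN.
have mu12 (X : set (T1 * T2)) : measurable X -> (mu1 \x nu) X = mu2 X.
  by apply: product_measure_unique => U V mU mV; exact: AN.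
transitivity (\int[mu2]_p F p).
  by rewrite ge0_integral_pushforward// preimage_setT.
rewrite (eq_measure_integral (mu1 \x nu)); last first.
  by move=> X mX _; exact/esym/mu12.
rewrite fubini_tonelli1// ge0_integral_pushforward//=.
- exact: measurable_fun_fubini_tonelli_F.
- by move=> a _; apply: integral_ge0.
Qed.

End independence.

Lemma measurable_fun_sub_sigma {R : realType} (Omega : pointedType)
    (G G' : set (set Omega)) (f : Omega -> R) :
  G `<=` <<s G' >> ->
  measurable_fun (setT : set (g_sigma_algebraType G)) f ->
  measurable_fun (setT : set (g_sigma_algebraType G')) f.
Proof.
move=> GG' mf _ A mA; have := mf measurableT A mA.
by apply: smallest_sub => //; exact: smallest_sigma_algebra.
Qed.

Lemma measurable_fun_g_sigma {R : realType} d (Omega : measurableType d)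
    (G : set (set Omega)) (f : Omega -> R) :
  G `<=` measurable ->
  measurable_fun (setT : set (g_sigma_algebraType G)) f ->
  measurable_fun [set: Omega] f.
Proof.
move=> Gm mf _ A mA; have := mf measurableT A mA.
by apply: smallest_sub => //; exact: sigma_algebra_measurable.
Qed.

Section proc_measurable.
Context {R : realType} d (Omega : measurableType d).

Lemma proc_events_measurable (X : R -> Omega -> R) (J : set R) :
  (forall t, measurable_fun [set: Omega] (X t)) -> proc_events X J `<=` measurable.
Proof. by move=> mX _ [t _ [A mA <-]]; exact: mX. Qed.

Lemma measurable_proc (X : R -> Omega -> R) (J : set R) (t : R) : J t ->
  measurable_fun (setT : set (g_sigma_algebraType (proc_events X J))) (X t).
Proof. by move=> Jt _ A mA; apply: sub_sigma_algebra; exists t => //; exists A. Qed.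

Lemma proc_eventsS (X : R -> Omega -> R) (J J' : set R) : J `<=` J' ->
  proc_events X J `<=` proc_events X J'.
Proof. by move=> JJ' E [t Jt Et]; exists t => //; exact: JJ'. Qed.

End proc_measurable.

(** * Increments of the Wiener process, given the whole path of [B] *)

Section wiener_increment.
Context {R : realType} d (Omega : measurableType d) (P : probability Omega R).
Variables (T : R) (W B : R -> {RV P >-> R}).
Hypothesis W_wiener : wiener T W.
Hypothesis WB_indep : indep_processes P (fun t => W t : Omega -> R)
                  (fun t => B t : Omega -> R) `[0, T].

(* The filtration at time [s] enlarged by the whole path of [B]: it is still
   independent of the later increments of [W]. *)
Definition past_events (s : R) : set (set Omega) :=
  proc_events (fun u => B u : Omega -> R) `[0, T]
  `|` proc_events (fun u => W u : Omega -> R) `[0, s].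

Lemma past_events_measurable s : past_events s `<=` measurable.
Proof. by move=> E [] ; apply: proc_events_measurable => t; exact: measurable_funP. Qed.

Local Open Scope ereal_scope.

(** Intersections of an event [A] of [B] with an event [C] of [W] up to [s] form a pi-system
    generating the enlarged past. There, independence of [W] and [B] detaches [A], both from [C] and
    from the intersection of [C] with [D], and independence of increments separates [C] from [D].
    Two finite measures that agree on the pi-system agree on what it generates. *)
Lemma wiener_increment_indep (s t : R) (E : set Omega) (V : set R) :
  (0 <= s)%R -> (s < t)%R -> (t <= T)%R -> <<s past_events s >> E -> measurable V ->
  P (E `&` (fun w => W t w - W s w)%R @^-1` V)
  = P E * normal_prob 0 (Num.sqrt (t - s)) V.
Proof.
move=> s0 st tT sE mV; have [_ _ Wind Wlaw] := W_wiener.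
rewrite -(Wlaw _ _ s0 st tT _ mV).
set D := _ @^-1` V.
have tI : `[0%R, T]%classic t by rewrite /= in_itv/= tT (le_trans s0 (ltW st)).
have sI : `[0%R, T]%classic s by rewrite /= in_itv/= s0 (le_trans (ltW st)).
pose GW := proc_events (fun u => W u : Omega -> R) `[0%R, T].
pose GB := proc_events (fun u => B u : Omega -> R) `[0%R, T].
pose GWs := proc_events (fun u => W u : Omega -> R) `[0%R, s].
have GBm : <<s GB >> `<=` measurable.
  apply: smallest_sub; first exact: sigma_algebra_measurable.
  by apply: proc_events_measurable => u; exact: measurable_funP.
have GWm : <<s GW >> `<=` measurable.
  apply: smallest_sub; first exact: sigma_algebra_measurable.
  by apply: proc_events_measurable => u; exact: measurable_funP.
have GWsW : <<s GWs >> `<=` <<s GW >>.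
  apply: sub_sigma_algebra2; apply: proc_eventsS; apply: subset_itvl.
  by rewrite bnd_simp (le_trans (ltW st)).
have GWD : <<s GW >> D.
  have : measurable_fun (setT : set (g_sigma_algebraType GW)) (fun w => W t w - W s w)%R.
    by apply: measurable_funB; [exact: (measurable_proc (X := fun u => W u : Omega -> R) tI)|
      exact: (measurable_proc (X := fun u => W u : Omega -> R) sI)].
  by move=> /(_ measurableT _ mV); rewrite setTI.
have mD := GWm _ GWD.
pose Pi : set (set Omega) := [set X | exists A C, [/\ <<s GB >> A, <<s GWs >> C & X = A `&` C]].
have mPi : Pi `<=` measurable.
  by move=> X [A [C [/GBm mA /GWsW/GWm mC ->]]]; exact: measurableI.
have PiI : setI_closed Pi.
  move=> _ _ [A [C [sA sC ->]]] [A' [C' [sA' sC' ->]]].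
  exists (A `&` A'), (C `&` C'); split; last by rewrite setIACA.
  - exact: (@measurableI _ (g_sigma_algebraType GB)).
  - exact: (@measurableI _ (g_sigma_algebraType GWs)).
have GsPi : <<s past_events s >> `<=` <<s Pi >>.
  apply: sub_sigma_algebra2 => X [XB|XW].
    exists X, setT; split; [exact: sub_sigma_algebra| |by rewrite setIT].
    exact: (@measurableT _ (g_sigma_algebraType GWs)).
  exists setT, X; split; [|exact: sub_sigma_algebra|by rewrite setTI].
  exact: (@measurableT _ (g_sigma_algebraType GB)).
have PPi X : Pi X -> P (X `&` D) = P X * P D.
  move=> [A [C [sA sC ->]]].
  have CD : P (C `&` D) = P C * P D by apply: (Wind s t) => //; exists V => //; rewrite setTI.
  have ACD : P (A `&` (C `&` D)) = P A * P (C `&` D).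
    rewrite setIC muleC; apply: WB_indep => //.
    by apply: (@measurableI _ (g_sigma_algebraType GW)) => //; exact: GWsW.
  have AC : P (A `&` C) = P A * P C by rewrite setIC muleC; apply: WB_indep => //; exact: GWsW.
  by rewrite -setIA ACD CD AC muleA.
have PD : P D \is a fin_num by exact: fin_num_measure.
pose mu1 := mrestr P mD.
pose mu2 := mscale (NngNum (fine_ge0 (measure_ge0 P D))) P.
have : mu1 E = mu2 E.
  apply: (g_sigma_algebra_measure_unique_trace Pi setT) => //.
  - by move=> X [/mPi].
  - move=> X Y [PX _] [PY _]; split => //; exact: PiI.
  - change (P ([set: Omega] `&` D) = (fine (P D))%:E * P [set: Omega]).
    by rewrite setTI probability_setT mule1 fineK.
  - move=> X [PX _]; change (P (X `&` D) = (fine (P D))%:E * P X).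
    by rewrite fineK// muleC; exact: PPi.
  - change (P ([set: Omega] `&` D) < +oo).
    by rewrite setTI ltey_eq PD.
  - apply: sub_sigma_algebra2 (GsPi _ sE) => X PX; split => //.
change (P (E `&` D) = (fine (P D))%:E * P E -> P (E `&` D) = P E * P D).
by rewrite fineK// muleC.
Qed.

Let Bsig := proc_events (fun u => B u : Omega -> R) `[0%R, T].

(** The coefficients may use the whole path of [B], future included, but not [W]. They are
    nonnegative so that [gauss_rotation] applies to them directly. *)
Lemma elem_int_mixture (n : nat) (x : nat -> R) (xi : nat -> Omega -> R)
    (U : Omega -> R) (psi : R -> \bar R) :
  (0 <= x 0%N)%R -> (forall i, (i < n)%N -> (x i < x i.+1)%R) -> (x n <= T)%R ->
  (forall i w, (0 <= xi i w)%R) ->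
  (forall i, measurable_fun (setT : set (g_sigma_algebraType Bsig)) (xi i)) ->
  measurable_fun (setT : set (g_sigma_algebraType Bsig)) U ->
  measurable_fun [set: R] psi -> (forall y, 0 <= psi y) ->
  \int[P]_w psi (U w + \sum_(i < n) xi i w * (W (x i.+1) w - W (x i) w))%R
  = \int[P]_w \int[normal_prob 0 1]_z
      psi (U w + Num.sqrt (\sum_(i < n) xi i w ^+ 2 * (x i.+1 - x i)) * z)%R.
Proof.
move=> x0 xS xT xi0 mxi mU mpsi psi0.
have xle i j : (i <= j)%N -> (j <= n)%N -> (x i <= x j)%R.
  elim: j => [|j IH]; first by rewrite leqn0 => /eqP->.
  rewrite leq_eqVlt => /predU1P[->//|ij] jn.
  by rewrite (le_trans (IH ij (ltnW jn)))// ltW// xS.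
pose S k w := (\sum_(i < k) xi i w * (W (x i.+1) w - W (x i) w))%R.
pose V k w := (\sum_(k <= i < n) xi i w ^+ 2 * (x i.+1 - x i))%R.
have V0 k w : (0 <= V k w)%R.
  rewrite /V big_nat_cond; apply: sumr_ge0 => i; rewrite andbT => /andP[_ i_n].
  by rewrite mulr_ge0 ?exprn_ge0// subr_ge0 ltW// xS.
(* The last [k] increments of [W] are replaced by one Gaussian variable whose
   variance is their conditional variance given [B]. *)
suff H k : (k <= n)%N -> \int[P]_w psi (U w + S n w)%R =
    \int[P]_w \int[normal_prob 0 1]_z psi (U w + S (n - k)%N w + Num.sqrt (V (n - k)%N w) * z)%R.
  transitivity (\int[P]_w psi (U w + S n w)%R) => //.
  rewrite (H n (leqnn n)) subnn; apply: eq_integral => w _; apply: eq_integral => z _.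
  by rewrite /S big_ord0 addr0 /V big_mkord.
elim: k => [_|k IH kn].
  rewrite subn0; apply: eq_integral => w _; rewrite /V big_geq// sqrtr0.
  under eq_integral do rewrite mul0r addr0.
  by rewrite integral_cst//= probability_setT mule1.
rewrite (IH (ltnW kn)); set j := (n - k.+1)%N.
have -> : (n - k)%N = j.+1 by rewrite /j subnSK.
have jn : (j < n)%N by rewrite /j ltn_subrL (leq_ltn_trans _ kn).
have xj : (0 < x j.+1 - x j)%R by rewrite subr_gt0 xS.
have xj0 : (0 <= x j)%R by rewrite (le_trans x0)// xle// ltnW.
have xjT : (x j.+1 <= T)%R by rewrite (le_trans _ xT)// xle.
pose G := past_events (x j).
have mB (f : Omega -> R) : measurable_fun (setT : set (g_sigma_algebraType Bsig)) f ->
    measurable_fun (setT : set (g_sigma_algebraType G)) f.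
  by apply: measurable_fun_sub_sigma => E BE; apply: sub_sigma_algebra; left.
have mW (u : R) : (0 <= u <= x j)%R -> measurable_fun (setT : set (g_sigma_algebraType G)) (W u).
  move=> uj; apply: (@measurable_fun_sub_sigma _ _ (proc_events (fun u => W u : Omega -> R) `[0%R, x j])).
    by move=> E WE; apply: sub_sigma_algebra; right.
  exact: (measurable_proc (X := fun u => W u : Omega -> R)).
(* All that is frozen while increment number [j] is integrated. [V j.+1] concerns later times but is
   a function of [B], hence belongs to the enlarged past. *)
pose A w : R * (R * R) := (U w + S j w, (xi j w, Num.sqrt (V j.+1 w)))%R.
have mA : measurable_fun (setT : set (g_sigma_algebraType G)) A.
  apply: measurable_fun_pair; [|apply: measurable_fun_pair].
  - apply: measurable_funD; first exact: mB.
    rewrite /S.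
    apply: measurable_sum => i; apply: measurable_funM.
      exact: (mB _ (mxi i)).
    have ij : (i < j)%N by exact: ltn_ord.
    apply: measurable_funB; apply: mW.
      by rewrite (le_trans x0) ?xle// ltnW// (leq_ltn_trans ij).
    by rewrite (le_trans x0) ?xle// ltnW// ltnW// (leq_ltn_trans ij).
  - exact: (mB _ (mxi j)).
  - apply: (measurableT_comp (f := @Num.sqrt R)).
      by apply: continuous_measurable_fun; exact: sqrt_continuous.
    rewrite /V; apply: measurable_sum => i.
    apply: measurable_funM => //; apply: measurable_funX; exact: (mB _ (mxi i)).
have mA' : measurable_fun [set: Omega] A.
  move=> _ Y mY; have := mA measurableT Y mY; rewrite !setTI => K.
  apply: (smallest_sub (@sigma_algebra_measurable _ Omega) (@past_events_measurable (x j))) K.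
pose F (p : R * (R * R) * R) :=
  \int[normal_prob 0 1]_z psi (p.1.1 + p.1.2.1 * p.2 + p.1.2.2 * z)%R.
have mFF : measurable_fun setT (fun q : (R * (R * R) * R) * R =>
    psi (q.1.1.1 + q.1.1.2.1 * q.1.2 + q.1.1.2.2 * q.2)%R).
  apply: (measurableT_comp mpsi); apply: measurable_funD; [apply: measurable_funD|].
  - exact: (measurableT_comp (measurableT_comp measurable_fst measurable_fst) measurable_fst).
  - apply: measurable_funM; last exact: (measurableT_comp measurable_snd measurable_fst).
    exact: (measurableT_comp (measurableT_comp (measurableT_comp measurable_fst measurable_snd) measurable_fst) measurable_fst).
  - apply: measurable_funM => //.
    exact: (measurableT_comp (measurableT_comp (measurableT_comp measurable_snd measurable_snd) measurable_fst) measurable_fst).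
have mF : measurable_fun setT F.
  exact: (@measurable_fun_fubini_tonelli_F _ _ _ _ _ (normal_prob 0 1) _ mFF (fun q => psi0 _)).
have F0 p : 0 <= F p by apply: integral_ge0.
pose N w := (W (x j.+1) w - W (x j) w)%R.
have mN : measurable_fun [set: Omega] N.
  by apply: measurable_funB; exact: measurable_funP.
have AN Y V' : measurable Y -> measurable V' ->
    P (A @^-1` Y `&` N @^-1` V') = P (A @^-1` Y) * normal_prob 0 (Num.sqrt (x j.+1 - x j)) V'.
  move=> mY mV'; apply: wiener_increment_indep => //.
    by rewrite -subr_gt0.
  by have := mA measurableT _ mY; rewrite setTI.
transitivity (\int[P]_w F (A w, N w)).
  apply: eq_integral => w _; apply: eq_integral => z _ /=.
  by rewrite /S big_ord_recr/= addrA.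
rewrite (@indep_ge0_integral _ _ _ P _ _ _ (measurableTypeR R) (normal_prob 0 (Num.sqrt (x j.+1 - x j))) A N F mA' mN AN mF F0).
apply: eq_integral => w _.
have sq0 : (0 < Num.sqrt (x j.+1 - x j))%R by rewrite sqrtr_gt0.
have mFA : measurable_fun [set: R] (fun y => F (A w, y)).
  exact: (measurableT_comp mF (pair1_measurable (A w))).
rewrite (ge0_integral_normal_prob 0 sq0 mFA (fun y => F0 (A w, y))).
transitivity (\int[normal_prob 0 1]_y \int[normal_prob 0 1]_z
    psi (U w + S j w + (xi j w * Num.sqrt (x j.+1 - x j) * y + Num.sqrt (V j.+1 w) * z))%R).
  apply: eq_integral => y _; apply: eq_integral => z _ /=.
  by rewrite add0r mulrA -addrA.
(* [y] is the increment being peeled off, normalised, and [z] the variable that already replaces the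
   later ones; their variances add up to [V j]. *)
rewrite (gauss_rotation (h := fun y => psi (U w + S j w + y)%R)) ?mulr_ge0 ?sqrtr_ge0//.
- apply: eq_integral => z _; congr (psi (_ + Num.sqrt _ * _))%R.
  rewrite exprMn !sqr_sqrtr// ?(ltW xj)//.
  by rewrite /V [in RHS]big_ltn.
- by apply: (measurableT_comp mpsi); exact: measurable_funD.
Qed.

End wiener_increment.

(** * Approximation by elementary processes *)

Section law_uniqueness.
Context {R : realType}.
Local Open Scope ereal_scope.

(** Vanishes on [a, +oo[ and tends to 1 at each point below [a], so the limit is the indicator of
    the open half-line, through functions that are Lipschitz with constant [n]. *)
Definition ramp (n : nat) (a x : R) : R := (Num.min 1 (Num.max 0 (n%:R * (a - x))))%R.

Lemma ramp01 n a x : (0 <= ramp n a x <= 1)%R.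
Proof. by rewrite /ramp ge_min lexx/= le_min ler01/= le_max lexx. Qed.

Lemma ramp_lipschitz n a x y : (`|ramp n a x - ramp n a y| <= n%:R * `|x - y|)%R.
Proof.
have mm (u v : R) : (`|Num.min 1 (Num.max 0 u) - Num.min 1 (Num.max 0 v)| <= `|u - v|)%R.
  have := ler_norm (u - v); have := ler_norm (v - u); rewrite (distrC v u).
  case: (leP 1%R (Num.max 0%R u)); case: (leP 1%R (Num.max 0%R v));
    case: (leP 0%R u) => ?; case: (leP 0%R v) => ? ? ? ? ?;
    rewrite ler_norml; apply/andP; split; lra.
rewrite /ramp (le_trans (mm _ _))// -mulrBr normrM ger0_norm//.
by rewrite (_ : a - x - (a - y) = y - x)%R; [rewrite distrC|ring].
Qed.

Lemma ramp_cvg a x : (fun n => (ramp n a x)%:E) @ \oo --> (\1_(`]-oo, a[%classic) x)%:E.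
Proof.
apply: cvg_EFin; first exact: nearW.
rewrite indicE mem_setE in_itv/=; have [xa|ax] := ltP x a.
  apply: cvg_near_cst; near=> n; rewrite /ramp; apply/eqP; rewrite eq_sym.
  apply/eqP; apply/esym/min_idPl; rewrite le_max; apply/orP; right.
  rewrite -ler_pdivrMr ?subr_gt0// mul1r; near: n; exact: nbhs_infty_ger.
rewrite (_ : (fun _ => _) = cst 0%R); first exact: cvg_cst.
apply/funext => n /=; rewrite /ramp (max_idPl _) ?(min_idPr _)//.
by rewrite mulr_ge0_le0// subr_le0.
Unshelve. all: by end_near. Qed.

(** Ramps and dominated convergence give all half-lines ]-oo, a[ the same mass, and these form a
    generating pi-system. Lipschitz tests are the ones an L^2 limit can handle, while the conclusion
    reaches unbounded functions [g]. *)
Lemma lipschitz_law_eq d1 d2 (T1 : measurableType d1) (T2 : measurableType d2)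
    (m1 : {measure set T1 -> \bar R}) (m2 : {measure set T2 -> \bar R})
    (X1 : T1 -> R) (X2 : T2 -> R) :
  m1 setT < +oo -> m2 setT < +oo ->
  measurable_fun [set: T1] X1 -> measurable_fun [set: T2] X2 ->
  (forall (h : R -> R) (L : R), (0 <= L)%R -> (forall x, (0 <= h x <= 1)%R) ->
     (forall x y, (`|h x - h y| <= L * `|x - y|)%R) ->
     measurable_fun [set: R] h ->
     \int[m1]_w (h (X1 w))%:E = \int[m2]_w (h (X2 w))%:E) ->
  forall g : R -> \bar R, measurable_fun [set: R] g -> (forall x, 0 <= g x) ->
    \int[m1]_w g (X1 w) = \int[m2]_w g (X2 w).
Proof.
move=> m1oo m2oo mX1 mX2 H g mg g0.
pose pn1 := (pushforward m1 (X1 : T1 -> measurableTypeR R)) : {measure set (measurableTypeR R) -> \bar R}.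
pose pn2 := (pushforward m2 (X2 : T2 -> measurableTypeR R)) : {measure set (measurableTypeR R) -> \bar R}.
pose n1 := pn1 mX1; pose n2 := pn2 mX2.
have mramp n a : measurable_fun [set: R] (ramp n a).
  apply: measurable_minr => //; apply: measurable_maxr => //.
  by apply: measurable_funM => //; exact: measurable_funB.
have half d (T : measurableType d) (m : {measure set T -> \bar R}) (X : T -> R) a :
    m setT < +oo -> measurable_fun [set: T] X ->
    \int[m]_w (ramp n a (X w))%:E @[n --> \oo] --> m (X @^-1` `]-oo, a[).
  move=> moo mX.
  have mXa : measurable (X @^-1` `]-oo, a[).
    by rewrite -[X in measurable X]setTI; exact: mX.
  have := @dominated_cvg _ _ _ m setT measurableT
    (fun n w => (ramp n a (X w))%:E) (fun w => (\1_(X @^-1` `]-oo, a[) w)%:E) (cst 1).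
  rewrite integral_indic// setIT; apply.
  - by move=> n; apply/measurable_EFinP; apply: measurableT_comp.
  - by move=> w _; exact: ramp_cvg.
  - by move=> w _.
  - apply/integrableP; split => //.
    by rewrite /= normr1 integral_cst// mul1e.
  - by move=> n w _ /=; rewrite lee_fin ger0_norm; have /andP[] := ramp01 n a (X w).
have n12 A : measurable A -> n1 A = n2 A.
  move=> mA; apply: (@g_sigma_algebra_measure_unique_trace _ R (measurableTypeR R)
    (@RGenInftyO.G R) setT measurableT _ _ n1 n2) => //.
  - by move=> _ [[x ->] _]; exact: measurable_itv.
  - move=> _ _ [[x ->] _] [[y ->] _]; split=> //; exists (Num.min x y).
    apply/seteqP; split => z /=; rewrite !in_itv/= lt_min.
      by move=> [-> ->].
    by move=> /andP[].
  - change (m1 (X1 @^-1` setT) = m2 (X2 @^-1` setT)); rewrite !preimage_setT.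
    have := H (fun=> 1%R) 0%R (lexx _) _ _ (measurable_cst _); rewrite /= !integral_cst// !mul1e; apply.
    + by move=> _; rewrite ler01 lexx.
    + by move=> x y; rewrite subrr normr0 mul0r.
  - move=> _ [[a ->] _].
    change (m1 (X1 @^-1` `]-oo, a[) = m2 (X2 @^-1` `]-oo, a[)).
    have h1 := half _ _ m1 X1 a m1oo mX1.
    have h2 := half _ _ m2 X2 a m2oo mX2.
    have E : (fun n => \int[m1]_w (ramp n a (X1 w))%:E) = (fun n => \int[m2]_w (ramp n a (X2 w))%:E).
      apply/funext => n; apply: (H _ n%:R) => //; first by move=> x; exact: ramp01.
      by move=> x y; exact: ramp_lipschitz.
    by rewrite E in h1; exact: (cvg_unique _ h1 h2).
  - move: mA; rewrite -[measurable]/((@ocitv R).-sigma.-measurable) RGenInftyO.measurableE.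
    by apply: sub_sigma_algebra2 => X GX; split.
have E1 := @ge0_integral_pushforward _ _ T1 (measurableTypeR R) R X1 mX1 m1 setT g measurableT mg (fun x _ => g0 x).
have E2 := @ge0_integral_pushforward _ _ T2 (measurableTypeR R) R X2 mX2 m2 setT g measurableT mg (fun x _ => g0 x).
rewrite !preimage_setT in E1 E2; rewrite -[LHS]E1 -[RHS]E2.
change (\int[n1]_y g y = \int[n2]_y g y).
by rewrite (eq_measure_integral n2)// => A mA _; exact: n12.
Qed.

End law_uniqueness.

(** * Mean square limits of processes *)

Section L2_limits.
Context {R : realType} d (Omega : measurableType d) (P : probability Omega R).
Notation leb := (@lebesgue_measure R).
Variable T : R.
Hypothesis T0 : 0 < T.
Local Open Scope ereal_scope.

(** The square of the distance in L^2(du x P), in the form used by [ito_approx]. *)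
Definition L2dist (phi psi : R -> Omega -> R) : \bar R :=
  \int[P]_w \int[leb]_(u in `[0%R, T]) ((phi u w - psi u w) ^+ 2)%:E.

Definition jmeas (phi : R -> Omega -> R) :=
  measurable_fun [set: R * Omega] (fun p : R * Omega => phi p.1 p.2).

Lemma jmeas_restrict (f : R * Omega -> \bar R) : measurable_fun setT f ->
  measurable_fun setT (fun p : R * Omega => if p.1 \in `]0%R, T] then f p else 0).
Proof.
move=> mf; apply: measurable_fun_ifT => //.
apply: (@measurableT_comp _ _ _ _ _ _ (fun t : R => t \in `]0%R, T])) => //.
by apply: measurable_and; [exact: measurable_fun_ltr|exact: measurable_fun_ler].
Qed.

(** Time 0 is a null set and is dropped: elementary processes live on intervals ]x_i, x_(i+1)] and
    vanish at 0, so pointwise convergence is available only for u > 0. *)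
Lemma iterated_integralE (f : R * Omega -> \bar R) : measurable_fun setT f ->
  (forall p, 0 <= f p) ->
  \int[P]_w \int[leb]_(u in `[0%R, T]) f (u, w)
  = \int[leb \x P]_p (if p.1 \in `]0%R, T] then f p else 0).
Proof.
move=> mf f0; rewrite fubini_tonelli2; [|exact: jmeas_restrict|by move=> p /=; case: ifP].
- apply: eq_integral => w _; rewrite /fubini_G -(@integral_itv_obnd_cbnd R 0%R (BRight T) (fun u => f (u, w))).
    rewrite [LHS]integral_mkcond; apply: eq_integral => u _.
    by rewrite patchE mem_setE.
  apply: measurable_funTS; exact: (measurableT_comp mf (pair2_measurable w)).
Qed.

Lemma L2_dominated (phi_ : nat -> R -> Omega -> R) (phi psi : R -> Omega -> R) :
  (forall n, jmeas (phi_ n)) -> jmeas phi -> jmeas psi ->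
  (forall u w, (0 < u <= T)%R -> phi_ n u w @[n --> \oo] --> phi u w) ->
  (forall n u w, (0 < u <= T)%R -> (`|phi_ n u w - phi u w| <= psi u w)%R) ->
  \int[P]_w \int[leb]_(u in `[0%R, T]) ((psi u w) ^+ 2)%:E < +oo ->
  L2dist (phi_ n) phi @[n --> \oo] --> 0.
Proof.
move=> mphi_ mphi mpsi phi_cvg phi_le psioo.
have mdiff n : measurable_fun setT (fun p : R * Omega => ((phi_ n p.1 p.2 - phi p.1 p.2) ^+ 2)%:E).
  by apply/measurable_EFinP; apply: measurable_funX; apply: measurable_funB; [exact: mphi_|exact: mphi].
have mpsi2 : measurable_fun setT (fun p : R * Omega => (psi p.1 p.2 ^+ 2)%:E).
  by apply/measurable_EFinP; apply: measurable_funX; exact: mpsi.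
have E n : L2dist (phi_ n) phi = \int[leb \x P]_p
    (if p.1 \in `]0%R, T] then ((phi_ n p.1 p.2 - phi p.1 p.2) ^+ 2)%:E else 0).
  by rewrite -iterated_integralE// => p; rewrite lee_fin sqr_ge0.
under eq_fun do rewrite E.
have := @dominated_cvg _ _ _ (leb \x P) setT measurableT (fun n p => (if p.1 \in `]0%R, T] then ((phi_ n p.1 p.2 - phi p.1 p.2) ^+ 2)%:E else 0)) (cst 0) (fun p => if p.1 \in `]0%R, T] then (psi p.1 p.2 ^+ 2)%:E else 0).
rewrite integral0; apply.
- by move=> n; apply: jmeas_restrict.
- move=> [u w] _ /=; case: (boolP (u \in `]0%R, T])) => uT; last exact: cvg_cst.
  apply: cvg_EFin; first exact: nearW.
  rewrite [X in _ --> X](_ : _ = (phi u w - phi u w) ^+ 2)%R; last by rewrite subrr expr0n.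
  apply: (cvg_comp _ (fun x : R => x ^+ 2)%R _ (@exprn_continuous R 2 _)).
  apply: cvgB; last exact: cvg_cst.
  by apply: phi_cvg; move: uT; rewrite in_itv.
- by move=> p _; case: ifP.
- apply/integrableP; split; first exact: jmeas_restrict.
  move: psioo; rewrite (@iterated_integralE (fun p => (psi p.1 p.2 ^+ 2)%:E))//; last first.
    by move=> p; rewrite lee_fin sqr_ge0.
  apply: le_lt_trans; rewrite le_eqVlt; apply/orP; left; apply/eqP.
  apply: eq_integral => p _; case: ifP => _; rewrite ?abse0//.
  by rewrite gee0_abs// lee_fin sqr_ge0.
- move=> n [u w] _ /=; case: ifPn => uT; rewrite ?abse0//.
  rewrite lee_fin normrX ler_sqr ?nnegrE ?normr_ge0//.
    by apply: phi_le; move: uT; rewrite in_itv.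
  by rewrite (le_trans (normr_ge0 (phi_ n u w - phi u w)%R))// phi_le//; move: uT; rewrite in_itv.
Qed.

(** The distances are squared, so the pointwise inequality is (x + y)^2 <= 2 x^2 + 2 y^2. *)
Lemma L2dist_triangle (phi psi chi : R -> Omega -> R) :
  jmeas phi -> jmeas psi -> jmeas chi ->
  L2dist phi chi <= 2%:E * L2dist phi psi + 2%:E * L2dist psi chi.
Proof.
move=> m1 m2 m3.
have mB f g : jmeas f -> jmeas g -> measurable_fun setT (fun p : R * Omega => ((f p.1 p.2 - g p.1 p.2) ^+ 2)%:E).
  by move=> mf mg; apply/measurable_EFinP; apply: measurable_funX; apply: measurable_funB; [exact: mf|exact: mg].
have p0 f g (p : R * Omega) : 0 <= ((f p.1 p.2 - g p.1 p.2) ^+ 2 : R)%:E.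
  by rewrite lee_fin sqr_ge0.
rewrite /L2dist.
rewrite (@iterated_integralE (fun p => ((phi p.1 p.2 - chi p.1 p.2) ^+ 2)%:E)); [|exact: mB|exact: p0].
rewrite (@iterated_integralE (fun p => ((phi p.1 p.2 - psi p.1 p.2) ^+ 2)%:E)); [|exact: mB|exact: p0].
rewrite (@iterated_integralE (fun p => ((psi p.1 p.2 - chi p.1 p.2) ^+ 2)%:E)); [|exact: mB|exact: p0].
have pos (f g : R -> Omega -> R) (p : R * Omega) :
    0 <= (if p.1 \in `]0%R, T] then ((f p.1 p.2 - g p.1 p.2) ^+ 2)%:E else 0%E).
  by case: ifP => _; rewrite ?lexx ?p0.
rewrite -!ge0_integralZl//; [|exact: jmeas_restrict (mB _ _ m2 m3)|exact: jmeas_restrict (mB _ _ m1 m2)].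
have mZ f g : jmeas f -> jmeas g -> measurable_fun setT (fun p : R * Omega => 2%:E *
    (if p.1 \in `]0%R, T] then ((f p.1 p.2 - g p.1 p.2) ^+ 2)%:E else 0)).
  by move=> mf mg; apply: emeasurable_funM => //; exact: jmeas_restrict (mB _ _ mf mg).
rewrite -ge0_integralD//; [|by move=> p _; rewrite mule_ge0|exact: mZ|by move=> p _; rewrite mule_ge0|exact: mZ].
apply: ge0_le_integral => //.
- exact: jmeas_restrict (mB _ _ m1 m3).
- by apply: emeasurable_funD; exact: mZ.
- move=> p _; case: ifP => _; last by rewrite !mule0 adde0.
  rewrite -!EFinM -EFinD lee_fin.
  have := sqr_ge0 ((phi p.1 p.2 - psi p.1 p.2) - (psi p.1 p.2 - chi p.1 p.2))%R; nra.
Qed.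

End L2_limits.
Section step_processes.
Context {R : realType} d (Omega : measurableType d).
Notation leb := (@lebesgue_measure R).
Variable T : R.
Hypothesis T0 : 0 < T.

Lemma upart_le (n i j : nat) : (i <= j)%N -> (j <= n.+1)%N ->
  node 0 (upart T n) i <= node 0 (upart T n) j.
Proof.
move=> ij jn; rewrite !node_upart ?(leq_trans ij)//.
by rewrite ler_pM2r ?invr_gt0// ler_pM2l// ler_nat.
Qed.

(** The intervals ]x_i, x_(i+1)] are disjoint and cover ]0, T], so one summand survives, that of the
    least [i] with u <= x_(i+1). *)
Lemma elem_proc_upart (n : nat) (xi : nat -> Omega -> R) (u : R) (w : Omega) :
  0 < u <= T -> exists i, [/\ (i <= n)%N,
    node 0 (upart T n) i < u <= node 0 (upart T n) i.+1 &
    elem_proc (upart T n) xi u w = xi i w].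
Proof.
move=> /andP[u0 uT].
have ex : exists i, (u <= node 0 (upart T n) i.+1) && (i <= n)%N.
  by exists n; rewrite leqnn andbT node_upart// mulfK.
case: (ex_minnP ex) => i /andP[ui i_n] mini.
have iu : node 0 (upart T n) i < u.
  case: i ui i_n mini => [|i] ui i_n mini; first by rewrite node_upart// mulr0 mul0r.
  rewrite ltNge; apply/negP => h; have := mini i; rewrite h (ltnW i_n) => /(_ isT).
  by rewrite ltnn.
exists i; split => //; first by rewrite iu ui.
rewrite /elem_proc size_upart (bigD1 (Ordinal (i_n : (i < n.+1)%N)))//= big1 ?addr0.
  by rewrite indicE mem_set ?mulr1//= in_itv/= iu ui.
move=> j ji; rewrite indicE memNset ?mulr0//= in_itv/= => /andP[ju uj].
have : (j < i)%N || (i < j)%N by rewrite -neq_ltn; move: ji; apply: contra => /eqP h; apply/eqP/val_inj.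
move=> /orP[h|h].
  have := @upart_le n j.+1 i h (leqW i_n); rewrite leNgt => /negP; apply.
  exact: lt_le_trans iu uj.
have := @upart_le n i.+1 j h (ltnW (ltn_ord j)); rewrite leNgt => /negP; apply.
exact: lt_le_trans ju ui.
Qed.

Lemma elem_proc_jmeas (s : seq R) (xi : nat -> Omega -> R) :
  (forall i, measurable_fun [set: Omega] (xi i)) -> jmeas (elem_proc s xi).
Proof.
move=> mxi; apply: measurable_sum => i; apply: measurable_funM.
  exact: (measurableT_comp (mxi i)).
apply: (measurableT_comp (f := \1_(`]node 0 s i, node 0 s i.+1]%classic) : R -> R)) => //.
Qed.

(** At each time at most one summand is nonzero, so squaring acts on the coefficients. The sum is
    the conditional variance that appears in [elem_int_mixture]. *)
Lemma elem_proc_sqr_integral (n : nat) (xi : nat -> Omega -> R) (w : Omega) :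
  (\int[leb]_(u in `[0, T]) (elem_proc (upart T n) xi u w ^+ 2)
  = \sum_(i < n.+1) xi i w ^+ 2 * (node 0 (upart T n) i.+1 - node 0 (upart T n) i))%R.
Proof.
have mI (i : nat) : measurable_fun [set: R]
    (fun u : R => xi i w ^+ 2 * \1_(`]node 0 (upart T n) i, node 0 (upart T n) i.+1]%classic) u).
  by apply: measurable_funM.
transitivity (\int[leb]_(u in `]0%R, T]) (elem_proc (upart T n) (fun i w => xi i w ^+ 2) u w))%R.
  rewrite /Rintegral -integral_itv_obnd_cbnd; last first.
    apply: measurable_funTS; apply/measurable_EFinP; apply: measurable_funX.
    by apply: measurable_sum => i; apply: measurable_funM.
  congr fine; apply: eq_integral => u; rewrite inE/= in_itv/= => uT; congr EFin.
  have [i [i_n iu ->]] := @elem_proc_upart n xi u w uT.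
  have [j [j_n ju ->]] := @elem_proc_upart n (fun i w => xi i w ^+ 2) u w uT.
  suff -> : i = j by [].
  apply/eqP; move: iu ju => /andP[i1 i2] /andP[j1 j2].
  rewrite eqn_leq; apply/andP; split; rewrite leqNgt; apply/negP => h.
    have := upart_le h (leqW i_n); rewrite leNgt => /negP; apply; exact: lt_le_trans i1 j2.
  have := upart_le h (leqW j_n); rewrite leNgt => /negP; apply; exact: lt_le_trans j1 i2.
rewrite /Rintegral /elem_proc size_upart.
transitivity (fine (\sum_(i < n.+1) (xi i w ^+ 2 * (node 0 (upart T n) i.+1 - node 0 (upart T n) i))%:E)%E); last first.
  by rewrite sumEFin.
congr fine.
under eq_integral do rewrite -sumEFin.
rewrite ge0_integral_sum//; last 2 first.
- by move=> i; apply/measurable_EFinP; apply: measurable_funTS; exact: mI.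
- by move=> i u _; rewrite lee_fin mulr_ge0 ?sqr_ge0.
apply: eq_bigr => i _.
under eq_integral do rewrite EFinM.
rewrite ge0_integralZl//; last 2 first.
- by apply/measurable_EFinP/measurable_funTS.
- by rewrite lee_fin sqr_ge0.
rewrite integral_indic//.
have i_n : (i <= n)%N by rewrite -ltnS.
have /andP[a0 _] := @node_upart_itv _ T n i (ltW T0) (leqW i_n).
have /andP[_ bT] := @node_upart_itv _ T n i.+1 (ltW T0) i_n.
rewrite (_ : _ `&` _ = `]node 0 (upart T n) i, node 0 (upart T n) i.+1]%classic); last first.
  apply/seteqP; split => [u []//|u /=]; rewrite !in_itv/= => /andP[h1 h2].
  by rewrite h1 h2 (le_lt_trans a0 h1) (le_trans h2 bT).
have L : leb `]node 0 (upart T n) i, node 0 (upart T n) i.+1]%classic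
    = (node 0 (upart T n) i.+1 - node 0 (upart T n) i)%:E.
  rewrite lebesgue_measure_itv/= lte_fin.
  have -> : node 0 (upart T n) i < node 0 (upart T n) i.+1.
    by rewrite -subr_gt0 node_upartB// divr_gt0.
  by rewrite -EFinB.
by rewrite [RHS]EFinM; congr (_ * _)%E; exact: L.
Qed.

End step_processes.

Section step_approximation.
Context {R : realType} d (Omega : measurableType d) (P : probability Omega R).
Notation leb := (@lebesgue_measure R).
Variable T : R.
Hypothesis T0 : 0 < T.
Variable F : R -> Omega -> R.
Hypothesis mF : forall t, 0 <= t -> measurable_fun [set: Omega] (F t).
Hypothesis cF : forall w, continuous (F ^~ w).
Hypothesis F0c : forall t w, t <= 0 -> F t w = F 0 w.
Hypothesis F0 : forall t w, 0 <= F t w.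

(** Sampling at the left endpoint gives adaptedness, and the cap [M] the boundedness demanded by
    [elementary]. Past the last index [node] defaults to 0, so the sampling time is nonnegative for
    every [i]. *)
Definition step_xi (M : R) (n i : nat) (w : Omega) : R :=
  Num.min (F (node 0 (upart T n) i) w) M.

Let node_ge0 n i : 0 <= node 0 (upart T n) i.
Proof.
have [i_n|n_i] := leqP i n.+1; first by have /andP[] := node_upart_itv (ltW T0) i_n.
rewrite /node nth_default//; change (size (upart T n) < i)%N.
by rewrite size_upart.
Qed.

Lemma step_xi_measurable M n i : measurable_fun [set: Omega] (step_xi M n i).
Proof. by apply: measurable_minr => //; apply: mF; exact: node_ge0. Qed.

Lemma L2_step_cvg (M : R) : 0 <= M ->
  L2dist P T (elem_proc (upart T n) (step_xi M n)) (fun u w => Num.min (F u w) M)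
    @[n --> \oo] --> 0%E.
Proof.
move=> M0; apply: (@L2_dominated _ _ _ P T _ _ (fun _ _ => M)).
- by move=> n; apply: elem_proc_jmeas => i; exact: step_xi_measurable.
- by apply: measurable_minr => //; exact: joint_measurable.
- exact: measurable_cst.
- move=> u w uT.
  have cm : {for u, continuous (fun t => Num.min (F t w) M)}.
    by apply: (@continuous_min R R (F ^~ w) (fun=> M) u); [exact: cF|exact: cvg_cst].
  apply/cvgrPdist_lt => eps eps0.
  have /cvgrPdist_lt/(_ _ eps0)/nbhs_ballP[dlt /= dlt0 H] := cm.
  near=> n.
  have [i [i_n /andP[iu ui] ->]] := @elem_proc_upart _ _ Omega T T0 n (step_xi M n) u w uT.
  apply: H; rewrite /ball/= ger0_norm ?subr_ge0 ?(ltW iu)//.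
  apply: (@le_lt_trans _ _ (T / n.+1%:R)); last by near: n; exact: upart_mesh.
  by rewrite -(node_upartB T i_n) lerB.
- move=> n u w uT.
  have [i [i_n _ ->]] := @elem_proc_upart _ _ Omega T T0 n (step_xi M n) u w uT.
  have b (x : R) : 0 <= x -> 0 <= Num.min x M <= M.
    by move=> x0; rewrite le_min x0 M0/= ge_min lexx orbT.
  have /andP[a1 a2] := b _ (F0 (node 0 (upart T n) i) w).
  have /andP[a3 a4] := b _ (F0 u w).
  rewrite /step_xi ler_norml; apply/andP; split; lra.
- have E : (\int[leb]_(u in `[0%R, T]) (M ^+ 2)%:E = (M ^+ 2 * T)%:E)%E.
    rewrite integral_cst//= [RHS]EFinM; congr (_ * _)%E.
    by rewrite lebesgue_measure_itv/= lte_fin T0 oppr0 adde0.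
  under eq_integral do rewrite E.
  by rewrite integral_cst//= probability_setT mule1 ltry.
Unshelve. all: by end_near. Qed.

Hypothesis F2 : (\int[P]_w \int[leb]_(u in `[0%R, T]) (F u w ^+ 2)%:E < +oo)%E.

Lemma L2_truncation_cvg :
  L2dist P T (fun u w => Num.min (F u w) n%:R) F @[n --> \oo] --> 0%E.
Proof.
have jF : jmeas F by exact: joint_measurable.
apply: (@L2_dominated _ _ _ P T _ _ F) => //.
- by move=> n; apply: measurable_minr.
- move=> u w _; apply: cvg_near_cst; near=> n; apply/min_idPl.
  by near: n; exact: nbhs_infty_ger.
- move=> n u w _; have [h|h] := leP (F u w) n%:R; first by rewrite subrr normr0.
  by rewrite ltr0_norm ?subr_lt0// opprB gerBl.
Unshelve. all: by end_near. Qed.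

Lemma L2_step_approx (e : R) : 0 < e -> exists (n M : nat),
  (L2dist P T (elem_proc (upart T n) (step_xi M%:R n)) F < e%:E)%E.
Proof.
(* Truncation and discretisation each cost less than e / 4, and [L2dist_triangle] doubles both. *)
move=> e0; have e40 : 0 < e / 4 by rewrite divr_gt0.
have L0 phi psi : (0 <= L2dist P T phi psi)%E.
  by apply: integral_ge0 => w _; apply: integral_ge0 => u _; rewrite lee_fin sqr_ge0.
have small (u : nat -> \bar R) : u n @[n --> \oo] --> 0%E -> exists n, (u n < (e / 4)%:E)%E.
  move=> u0; have : \forall n \near \oo, (u n < (e / 4)%:E)%E.
    have : nbhs (0%E : \bar R) [set x : \bar R | (x < (e / 4)%:E)%E].
      by apply: open_nbhs_nbhs; split; [exact: open_ereal_lt_ereal|rewrite /= lte_fin].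
    by move=> /u0.
  by move=> [n _ /(_ n (leqnn n))]; exists n.
have [M HM] := small _ L2_truncation_cvg.
have [n Hn] := small _ (@L2_step_cvg M%:R (ler0n _ _)).
exists n, M.
have jF : jmeas F by exact: joint_measurable.
apply: (le_lt_trans (@L2dist_triangle _ _ _ P T _ (fun u w => Num.min (F u w) M%:R) _ _ _ jF)).
- by apply: elem_proc_jmeas => i; exact: step_xi_measurable.
- by apply: measurable_minr.
apply: (@lt_le_trans _ _ (2%:E * (e / 4)%:E + 2%:E * (e / 4)%:E)%E).
  by apply: lteD; rewrite lte_pmul2l.
by rewrite -!EFinM -EFinD lee_fin; lra.
Qed.

End step_approximation.

(** The reverse triangle inequality in L^2(0, T). It reduces to Cauchy-Schwarz, p <= a b, obtained
    by integrating ((b + c) f - (a + c) g)^2 >= 0; the shift [c] avoids dividing by a norm that may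
    vanish. *)
Lemma sqrt_integral_dist {R : realType} (T : R) (f g : R -> R) :
  let leb := @lebesgue_measure R in
  measurable_fun [set: R] f -> measurable_fun [set: R] g ->
  leb.-integrable `[0, T] (EFin \o (fun u => f u ^+ 2)) ->
  leb.-integrable `[0, T] (EFin \o (fun u => g u ^+ 2)) ->
  ((Num.sqrt (\int[leb]_(u in `[0, T]) (f u ^+ 2)) -
     Num.sqrt (\int[leb]_(u in `[0, T]) (g u ^+ 2))) ^+ 2
  <= \int[leb]_(u in `[0, T]) ((f u - g u) ^+ 2))%R.
Proof.
move=> leb mf mg if2 ig2.
have mT : measurable (`[0, T]%classic : set (measurableTypeR R)) by [].
have ifg : leb.-integrable `[0, T] (EFin \o (fun u => f u * g u)).
  apply: (@le_integrable _ _ _ leb _ mT _ (fun u => (f u ^+ 2)%:E + (g u ^+ 2)%:E)%E).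
  - by apply: measurable_funTS; apply/measurable_EFinP; exact: measurable_funM.
  - move=> u _; rewrite /= lee_fin (@ger0_norm _ (f u ^+ 2 + g u ^+ 2)) ?addr_ge0 ?sqr_ge0//.
    rewrite ler_norml; apply/andP; split.
      by have := sqr_ge0 (f u + g u); have := sqr_ge0 (f u); have := sqr_ge0 (g u); nra.
    by have := sqr_ge0 (f u - g u); have := sqr_ge0 (f u); have := sqr_ge0 (g u); nra.
  - exact: integrableD.
set A := (\int[leb]_(u in `[0, T]) (f u ^+ 2))%R.
set B := (\int[leb]_(u in `[0, T]) (g u ^+ 2))%R.
set p := (\int[leb]_(u in `[0, T]) (f u * g u))%R.
have A0 : 0 <= A by apply: Rintegral_ge0 => u _; exact: sqr_ge0.
have B0 : 0 <= B by apply: Rintegral_ge0 => u _; exact: sqr_ge0.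
have lin (a b c : R) : (\int[leb]_(u in `[0, T]) (a * f u ^+ 2 + b * g u ^+ 2 + c * (f u * g u)) = a * A + b * B + c * p)%R.
  have iZ (h : R -> R) (k : R) : leb.-integrable `[0, T] (EFin \o h) -> leb.-integrable `[0, T] (EFin \o (fun u => k * h u)).
    by move=> ih; have := integrableZl mT k ih; apply: eq_integrable => // u _ /=; rewrite EFinM.
  rewrite RintegralD//; last 2 first.
  - have := integrableD mT (iZ _ a if2) (iZ _ b ig2).
    by apply: eq_integrable => // u _ /=.
  - exact: iZ.
  by rewrite RintegralD ?RintegralZl//; exact: iZ.
have -> : (\int[leb]_(u in `[0, T]) ((f u - g u) ^+ 2) = A + B - 2 * p)%R.
  have := lin 1 1 (- 2); rewrite !mul1r mulNr => <-.
  by apply: eq_Rintegral => u _; ring.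
set a := Num.sqrt A; set b := Num.sqrt B.
have a0 : 0 <= a by exact: sqrtr_ge0.
have b0 : 0 <= b by exact: sqrtr_ge0.
have aA : a ^+ 2 = A by rewrite sqr_sqrtr.
have bB : b ^+ 2 = B by rewrite sqr_sqrtr.
suff : p <= a * b by rewrite -aA -bB => h; lra.
apply/ler_addgt0Pr => e e0.
(* Makes the error c (a + b) caused by the shift at most [e]. *)
pose c := e / (a + b + 1).
have ab0 : 0 < a + b + 1 by rewrite ltr_wpDl// addr_ge0.
have c0 : 0 < c by rewrite divr_gt0.
have ca : 0 < a + c by rewrite ltr_wpDl.
have cb : 0 < b + c by rewrite ltr_wpDl.
have : 0 <= \int[leb]_(u in `[0, T]) ((b + c) / (a + c) * f u ^+ 2 + (a + c) / (b + c) * g u ^+ 2 + (- 2) * (f u * g u)).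
  apply: Rintegral_ge0 => u _.
  have -> : (b + c) / (a + c) * f u ^+ 2 + (a + c) / (b + c) * g u ^+ 2 + (- 2) * (f u * g u)
     = ((b + c) * f u - (a + c) * g u) ^+ 2 / ((a + c) * (b + c)).
    by field; rewrite !gt_eqF.
  by rewrite divr_ge0 ?sqr_ge0// mulr_ge0// ltW.
rewrite lin -aA -bB => H.
have h1 : (b + c) / (a + c) * a ^+ 2 <= (b + c) * a.
  rewrite -mulrA ler_wpM2l ?(ltW cb)// mulrC ler_pdivrMr// expr2 ler_wpM2l//.
  by rewrite lerDl ltW.
have h2 : (a + c) / (b + c) * b ^+ 2 <= (a + c) * b.
  rewrite -mulrA ler_wpM2l ?(ltW ca)// mulrC ler_pdivrMr// expr2 ler_wpM2l//.
  by rewrite lerDl ltW.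
have h3 : c * (a + b) <= e.
  by rewrite /c mulrAC ler_pdivrMr// ler_wpM2l ?(ltW e0)// lerDl.
nra.
Qed.

(** * Exponential moments of the integrated variance *)

Section gaussian_law.
Context {R : realType}.
Notation leb := (@lebesgue_measure R).
Notation stdN := (@normal_prob R 0 1).
Local Open Scope ereal_scope.

(** Folding onto a half-line cancels the cross term 2 m s z; the second moment of z then comes from
    [ge0_gauss_ibp_half] with h = 1. *)
Lemma gauss_second_moment (m s : R) :
  \int[stdN]_z ((m + s * z) ^+ 2)%:E = (m ^+ 2 + s ^+ 2)%:E.
Proof.
have mpdf := measurable_normal_pdf (0 : R) 1.
have mlin (h : R -> R) : measurable_fun [set: R] h ->
    measurable_fun [set: R] (fun z : R => (h z * normal_pdf 0 1 z)%:E).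
  by move=> mh; apply/measurable_EFinP; exact: measurable_funM.
have pdf0 (z : R) : (0 <= normal_pdf 0 1 z :> R)%R by exact: normal_pdf_ge0.
have pdfN (z : R) : normal_pdf 0 1 (- z) = normal_pdf 0 1 z :> R by rewrite !normal_pdf_gauss sqrrN.
have mq (a b : R) : measurable_fun [set: R] (fun z : R => (a + b * z ^+ 2)%R).
  by apply: measurable_funD => //; apply: measurable_funM => //; exact: measurable_funX.
have nn (z : R) : 0 <= ((m ^+ 2 + s ^+ 2 * z ^+ 2) * normal_pdf 0 1 z)%:E.
  by rewrite lee_fin; apply: mulr_ge0 => //; apply: addr_ge0; [exact: sqr_ge0|apply: mulr_ge0; exact: sqr_ge0].
have mf : measurable_fun [set: R] (fun z : R => ((m + s * z) ^+ 2)%R).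
  by apply: measurable_funX; apply: measurable_funD => //; exact: measurable_funM.
rewrite ge0_integral_normal_pdf; last 2 first.
- exact/measurable_EFinP.
- by move=> z; rewrite lee_fin sqr_ge0.
transitivity (\int[leb]_z ((m ^+ 2 + s ^+ 2 * z ^+ 2) * normal_pdf 0 1 z)%:E).
  under eq_integral do rewrite -EFinM.
  rewrite (ge0_integral_fold (mlin _ mf)); last by move=> z; rewrite lee_fin mulr_ge0 ?sqr_ge0.
  rewrite [RHS](ge0_integral_fold (mlin _ (mq _ _))); last first.
    by move=> z; apply: nn.
  have mT (h : R -> R) : measurable_fun [set: R] h ->
     measurable_fun (`[0%R, +oo[%classic : set R) (fun z : R => (h z * normal_pdf 0 1 z)%:E).
    by move=> mh; apply: measurable_funTS; exact: mlin.
  rewrite -!ge0_integralD//.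
  - by apply: eq_integral => z _; rewrite -!EFinD pdfN sqrrN; congr EFin; ring.
  - exact: mT.
  - apply: (eq_measurable_fun (fun z : R => ((m ^+ 2 + s ^+ 2 * z ^+ 2) * normal_pdf 0 1 z)%:E)); last exact: mT.
    by move=> z _; rewrite (pdfN (z : R)) (sqrrN (z : R)).
  - by move=> z _; rewrite lee_fin mulr_ge0 ?sqr_ge0.
  - exact: mT.
  - by move=> z _; rewrite lee_fin mulr_ge0 ?sqr_ge0.
  - apply: (eq_measurable_fun (fun z : R => ((m + s * - z) ^+ 2 * normal_pdf 0 1 z)%:E)).
      by move=> z _; rewrite (pdfN (z : R)).
    apply: mT; apply: measurable_funX; apply: measurable_funD => //; apply: measurable_funM => //; exact: oppr_measurable.
transitivity (\int[leb]_z ((m ^+ 2)%:E * (normal_pdf 0 1 z)%:E + (s ^+ 2)%:E * (z ^+ 2 * normal_pdf 0 1 z)%:E)).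
  by apply: eq_integral => z _; rewrite -!EFinM -EFinD; congr EFin; ring.
have mz2 := mlin _ (@measurable_funX _ _ _ setT (fun z : R => z) 2 (@measurable_id _ _ _)).
rewrite ge0_integralD//; last 4 first.
- by move=> z _; rewrite -EFinM lee_fin mulr_ge0 ?sqr_ge0.
- by apply: emeasurable_funM => //; exact/measurable_EFinP.
- move=> z _; apply: mule_ge0; rewrite lee_fin; first exact: sqr_ge0.
  by apply: mulr_ge0 => //; exact: sqr_ge0.
- by apply: emeasurable_funM => //; exact: mz2.
rewrite !ge0_integralZl//=; try by rewrite lee_fin sqr_ge0.
all: try by [exact: mz2 | apply/measurable_EFinP | move=> z _; rewrite lee_fin; exact: pdf0 | move=> z _; rewrite lee_fin mulr_ge0 ?sqr_ge0].
rewrite integral_normal_pdf mule1 EFinD; congr (_ + _).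
rewrite -[RHS]mule1; congr (_ * _).
have c00 := @c0_gt0 R.
transitivity (\int[leb]_z (((2 * pi) `^ (- 2^-1))%:E * (z ^+ 2 * expR (- (z ^+ 2 / 2)))%:E)).
  by apply: eq_integral => z _; rewrite normal_pdf_gauss -EFinM mulrCA.
have mg2 : measurable_fun [set: R] (fun z : R => (z ^+ 2 * expR (- (z ^+ 2 / 2)))%:E).
  by apply/measurable_EFinP; apply: measurable_funM; [exact: measurable_funX|exact: measurable_gss].
rewrite ge0_integralZl//; try by rewrite lee_fin ltW.
all: try by [exact: mg2 | move=> z _; rewrite lee_fin mulr_ge0 ?sqr_ge0 ?expR_ge0].
have mgE : measurable_fun [set: R] (fun z : R => (expR (- (z ^+ 2 / 2)))%:E).
  by apply/measurable_EFinP; exact: measurable_gss.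
have half : \int[leb]_(z in `[0%R, +oo[) (z ^+ 2 * expR (- (z ^+ 2 / 2)))%:E
    = \int[leb]_(z in `[0%R, +oo[) (expR (- (z ^+ 2 / 2)))%:E.
  have := @ge0_gauss_ibp_half R (fun=> 1%R) (measurable_cst _) (fun=> ler01).
  under [in X in _ = X -> _]eq_integral do rewrite mul1r.
  move=> <-; apply: eq_integral => z; rewrite inE/= in_itv/= andbT => z0.
  rewrite integral_cst//= mul1e lebesgue_measure_itv/= lte_fin.
  case: ltP => z0'; first by rewrite oppr0 adde0 -EFinM mulrA expr2.
  have -> : z = 0%R by apply/eqP; rewrite eq_le z0' z0.
  by rewrite expr0n/= !mul0r mul0e.
rewrite (ge0_integral_fold mg2); last by move=> z; rewrite lee_fin mulr_ge0 ?sqr_ge0 ?expR_ge0.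
under [X in _ + X]eq_integral do rewrite sqrrN.
rewrite half.
rewrite -(integral_normal_pdf (0 : R) 1).
transitivity (\int[leb]_z (((2 * pi) `^ (- 2^-1))%:E * (expR (- (z ^+ 2 / 2)))%:E)); last first.
  by apply: eq_integral => z _; rewrite normal_pdf_gauss EFinM.
rewrite ge0_integralZl//; last by rewrite lee_fin ltW.
rewrite [in RHS](ge0_integral_fold mgE); last by move=> z; rewrite lee_fin expR_ge0.
by under [X in _ = _ * (_ + X)]eq_integral do rewrite sqrrN.
Qed.

Context d (Omega : measurableType d) (P : probability Omega R).

Lemma gaussian_law_integral (X : {RV P >-> R}) (m s : R) (f : R -> \bar R) :
  (0 <= s)%R -> (forall A, measurable A -> distribution P X A = gaussian_law m s A) ->
  measurable_fun [set: R] f -> (forall x, 0 <= f x) ->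
  \int[P]_w f (X w) = \int[stdN]_z f (m + s * z)%R.
Proof.
move=> s0 Xlaw mf f0.
have mX : measurable_fun [set: Omega] (X : Omega -> R) by exact: measurable_funPT.
pose pn := (pushforward P (X : Omega -> measurableTypeR R)) : {measure set (measurableTypeR R) -> \bar R}.
pose n := pn mX.
transitivity (\int[n]_y f y).
  have E := @ge0_integral_pushforward _ _ Omega (measurableTypeR R) R X mX P setT f measurableT mf (fun x _ => f0 x).
  by rewrite preimage_setT in E; rewrite -[LHS]E.
move: s0; rewrite le_eqVlt => /predU1P[s0|s0].
  rewrite (eq_measure_integral (dirac (m : measurableTypeR R))); last first.
    by move=> A mA _; have := Xlaw A mA; rewrite /gaussian_law -s0 eqxx.
  rewrite integral_dirac// diracT mul1e -s0.
  under eq_integral do rewrite mul0r addr0.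
  by rewrite integral_cst//= probability_setT mule1.
transitivity (\int[normal_prob m s]_y f y); last exact: ge0_integral_normal_prob.
rewrite (eq_measure_integral (normal_prob m s))// => A mA _.
by have := Xlaw A mA; rewrite /gaussian_law gt_eqF.
Qed.

(* The variance of [B t] is at most [T `^ (2 * H)], so the assumption on [l] bounds
   the exponent by [1 + z ^+ 2 / 4] when [B t = m + s z] with [z] standard normal. *)
Lemma fbm_expR_moment (T H : R) (B : R -> {RV P >-> R}) (t l : R) :
  (0 < H)%R -> fbm T H B -> (0 <= t <= T)%R -> (0 <= l)%R ->
  (8 * l * T `^ (2 * H) <= 1)%R ->
  \int[P]_w (expR (l * B t w ^+ 2))%:E <= (expR 1 * Num.sqrt 2)%:E.
Proof.
move=> H0 [Bgauss Bmean Bcov _] tT l0 lT.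
have [m [s [s0 Blaw]]] : gaussian_rv (B t).
  apply: (Bgauss 1%N (fun=> t) (fun=> 1%R)) => //.
  by move=> w; rewrite big_ord1 mul1r.
(* As [B t] is centred, its covariance with itself is its second moment, and this is m^2 + s^2
   whatever the parameter [m]. *)
have v_le : (m ^+ 2 + s ^+ 2 <= T `^ (2 * H))%R.
  have := Bcov t t tT tT; rewrite covariance.unlock Bmean//= subrr normr0 powR0; last first.
    by rewrite mulf_neq0// gt_eqF.
  set a := (t `^ (2 * H))%R; rewrite (_ : 2^-1 * (a + a - 0) = a)%R; last by lra.
  rewrite /a expectation.unlock.
  rewrite (_ : \int[P]_w _ = \int[P]_w (B t w ^+ 2)%:E); last first.
    by apply: eq_integral => w _; rewrite -[LHS]/((B t w - 0) * (B t w - 0))%:E subr0 expr2.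
  rewrite (gaussian_law_integral (f := fun x : R => (x ^+ 2)%:E) s0 Blaw); last 2 first.
  - by apply/measurable_EFinP; exact: measurable_funX.
  - by move=> x; rewrite lee_fin sqr_ge0.
  rewrite gauss_second_moment => -[->]; case/andP: tT => t0 tT.
  by rewrite ge0_ler_powR ?nnegrE ?mulr_ge0 ?(ltW H0)// (le_trans t0).
rewrite (gaussian_law_integral (f := fun x : R => (expR (l * x ^+ 2))%:E) s0 Blaw); last 2 first.
- by apply/measurable_EFinP; apply: measurableT_comp => //; apply: measurable_funM => //; exact: measurable_funX.
- by move=> x; rewrite lee_fin expR_ge0.
have lm : (l * (m ^+ 2 + s ^+ 2) <= 8^-1)%R.
  have : (8 * (l * (m ^+ 2 + s ^+ 2)) <= 1)%R.
    by apply: le_trans lT; rewrite -mulrA ler_wpM2l// ler_wpM2l.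
  lra.
have lm2 : (0 <= l * m ^+ 2)%R by rewrite mulr_ge0 ?sqr_ge0.
have ls2 : (0 <= l * s ^+ 2)%R by rewrite mulr_ge0 ?sqr_ge0.
rewrite mulrDr in lm.
apply: (@le_trans _ _ (\int[stdN]_z ((expR 1)%:E * (expR (z ^+ 2 / 4))%:E))).
  apply: ge0_le_integral => //.
  - apply/measurable_EFinP; apply: measurableT_comp => //; apply: measurable_funM => //.
    by apply: measurable_funX; apply: measurable_funD => //; exact: measurable_funM.
  - apply: emeasurable_funM => //; apply/measurable_EFinP; apply: measurableT_comp => //.
    by apply: measurable_funM => //; exact: measurable_funX.
  - move=> z _; rewrite -EFinM -expRD lee_fin ler_expR.
    have h1 : (l * (m + s * z) ^+ 2 <= 2 * (l * m ^+ 2) + 2 * (l * s ^+ 2) * z ^+ 2)%R.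
      have := mulr_ge0 l0 (sqr_ge0 (m - s * z)%R); nra.
    have h2 : ((l * s ^+ 2) * z ^+ 2 <= 8^-1 * z ^+ 2)%R.
      by rewrite ler_wpM2r ?sqr_ge0//; lra.
    lra.
rewrite ge0_integralZl//; last first.
  apply/measurable_EFinP; apply: measurableT_comp => //.
  by apply: measurable_funM => //; exact: measurable_funX.
by rewrite gauss_integral_expR_sqr EFinM.
Qed.

End gaussian_law.
(** [M] solves M^(q - 1) = e: up to [M] the power is at most M^q, and beyond [M] it is y^(q - 1) y
    <= e y because q - 1 < 0. *)
Lemma powR_le_affine {R : realType} (q e : R) : 0 < q < 1 -> 0 < e ->
  exists2 A : R, 0 <= A & forall y, 0 <= y -> y `^ q <= A + e * y.
Proof.
move=> /andP[q0 q1] e0; have q10 : q - 1 != 0 by rewrite lt_eqF// subr_lt0.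
pose M := e `^ (q - 1)^-1.
have M0 : 0 < M by rewrite powR_gt0.
exists (M `^ q) => [|y y0]; first exact: powR_ge0.
have [yM|My] := leP y M.
  by rewrite (le_trans (ge0_ler_powR _ _ _ yM)) ?nnegrE ?(ltW q0) ?(ltW M0)// lerDl mulr_ge0// ltW.
have y_gt0 : 0 < y by exact: lt_trans My.
suff : y `^ q <= e * y by move=> /le_trans; apply; rewrite lerDr powR_ge0.
have -> : y `^ q = y `^ (q - 1) * y.
  by rewrite -[X in _ * X]powRr1 ?ltW// -powRD ?subrK// gt_eqF// implybT.
have eM : e = M `^ (q - 1) by rewrite /M -powRrM mulVf// powRr1// ltW.
rewrite ler_pM2r// eM /powR !gt_eqF// ler_expR ler_nM2l ?subr_lt0//.
by rewrite ler_ln ?posrE// ltW.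
Qed.

(** The square of sigma is at most 2 C^2 (1 + (x^2)^q), and [powR_le_affine] is applied at x^2 with
    e / (2 C^2); q < 1 is what makes the quadratic coefficient arbitrarily small. *)
Lemma condition_B_sqr_le {R : realType} (sigma : R -> R) (e : R) :
  condition_B sigma -> 0 < e ->
  exists2 A : R, 0 <= A & forall x, sigma x ^+ 2 <= A + e * x ^+ 2.
Proof.
move=> [C C0 [[smin smin0 s_ge] [q q01 s_le] _ _]] e0.
have C2 : 0 < 2 * C ^+ 2 by rewrite mulr_gt0// exprn_gt0.
have [A A0 HA] := powR_le_affine q01 (divr_gt0 e0 C2).
exists (2 * C ^+ 2 * (1 + A)) => [|x]; first by rewrite mulr_ge0 ?addr_ge0// ltW.
have s0 : 0 <= sigma x by rewrite (le_trans (ltW smin0)).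
have xq0 : 0 <= `|x| `^ q by exact: powR_ge0.
have h1 : sigma x ^+ 2 <= C ^+ 2 * (1 + `|x| `^ q) ^+ 2.
  by rewrite -exprMn ler_sqr ?nnegrE// mulr_ge0 ?addr_ge0// ltW.
have h2 : (1 + `|x| `^ q) ^+ 2 <= 2 * (1 + (`|x| `^ q) ^+ 2).
  have := sqr_ge0 (1 - `|x| `^ q); nra.
have h3 : (`|x| `^ q) ^+ 2 <= A + e / (2 * C ^+ 2) * x ^+ 2.
  have -> : (`|x| `^ q) ^+ 2 = (x ^+ 2) `^ q.
    by rewrite -(real_normK (num_real x)) !expr2 powRM.
  by rewrite HA// sqr_ge0.
have h4 : C ^+ 2 * (1 + `|x| `^ q) ^+ 2 <= C ^+ 2 * (2 * (1 + (A + e / (2 * C ^+ 2) * x ^+ 2))).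
  by rewrite ler_wpM2l ?sqr_ge0// (le_trans h2)// ler_wpM2l// lerD2l.
apply: (le_trans h1); apply: (le_trans h4); rewrite le_eqVlt; apply/orP; left; apply/eqP.
by field; rewrite gt_eqF.
Qed.

(** * Pathwise exponential bounds *)

Section pathwise_bound.
Context {R : realType}.
Notation leb := (@lebesgue_measure R).

Lemma continuous_itv_integrable (f : R -> R) (a b : R) : continuous f ->
  leb.-integrable `[a, b] (EFin \o f).
Proof.
move=> cf; apply: continuous_compact_integrable; first exact: segment_compact.
exact: continuous_subspaceT.
Qed.

Variable T : R.
Hypothesis T0 : 0 < T.

Let mT : measurable (`[0, T]%classic : set (measurableTypeR R)).
Proof. exact: measurable_itv. Qed.

Lemma Rintegral_cst_itv0 (c : R) : (\int[leb]_(u in `[0, T]) c = c * T)%R.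
Proof.
have L : leb (`[0, T]%classic : set (measurableTypeR R)) = T%:E.
  by rewrite lebesgue_measure_itv/= lte_fin T0 oppr0 adde0.
rewrite Rintegral_cst//; congr (_ * _).
by rewrite -[RHS]/(fine T%:E); congr fine; exact: L.
Qed.

Lemma jensen_expR (phi : R -> R) : continuous phi ->
  (expR (\int[leb]_(u in `[0, T]) phi u) <=
   T^-1 * \int[leb]_(u in `[0, T]) expR (T * phi u))%R.
Proof.
move=> cphi; set m := (\int[leb]_(u in `[0, T]) phi u)%R.
have iphi := @continuous_itv_integrable phi 0 T cphi.
have cE : continuous (fun u => expR (T * phi u)).
  move=> u; apply: (continuous_comp (f := fun u => T * phi u) (g := expR)); last exact: continuous_expR.
  by apply: cvgM; [exact: cvg_cst|exact: cphi].
have cl : continuous (fun u => expR m * (1 - m) + expR m * T * phi u).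
  by move=> u; apply: cvgD; [exact: cvg_cst|apply: cvgM; [exact: cvg_cst|exact: cphi]].
(* Tangent line of [expR] at the mean [m] of [T * phi]. *)
have := le_Rintegral mT (continuous_itv_integrable _ _ cl) (continuous_itv_integrable _ _ cE).
rewrite RintegralD//; last 2 first.
- by apply: continuous_itv_integrable => u; exact: cvg_cst.
- by apply: continuous_itv_integrable => u; apply: cvgM; [exact: cvg_cst|exact: cphi].
rewrite Rintegral_cst_itv0 RintegralZl// -/m => H.
rewrite mulrC ler_pdivlMr//; apply: le_trans (H _); first by rewrite le_eqVlt; apply/orP; left; apply/eqP; ring.
move=> u _; have -> : expR (T * phi u) = expR m * expR (T * phi u - m) by rewrite -expRD; congr expR; ring.
rewrite (_ : _ + _ = expR m * (1 + (T * phi u - m))); last by ring.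
by rewrite ler_pM2l ?expR_gt0// expR_ge1Dx.
Qed.

(** Integrates T k^2 >= 2 q |k| - q^2 / T, a rewriting of (q - T |k|)^2 >= 0. *)
Lemma sqr_Rintegral_norm_le (k : R -> R) : continuous k ->
  ((\int[leb]_(u in `[0, T]) `|k u|) ^+ 2 <= T * \int[leb]_(u in `[0, T]) (k u ^+ 2))%R.
Proof.
move=> ck; set q := (\int[leb]_(u in `[0, T]) `|k u|)%R.
have cn : continuous (fun u => `|k u|).
  by move=> u; apply: (continuous_comp (f := k) (g := Num.norm)); [exact: ck|exact: norm_continuous].
have cs : continuous (fun u => T * k u ^+ 2).
  move=> u; apply: cvgM; first exact: cvg_cst.
  by apply: (continuous_comp (f := k) (g := fun x => x ^+ 2)); [exact: ck|exact: exprn_continuous].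
have ck2 : continuous (fun u => k u ^+ 2).
  by move=> u; apply: (continuous_comp (f := k) (g := fun x => x ^+ 2)); [exact: ck|exact: exprn_continuous].
have cl : continuous (fun u => - (q ^+ 2 / T) + 2 * q * `|k u|).
  by move=> u; apply: cvgD; [exact: cvg_cst|apply: cvgM; [exact: cvg_cst|exact: cn]].
have := le_Rintegral mT (continuous_itv_integrable _ _ cl) (continuous_itv_integrable _ _ cs).
rewrite RintegralD//; last 2 first.
- by apply: continuous_itv_integrable => u; exact: cvg_cst.
- by apply: continuous_itv_integrable => u; apply: cvgM; [exact: cvg_cst|exact: cn].
rewrite !RintegralZl//; [|exact: continuous_itv_integrable|exact: continuous_itv_integrable].
rewrite Rintegral_cst_itv0 -/q => H.
apply: le_trans (H _); first by rewrite le_eqVlt; apply/orP; left; apply/eqP; field; rewrite gt_eqF.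
move=> u _; have := sqr_ge0 (q - T * `|k u|); rewrite -(real_normK (num_real (k u))).
move=> h; rewrite -(ler_pM2l T0).
have -> : T * (- (q ^+ 2 / T) + 2 * q * `|k u|) = - q ^+ 2 + T * (2 * q * `|k u|) by field; rewrite gt_eqF.
nra.
Qed.

(** In [l], the 4 comes from squaring a sum of four terms, alpha^2 T^2 from the integral term of [y]
    by Cauchy-Schwarz, [T] from Jensen, and 2 from exp(x + y) <= exp(2 x) + exp(2 y). The value
    [k 0] is kept because B_0 = 0 holds only almost surely, whereas the bound is pathwise. *)
Lemma OU_expR_bound (alpha Y0 A e c : R) (k y F : R -> R) :
  0 < alpha -> 0 <= A -> 0 <= e -> 0 <= c -> continuous k -> continuous F ->
  (forall t, 0 <= t <= T -> F t ^+ 2 <= A + e * y t ^+ 2) ->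
  (forall t, 0 <= t <= T -> y t - Y0 * expR (- alpha * t) =
     k t - expR (- alpha * t) * k 0 -
     expR (- alpha * t) * \int[leb]_(s in `[0, t]) (alpha * expR (alpha * s) * k s)) ->
  forall l, l = 2 * T * c * e * (4 * (1 + alpha ^+ 2 * T ^+ 2)) ->
  (expR (c * \int[leb]_(u in `[0, T]) (F u ^+ 2)) <=
   expR (c * T * (A + 4 * e * Y0 ^+ 2)) * T^-1 *
     \int[leb]_(u in `[0, T]) (expR (l * k u ^+ 2) + expR (l * k 0 ^+ 2)))%R.
Proof.
move=> alpha0 A0 e0 c0 ck cF F_le yE l lE.
set q := (\int[leb]_(u in `[0, T]) `|k u|)%R.
have cpow (f : R -> R) : continuous f -> continuous (fun u => f u ^+ 2).
  by move=> cf u; apply: (continuous_comp (f := f) (g := fun x => x ^+ 2)); [exact: cf|exact: exprn_continuous].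
have cn : continuous (fun u => `|k u|).
  by move=> u; apply: (continuous_comp (f := k) (g := Num.norm)); [exact: ck|exact: norm_continuous].
have ca : continuous (fun s => alpha * expR (alpha * s) * k s).
  move=> s; apply: cvgM; last exact: ck.
  apply: cvgM; first exact: cvg_cst.
  apply: (continuous_comp (f := fun s => alpha * s) (g := expR)); last exact: continuous_expR.
  by apply: cvgM; [exact: cvg_cst|exact: cvg_id].
have y_le t : 0 <= t <= T -> y t ^+ 2 <= 4 * (Y0 ^+ 2 + k t ^+ 2 + k 0 ^+ 2 + alpha ^+ 2 * q ^+ 2).
  move=> tT; have /andP[t0 t1] := tT.
  have mt : measurable (`[0, t]%classic : set (measurableTypeR R)) by exact: measurable_itv.
  set J := (\int[leb]_(s in `[0, t]) (alpha * expR (alpha * s) * k s))%R.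
  set E := expR (- alpha * t).
  have /andP[E0 E1] : 0 <= E <= 1 by rewrite expR_ge0 -expR0 ler_expR; nra.
  have J_le : `|E * J| <= alpha * q.
    rewrite normrM (ger0_norm E0).
    (* On [0, t] the weight exp(alpha s) is at most exp(alpha t), which the prefactor [E] cancels,
       so no exponential of alpha T enters. *)
    have h1 : `|J| <= (alpha * expR (alpha * t)) * q.
      apply: (le_trans (le_normr_Rintegral mt (continuous_itv_integrable _ _ ca))).
      have cal : continuous (fun s => `|alpha * expR (alpha * s) * k s|).
        by move=> s; apply: (continuous_comp (f := fun s => alpha * expR (alpha * s) * k s) (g := Num.norm)); [exact: ca|exact: norm_continuous].
      have car : continuous (fun s => alpha * expR (alpha * t) * `|k s|).
        by move=> s; apply: cvgM; [exact: cvg_cst|exact: cn].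
      apply: (le_trans (le_Rintegral mt (continuous_itv_integrable _ _ cal) (continuous_itv_integrable _ _ car) _)).
        move=> s /=; rewrite in_itv/= => /andP[s0 st].
        rewrite !normrM (gtr0_norm alpha0) (ger0_norm (expR_ge0 _)).
        by rewrite ler_wpM2r// ler_wpM2l ?(ltW alpha0)// ler_expR ler_wpM2l// ltW.
      rewrite RintegralZl//; last exact: continuous_itv_integrable.
      rewrite ler_wpM2l ?mulr_ge0 ?expR_ge0 ?(ltW alpha0)//.
      have cnn := @continuous_itv_integrable _ 0 T cn.
      rewrite /q (@Rintegral_chasles R (fun u => `|k u|) _ 0 t T)//.
        by rewrite lerDl Rintegral_ge0.
      by move=> a b; exact: continuous_itv_integrable.
    have EE : E * expR (alpha * t) = 1 by rewrite /E -expRD mulNr addNr expR0.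
    have -> : alpha * q = E * (alpha * expR (alpha * t) * q).
      by rewrite (_ : E * _ = E * expR (alpha * t) * (alpha * q)); [rewrite EE mul1r|ring].
    by rewrite ler_wpM2l.
  have -> : y t = Y0 * E + k t - E * k 0 - E * J.
    by have := yE t tT; rewrite -/E -/J => h; rewrite -[LHS](subrK (Y0 * E)) h; ring.
  have h1 : (Y0 * E) ^+ 2 <= Y0 ^+ 2.
    by rewrite exprMn ler_piMr ?sqr_ge0// expr_le1.
  have h2 : (E * k 0) ^+ 2 <= k 0 ^+ 2.
    by rewrite exprMn ler_piMl ?sqr_ge0// expr_le1.
  have h3 : (E * J) ^+ 2 <= alpha ^+ 2 * q ^+ 2.
    rewrite -exprMn -(real_normK (num_real (E * J))) ler_sqr ?nnegrE//.
    exact: le_trans J_le.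
  have sq4 (a b p r : R) : (a + b - p - r) ^+ 2 <= 4 * (a ^+ 2 + b ^+ 2 + p ^+ 2 + r ^+ 2).
    have := sqr_ge0 (a - b); have := sqr_ge0 (a + p); have := sqr_ge0 (a + r).
    have := sqr_ge0 (b + p); have := sqr_ge0 (b + r); have := sqr_ge0 (p - r); nra.
  apply: (le_trans (sq4 _ _ _ _)); lra.
set K := (\int[leb]_(u in `[0, T]) (k u ^+ 2))%R.
have K0 : 0 <= K by apply: Rintegral_ge0 => u _; exact: sqr_ge0.
have q_le : q ^+ 2 <= T * K by exact: sqr_Rintegral_norm_le.
pose A2 := 4 * (1 + alpha ^+ 2 * T ^+ 2).
have aT : 0 <= alpha ^+ 2 * T ^+ 2 by rewrite -exprMn sqr_ge0.
have ik2 := @continuous_itv_integrable _ 0 T (cpow _ ck).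
have F_int : (\int[leb]_(u in `[0, T]) (F u ^+ 2) <= T * (A + 4 * e * Y0 ^+ 2) +
    \int[leb]_(u in `[0, T]) (e * A2 * (k u ^+ 2 + k 0 ^+ 2)))%R.
  pose D := A + e * (4 * (Y0 ^+ 2 + k 0 ^+ 2 + alpha ^+ 2 * q ^+ 2)).
  have cD : continuous (fun u => D + 4 * e * k u ^+ 2).
    by move=> u; apply: cvgD; [exact: cvg_cst|apply: cvgM; [exact: cvg_cst|exact: cpow]].
  apply: (le_trans (le_Rintegral mT (continuous_itv_integrable _ _ (cpow _ cF)) (continuous_itv_integrable _ _ cD) _)).
    move=> u /=; rewrite in_itv/= => uT; apply: (le_trans (F_le u uT)).
    have := ler_wpM2l e0 (y_le u uT); rewrite /D; lra.
  have ccst (a : R) : continuous (fun _ : R => a) by move=> u; exact: cvg_cst.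
  have c4 : continuous (fun u => 4 * e * k u ^+ 2).
    by move=> u; apply: cvgM; [exact: cvg_cst|exact: cpow].
  have ck0 : continuous (fun u => k u ^+ 2 + k 0 ^+ 2).
    by move=> u; apply: cvgD; [exact: cpow|exact: cvg_cst].
  rewrite RintegralD//; [|exact: continuous_itv_integrable|exact: continuous_itv_integrable].
  rewrite RintegralZl// RintegralZl//; last exact: continuous_itv_integrable.
  rewrite Rintegral_cst_itv0 [X in _ <= _ + _ * X]RintegralD//; last exact: continuous_itv_integrable.
  rewrite Rintegral_cst_itv0 -/K /D /A2.
  have h1 : e * (alpha ^+ 2 * T) * q ^+ 2 <= e * (alpha ^+ 2 * T) * (T * K).
    by rewrite ler_wpM2l// mulr_ge0// mulr_ge0 ?sqr_ge0// ltW.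
  (* Slack that lets the squares of [k u] and [k 0] carry the same coefficient [e * A2]. *)
  have h2 : 0 <= e * (alpha ^+ 2 * T ^+ 2) * (k 0 ^+ 2 * T).
    by apply: mulr_ge0; [exact: mulr_ge0|apply: mulr_ge0; [exact: sqr_ge0|exact: ltW]].
  nra.
apply: (@le_trans _ _ (expR (c * T * (A + 4 * e * Y0 ^+ 2)) *
    expR (\int[leb]_(u in `[0, T]) (c * e * A2 * (k u ^+ 2 + k 0 ^+ 2)))%R)).
  rewrite -expRD ler_expR; apply: (le_trans (ler_wpM2l c0 F_int)).
  have ck0 : continuous (fun u => k u ^+ 2 + k 0 ^+ 2).
    by move=> u; apply: cvgD; [exact: cpow|exact: cvg_cst].
  rewrite !RintegralZl//; [|exact: continuous_itv_integrable|exact: continuous_itv_integrable].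
  by rewrite le_eqVlt; apply/orP; left; apply/eqP; ring.
rewrite -[leRHS]mulrA ler_pM2l ?expR_gt0//.
have cphi : continuous (fun u => c * e * A2 * (k u ^+ 2 + k 0 ^+ 2)).
  by move=> u; apply: cvgM; [exact: cvg_cst|apply: cvgD; [exact: cpow|exact: cvg_cst]].
apply: (le_trans (jensen_expR cphi)).
rewrite ler_pM2l ?invr_gt0//.
have cexp (f : R -> R) : continuous f -> continuous (fun u => expR (f u)).
  by move=> cf u; apply: (continuous_comp (f := f) (g := expR)); [exact: cf|exact: continuous_expR].
apply: le_Rintegral => //.
- apply: continuous_itv_integrable; apply: cexp => u; apply: cvgM; first exact: cvg_cst.
  exact: cphi.
- apply: continuous_itv_integrable => u; apply: cvgD; last exact: cvg_cst.
  by apply: (cexp (fun u => l * k u ^+ 2)) => v; apply: cvgM; [exact: cvg_cst|exact: cpow].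
- move=> u _.
  have -> : T * (c * e * A2 * (k u ^+ 2 + k 0 ^+ 2)) = (l / 2) * k u ^+ 2 + (l / 2) * k 0 ^+ 2.
    by rewrite lE /A2; field.
  have -> : l * k u ^+ 2 = (l / 2) * k u ^+ 2 + (l / 2) * k u ^+ 2 by field.
  have -> : l * k 0 ^+ 2 = (l / 2) * k 0 ^+ 2 + (l / 2) * k 0 ^+ 2 by field.
  rewrite !expRD; have := sqr_ge0 (expR (l / 2 * k u ^+ 2) - expR (l / 2 * k 0 ^+ 2)).
  have := mulr_ge0 (expR_ge0 (l / 2 * k u ^+ 2)) (expR_ge0 (l / 2 * k 0 ^+ 2)); nra.
Qed.

End pathwise_bound.

(** * The volatility process and its exponential moments *)

Section fractional_volatility.
Context {R : realType} d (Omega : measurableType d) (P : probability Omega R).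
Notation leb := (@lebesgue_measure R).
Variables (T H alpha Y0 : R) (B : R -> {RV P >-> R}) (sigma : R -> R) (Y : R -> Omega -> R).
Hypotheses (T0 : 0 < T) (H0 : 0 < H) (alpha0 : 0 < alpha).
Hypotheses (B_fbm : fbm T H B) (sigmaB : condition_B sigma) (Y_OU : fractional_OU T alpha Y0 B Y).

Let k (w : Omega) (u : R) : R := B (clamp T u) w.

Let ck w : continuous (k w).
Proof.
have [_ _ _ cB] := B_fbm.
exact: (continuous_comp_clamp (ltW T0) (cB w)).
Qed.

Let caek w : continuous (fun s => alpha * expR (alpha * s) * k w s).
Proof.
move=> s; apply: cvgM; last exact: ck.
apply: cvgM; first exact: cvg_cst.
apply: (continuous_comp (f := fun s => alpha * s) (g := expR)); last exact: continuous_expR.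
by apply: cvgM; [exact: cvg_cst|exact: cvg_id].
Qed.

Lemma OU_byparts t w : 0 <= t <= T -> Y t w - Y0 * expR (- alpha * t) =
  k w t - expR (- alpha * t) * k w 0
  - expR (- alpha * t) * \int[leb]_(s in `[0, t]) (alpha * expR (alpha * s) * k w s).
Proof.
move=> tT; have /andP[t0 t1] := tT.
apply: (RS_expR_byparts (@ck w) alpha0 t0 _ (@Y_OU t w tT)) => s /andP[s0 st].
by rewrite /k clamp_id// s0 (le_trans st).
Qed.

(** [Y] is given pointwise in time as a limit of sums; continuity of its paths is read off the
    formula by parts, term by term. *)
Lemma OU_clamp_continuous w : continuous (fun u => Y (clamp T u) w).
Proof.
pose J := fun x : R => (\int[leb]_(s in `[0, x]) (alpha * expR (alpha * s) * k w s))%R.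
have cJ : {within `[0, T], continuous J}.
  apply: (@parameterized_integral_continuous R 0 T _ (ltW T0)).
  exact: continuous_itv_integrable.
have cJc := continuous_comp_clamp (ltW T0) cJ.
have cE : continuous (fun u => expR (- alpha * clamp T u)).
  move=> u; apply: (continuous_comp (f := fun u => - alpha * clamp T u) (g := expR)); last exact: continuous_expR.
  by apply: cvgM; [exact: cvg_cst|exact: continuous_clamp].
have -> : (fun u => Y (clamp T u) w) = (fun u => Y0 * expR (- alpha * clamp T u) + (k w (clamp T u)
    - expR (- alpha * clamp T u) * k w 0 - expR (- alpha * clamp T u) * (J \o clamp T) u)).
  apply/funext => u; have := @OU_byparts (clamp T u) w (clamp_itv (ltW T0) u).
  by rewrite -/(J _) => <-; rewrite addrC subrK.
move=> u; apply: cvgD; first by apply: cvgM; [exact: cvg_cst|exact: cE].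
apply: cvgB; last by apply: cvgM; [exact: cE|exact: cJc].
apply: cvgB; last by apply: cvgM; [exact: cE|exact: cvg_cst].
apply: (continuous_comp (f := clamp T) (g := k w)); [exact: continuous_clamp|exact: ck].
Qed.

Lemma OU_at0 w : Y 0 w = Y0.
Proof.
have := @OU_byparts 0 w; rewrite lexx (ltW T0) => /(_ isT).
rewrite set_itv1 Rintegral_set1 !mulr0 subr0 expR0 mul1r mulr1 subrr.
by move=> /eqP; rewrite subr_eq0 => /eqP.
Qed.

(** The nodes of a partition of [0, t] do not exceed [t], so the Riemann-Stieltjes sums, and with
    them their limit, use [B] up to [t] only. The adaptedness of the elementary approximations
    depends on this. *)
Lemma OU_measurable (t : R) : 0 <= t <= T ->
  measurable_fun (setT : set (g_sigma_algebraType (proc_events (fun u => B u : Omega -> R) `[0, t]))) (Y t).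
Proof.
move=> /andP[]; rewrite le_eqVlt => /predU1P[<- _|t0 tT].
  by rewrite (_ : Y 0 = cst Y0); [exact: measurable_cst|apply/funext => w; exact: OU_at0].
pose h s := expR (- alpha * (t - s)).
pose f (n : nat) (w : g_sigma_algebraType (proc_events (fun u => B u : Omega -> R) `[0, t])) := RS_sum h (fun s => B s w) 0 (upart t n) (node 0 (upart t n)) + Y0 * expR (- alpha * t).
apply: (@measurable_fun_cvg _ _ _ _ f).
  move=> n; apply: measurable_funD => //.
  apply: measurable_sum => i; apply: measurable_funM => //.
  have i_n : (i < n.+1)%N by rewrite -(size_upart t n).
  apply: measurable_funB; apply: measurable_proc; rewrite /= in_itv/=.
    exact: (node_upart_itv (ltW t0) i_n).
  exact: (node_upart_itv (ltW t0) (ltnW i_n)).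
move=> w _; rewrite -[X in _ --> X](subrK (Y0 * expR (- alpha * t))).
apply: cvgD; last exact: cvg_cst.
by apply: RS_sum_upart_cvg => //; apply: Y_OU; rewrite (ltW t0) tT.
Qed.

Definition volatility (u : R) (w : Omega) : R := sigma (Y (clamp T u) w).

Lemma condition_B_gt0 x : 0 < sigma x.
Proof. by have [C _ [[smin smin0 /(_ x) h] _ _ _]] := sigmaB; exact: lt_le_trans smin0 h. Qed.

Lemma volatility_ge0 u w : 0 <= volatility u w.
Proof. by rewrite ltW// condition_B_gt0. Qed.

Lemma volatility_continuous w : continuous (volatility ^~ w).
Proof.
have [C _ [_ _ _ [csigma _ _]]] := sigmaB.
move=> u; apply: (continuous_comp (f := fun u => Y (clamp T u) w) (g := sigma)).
  exact: OU_clamp_continuous.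
exact: csigma.
Qed.

Lemma volatility_le0 t w : t <= 0 -> volatility t w = volatility 0 w.
Proof. by move=> t0; rewrite /volatility /clamp min_l ?(le_trans t0 (ltW T0))// max_l// min_l ?(ltW T0)// maxxx. Qed.

Lemma measurable_condition_B : measurable_fun [set: R] sigma.
Proof. by have [C _ [_ _ _ [csigma _ _]]] := sigmaB; exact: continuous_measurable_fun. Qed.

Lemma volatility_measurable t :
  measurable_fun (setT : set (g_sigma_algebraType (proc_events (fun u => B u : Omega -> R) `[0, T]))) (volatility t).
Proof.
apply: (measurableT_comp measurable_condition_B).
have /andP[c0 cT] := clamp_itv (ltW T0) t.
apply: (@measurable_fun_sub_sigma _ _ (proc_events (fun u => B u : Omega -> R) `[0, clamp T t])); last first.
  by apply: OU_measurable; rewrite c0 cT.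
apply: (subset_trans (@proc_eventsS _ _ _ _ _ _ _)); last exact: sub_sigma_algebra.
by move=> u /=; rewrite !in_itv/= => /andP[-> /le_trans ->].
Qed.

Lemma B_events_measurable : proc_events (fun u => B u : Omega -> R) `[0, T] `<=` measurable.
Proof. by apply: proc_events_measurable => t; exact: measurable_funP. Qed.

(** [Omega] carries here the sigma-algebra of [B], so that sigma_Y^2, and hence m_Y, turn out to be
    functions of [B]. *)
Lemma volatility_joint_sigma :
  measurable_fun [set: R * g_sigma_algebraType (proc_events (fun u => B u : Omega -> R) `[0, T])]
    (fun p => volatility p.1 p.2).
Proof.
apply: joint_measurable => //.
- by move=> t _; exact: volatility_measurable.
- exact: volatility_continuous.
- by move=> t w; exact: volatility_le0.
Qed.

Lemma volatility_joint : jmeas volatility.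
Proof.
apply: joint_measurable => //.
- by move=> t _; apply: (measurable_fun_g_sigma B_events_measurable); exact: volatility_measurable.
- exact: volatility_continuous.
- by move=> t w; exact: volatility_le0.
Qed.

Lemma sigmaY2_volatility w : sigmaY2 sigma Y T w = (\int[leb]_(u in `[0, T]) (volatility u w ^+ 2))%R.
Proof.
apply: eq_Rintegral => u; rewrite inE/= in_itv/= => uT.
by rewrite /volatility clamp_id.
Qed.

Lemma volatility_sqr_continuous w : continuous (fun u => volatility u w ^+ 2).
Proof.
move=> u; apply: (continuous_comp (f := volatility ^~ w) (g := fun x => x ^+ 2)); last exact: exprn_continuous.
exact: volatility_continuous.
Qed.

Lemma sigmaY2_measurable_sigma :
  measurable_fun (setT : set (g_sigma_algebraType (proc_events (fun u => B u : Omega -> R) `[0, T])))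
    (sigmaY2 sigma Y T).
Proof.
rewrite (_ : sigmaY2 sigma Y T = fun w => \int[leb]_(u in `[0, T]) (volatility u w ^+ 2))%R; last first.
  by apply/funext => w; exact: sigmaY2_volatility.
apply: (@measurable_Rintegral_param R _ (g_sigma_algebraType (proc_events (fun u => B u : Omega -> R) `[0, T])) T (fun u w => volatility u w ^+ 2)).
  by apply: measurable_funX; exact: volatility_joint_sigma.
by move=> t w; exact: sqr_ge0.
Qed.

Lemma sigmaY2_measurable : measurable_fun [set: Omega] (sigmaY2 sigma Y T).
Proof. exact: (measurable_fun_g_sigma B_events_measurable sigmaY2_measurable_sigma). Qed.

Lemma sigmaY2_ge : exists2 v : R, 0 < v & forall w, v <= sigmaY2 sigma Y T w.
Proof.
have [C _ [[smin smin0 s_ge] _ _ _]] := sigmaB.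
exists (smin ^+ 2 * T); first by rewrite mulr_gt0// exprn_gt0.
move=> w; rewrite sigmaY2_volatility -(Rintegral_cst_itv0 T0).
have mT : measurable (`[0, T]%classic : set (measurableTypeR R)) by exact: measurable_itv.
apply: le_Rintegral => //.
- by apply: continuous_itv_integrable => u; exact: cvg_cst.
- by apply: continuous_itv_integrable; exact: volatility_sqr_continuous.
- move=> u _; rewrite ler_sqr ?nnegrE ?volatility_ge0 ?(ltW smin0)//.
  exact: s_ge.
Qed.

Local Open Scope ereal_scope.

(** Tonelli puts the expectation inside, where [fbm_expR_moment] bounds both terms uniformly in
    time. *)
Lemma fbm_expR_integral (l : R) : (0 <= l)%R -> (8 * l * T `^ (2 * H) <= 1)%R ->
  \int[P]_w \int[leb]_(u in `[0%R, T]) (expR (l * k w u ^+ 2) + expR (l * k w 0 ^+ 2))%:E < +oo.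
Proof.
move=> l0 lT.
have jk : measurable_fun [set: R * Omega] (fun p : R * Omega => k p.2 p.1).
  apply: (@joint_measurable R _ Omega (fun u w => k w u)).
  - by move=> t _; exact: measurable_funPT.
  - exact: ck.
  - by move=> t w t0; rewrite /k /clamp min_l ?(le_trans t0 (ltW T0))// max_l// min_l ?(ltW T0)// maxxx.
have jE : measurable_fun [set: R * Omega] (fun p : R * Omega => (expR (l * k p.2 p.1 ^+ 2))%:E).
  by apply/measurable_EFinP; apply: measurableT_comp => //; apply: measurable_funM => //; exact: measurable_funX.
have mk (u : R) : measurable_fun [set: Omega] (fun w => (expR (l * k w u ^+ 2))%:E).
  by apply/measurable_EFinP; apply: measurableT_comp => //; apply: measurable_funM => //; apply: measurable_funX; exact: measurable_funPT.
have jE2 : measurable_fun [set: R * Omega]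
    (fun p : R * Omega => (expR (l * k p.2 p.1 ^+ 2) + expR (l * k p.2 0 ^+ 2))%:E).
  apply/measurable_EFinP; apply: measurable_funD; first exact/measurable_EFinP.
  by apply/measurable_EFinP; exact: (measurableT_comp (mk 0%R)).
rewrite (@iterated_integralE _ _ _ P T (fun p => (expR (l * k p.2 p.1 ^+ 2) + expR (l * k p.2 0 ^+ 2))%:E))//.
rewrite fubini_tonelli1; [|exact: jmeas_restrict|]; last first.
  by move=> p; case: ifP => // _; rewrite lee_fin addr_ge0 ?expR_ge0.
rewrite /fubini_F.
pose c : R := (expR 1 * Num.sqrt 2)%R.
have c0 : (0 <= c)%R by rewrite mulr_ge0 ?expR_ge0 ?sqrtr_ge0.
apply: (@le_lt_trans _ _ (\int[leb]_(u in `[0%R, T]) (c + c)%:E)); last first.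
  have mT : measurable (`[0%R, T]%classic : set (measurableTypeR R)) by exact: measurable_itv.
  rewrite integral_cst//; have L : leb (`[0%R, T]%classic : set (measurableTypeR R)) = T%:E.
    by rewrite lebesgue_measure_itv/= lte_fin T0 oppr0 adde0.
  by rewrite [X in _ * X]L -EFinM ltry.
rewrite [leRHS]integral_mkcond; apply: ge0_le_integral => //.
- by move=> u _; apply: integral_ge0 => w _; case: ifP => // _; rewrite lee_fin addr_ge0 ?expR_ge0.
- apply: (measurable_fun_fubini_tonelli_F (fun p : R * Omega => if p.1 \in `]0%R, T] then (expR (l * k p.2 p.1 ^+ 2) + expR (l * k p.2 0 ^+ 2))%:E else 0)).
    exact: jmeas_restrict.
  by move=> p; case: ifP => // _; rewrite lee_fin addr_ge0 ?expR_ge0.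
- by apply/(measurable_restrictT _ _).1 => //; exact: measurable_itv.
move=> u _ /=; rewrite patchE mem_setE; case: (boolP (u \in `]0%R, T])) => uT; last first.
  rewrite /= integral0_eq//; case: ifP => // _; by rewrite lee_fin addr_ge0.
have uT' : u \in `[0%R, T] by move: uT; rewrite !in_itv/= => /andP[/ltW -> ->].
rewrite uT'.
under eq_integral do rewrite EFinD.
rewrite ge0_integralD//.
rewrite EFinD; apply: leeD.
- rewrite /k; apply: (fbm_expR_moment H0 B_fbm) => //; exact: clamp_itv (ltW T0) _.
- rewrite /k; apply: (fbm_expR_moment H0 B_fbm) => //; exact: clamp_itv (ltW T0) _.
Qed.

Lemma expR_sigmaY2_integrable (c : R) : (0 <= c)%R ->
  \int[P]_w (expR (c * sigmaY2 sigma Y T w))%:E < +oo.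
Proof.
move=> c0.
pose A2 := (4 * (1 + alpha ^+ 2 * T ^+ 2))%R.
have A20 : (0 < A2)%R by rewrite mulr_gt0// ltr_pwDl// -exprMn sqr_ge0.
have TH0 : (0 < T `^ (2 * H))%R by rewrite powR_gt0.
(* Makes 8 l T^(2H) equal to c / (c + 1); the 1 added to [c] covers c = 0. *)
pose e := ((16 * T * (c + 1) * A2 * T `^ (2 * H))^-1)%R.
have c1 : (0 < c + 1)%R by rewrite ltr_wpDl.
have den0 : (0 < 16 * T * (c + 1) * A2 * T `^ (2 * H))%R by do 4![apply: mulr_gt0 => //].
have e0 : (0 < e)%R by rewrite invr_gt0.
have [A A0 s_le] := condition_B_sqr_le sigmaB e0.
pose l := (2 * T * c * e * A2)%R.
have l0 : (0 <= l)%R by do 4![apply: mulr_ge0; rewrite ?(ltW T0) ?(ltW e0) ?(ltW A20)//].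
have lT : (8 * l * T `^ (2 * H) <= 1)%R.
  have -> : (8 * l * T `^ (2 * H) = c * (16 * T * A2 * T `^ (2 * H) * e))%R by rewrite /l; ring.
  have -> : (16 * T * A2 * T `^ (2 * H) * e = (c + 1)^-1)%R.
    by rewrite /e; field; rewrite !gt_eqF.
  by rewrite ler_pdivrMr// mul1r lerDl.
have fin := fbm_expR_integral l0 lT.
set M := (expR (c * T * (A + 4 * e * Y0 ^+ 2)) * T^-1)%R.
have M0 : (0 <= M)%R by rewrite mulr_ge0 ?expR_ge0// invr_ge0 ltW.
have jk : measurable_fun [set: R * Omega] (fun p : R * Omega => k p.2 p.1).
  apply: (@joint_measurable R _ Omega (fun u w => k w u)).
  - by move=> t _; exact: measurable_funPT.
  - exact: ck.
  - by move=> t w t0; rewrite /k /clamp min_l ?(le_trans t0 (ltW T0))// max_l// min_l ?(ltW T0)// maxxx.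
have cE w : continuous (fun u => expR (l * k w u ^+ 2) + expR (l * k w 0 ^+ 2))%R.
  move=> u; apply: cvgD; last exact: cvg_cst.
  apply: (continuous_comp (f := fun u => (l * k w u ^+ 2)%R) (g := expR)); last exact: continuous_expR.
  apply: cvgM; first exact: cvg_cst.
  by apply: (continuous_comp (f := k w) (g := fun x => (x ^+ 2)%R)); [exact: ck|exact: exprn_continuous].
have mI : measurable_fun [set: Omega] (fun w =>
    \int[leb]_(u in `[0%R, T]) (expR (l * k w u ^+ 2) + expR (l * k w 0 ^+ 2)))%R.
  apply: (@measurable_Rintegral_param R _ Omega T (fun u w => expR (l * k w u ^+ 2) + expR (l * k w 0 ^+ 2))%R).
    apply: measurable_funD; apply: measurableT_comp => //; apply: measurable_funM => //; apply: measurable_funX => //.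
    by apply: (@measurableT_comp _ _ _ _ _ _ (fun w => k w 0) _ snd) => //; exact: measurable_funPT.
  by move=> t w; rewrite addr_ge0 ?expR_ge0.
apply: (@le_lt_trans _ _ (M%:E * \int[P]_w \int[leb]_(u in `[0%R, T]) (expR (l * k w u ^+ 2) + expR (l * k w 0 ^+ 2))%:E)); last first.
  by rewrite lte_mul_pinfty// lee_fin.
have EI w : (\int[leb]_(u in `[0%R, T]) (expR (l * k w u ^+ 2) + expR (l * k w 0 ^+ 2)))%R%:E =
    \int[leb]_(u in `[0%R, T]) (expR (l * k w u ^+ 2) + expR (l * k w 0 ^+ 2))%:E.
  by rewrite fineK// integrable_fin_num//; exact: (continuous_itv_integrable _ _ (cE w)).
under [in leRHS]eq_integral do rewrite -EI.
rewrite -ge0_integralZl//; last 2 first.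
- exact/measurable_EFinP.
- by move=> w _; rewrite lee_fin Rintegral_ge0// => u _; rewrite addr_ge0 ?expR_ge0.
apply: ge0_le_integral => //.
- by apply/measurable_EFinP; apply: measurableT_comp => //; apply: measurable_funM => //; exact: sigmaY2_measurable.
- by apply/measurable_EFinP; apply: measurable_funM.
- move=> w _; rewrite -EFinM lee_fin sigmaY2_volatility.
  apply: (@OU_expR_bound R T T0 alpha Y0 A e c (k w) (Y ^~ w) (volatility ^~ w)) => //.
  + exact: ltW.
  + exact: volatility_continuous.
  + by move=> t tT; rewrite /volatility clamp_id.
  + by move=> t tT; exact: OU_byparts.
Qed.

End fractional_volatility.

(** * The law of the log-price *)

(** Rests on |x - y| <= e + (x - y)^2 / e, which passes from L^1 to L^2 without Cauchy-Schwarz; [e]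
    is left to be tuned. *)
Lemma lipschitz_integral_le {R : realType} d (T : measurableType d)
    (mu : {measure set T -> \bar R}) (X X' : T -> R) (h : R -> R) (L e : R) :
  mu setT = 1%E -> measurable_fun [set: T] X -> measurable_fun [set: T] X' ->
  measurable_fun [set: R] h -> (forall x, 0 <= h x) -> 0 <= L -> 0 < e ->
  (forall x y, `|h x - h y| <= L * `|x - y|) ->
  (\int[mu]_w (h (X w))%:E <= \int[mu]_w (h (X' w))%:E + (L * e)%:E +
     (L / e)%:E * \int[mu]_w ((X w - X' w) ^+ 2)%:E)%E.
Proof.
move=> mu1 mX mX' mh h0 L0 e0 hL.
have mhX : measurable_fun [set: T] (fun w => (h (X w))%:E).
  by apply/measurable_EFinP; exact: measurableT_comp.
have mhX' : measurable_fun [set: T] (fun w => (h (X' w))%:E).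
  by apply/measurable_EFinP; exact: measurableT_comp.
have mD : measurable_fun [set: T] (fun w => ((X w - X' w) ^+ 2)%:E).
  by apply/measurable_EFinP; apply: measurable_funX; exact: measurable_funB.
have Le : 0 <= L / e by rewrite divr_ge0// ltW.
have LE : 0 <= L * e by rewrite mulr_ge0// ltW.
have -> : ((L * e)%:E = \int[mu]_w (L * e)%:E)%E by rewrite integral_cst// mu1 mule1.
rewrite -ge0_integralD//; [|by move=> w _; rewrite lee_fin].
rewrite -ge0_integralZl//; [|by move=> w _; rewrite lee_fin sqr_ge0].
have mLD : measurable_fun [set: T] (fun w => (L / e)%:E * ((X w - X' w) ^+ 2)%:E)%E.
  exact: emeasurable_funM.
have mS : measurable_fun [set: T] (fun w => (h (X' w))%:E + (L * e)%:E)%E.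
  exact: emeasurable_funD.
rewrite -ge0_integralD//; last 2 first.
- by move=> w _; rewrite -EFinD lee_fin addr_ge0.
- by move=> w _; rewrite -EFinM lee_fin mulr_ge0 ?sqr_ge0.
apply: ge0_le_integral => //.
- by move=> w _; rewrite lee_fin.
- exact: emeasurable_funD.
move=> w _; rewrite -EFinM -!EFinD lee_fin.
have h1 : h (X w) <= h (X' w) + L * `|X w - X' w|.
  by rewrite -lerBlDl (le_trans (ler_norm _))// hL.
have h2 : `|X w - X' w| <= e + e^-1 * (X w - X' w) ^+ 2.
  rewrite -(real_normK (num_real (X w - X' w))); set x := `|_|.
  have x0 : 0 <= x by exact: normr_ge0.
  have [xe|ex] := leP x e; first by rewrite (le_trans xe)// lerDl mulr_ge0 ?sqr_ge0// invr_ge0 ltW.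
  rewrite (@le_trans _ _ (e^-1 * x ^+ 2))// ?lerDr ?(ltW e0)//.
  by rewrite expr2 mulrA ler_peMl// mulrC ler_pdivlMr// mul1r ltW.
by rewrite -addrA (le_trans h1)// lerD2l -mulrA -mulrDr ler_wpM2l.
Qed.

Lemma fine_le_id {R : realType} (x : \bar R) : (0 <= x)%E -> ((fine x)%:E <= x)%E.
Proof. by case: x => [r||]//= _; rewrite leey. Qed.

Section log_price_law.
Context {R : realType} d (Omega : measurableType d) (P : probability Omega R).
Notation leb := (@lebesgue_measure R).
Notation stdN := (@normal_prob R 0 1).
Variables (T H alpha Y0 : R) (W B : R -> {RV P >-> R}) (sigma : R -> R) (Y : R -> Omega -> R)
  (I : {RV P >-> R}).
Hypotheses (T0 : 0 < T) (H0 : 0 < H) (alpha0 : 0 < alpha).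
Hypotheses (W_wiener : wiener T W) (B_fbm : fbm T H B).
Hypothesis WB_indep : indep_processes P (fun t => W t : Omega -> R)
  (fun t => B t : Omega -> R) `[0, T].
Hypotheses (sigmaB : condition_B sigma) (Y_OU : fractional_OU T alpha Y0 B Y).
Hypothesis I_ito : forall s xi,
  ito_approx P (joint_filtration W B) (fun s w => sigma (Y s w)) T s xi ->
  (fun n => \int[P]_w ((elem_int (fun t => W t : Omega -> R) (s n) (xi n) w - I w) ^+ 2)%:E)%E
      @ \oo --> 0%E.

Let Bsig := proc_events (fun u => B u : Omega -> R) `[0, T].
Let vol := volatility T sigma Y.

Let mG (f : Omega -> R) : measurable_fun (setT : set (g_sigma_algebraType Bsig)) f ->
  measurable_fun [set: Omega] f.
Proof.
by move=> mf; apply: (@measurable_fun_g_sigma R _ Omega Bsig) => //; exact: B_events_measurable.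
Qed.

Let mvol t : measurable_fun [set: Omega] (vol t).
Proof.
apply: mG.
exact: (volatility_measurable T0 alpha0 B_fbm sigmaB Y_OU).
Qed.

Let cvol w : continuous (vol ^~ w).
Proof. exact: (volatility_continuous T0 alpha0 B_fbm sigmaB Y_OU). Qed.

Let vol_le0 t w : t <= 0 -> vol t w = vol 0 w.
Proof. exact: volatility_le0. Qed.

Let vol_ge0 t w : 0 <= vol t w.
Proof. exact: volatility_ge0. Qed.

Local Open Scope ereal_scope.

Let sigmaY2_fin : \int[P]_w (sigmaY2 sigma Y T w)%:E < +oo.
Proof.
have mV := sigmaY2_measurable T0 alpha0 B_fbm sigmaB Y_OU.
apply: le_lt_trans (expR_sigmaY2_integrable T0 H0 alpha0 B_fbm sigmaB Y_OU ler01).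
have V0 w : (0 <= sigmaY2 sigma Y T w)%R.
  have [v v0 /(_ w)] := sigmaY2_ge T0 alpha0 B_fbm sigmaB Y_OU.
  exact/le_trans/ltW.
apply: ge0_le_integral => //.
- by move=> w _; rewrite lee_fin.
- exact/measurable_EFinP.
- by apply/measurable_EFinP; apply: measurableT_comp => //; exact: measurable_funM.
- move=> w _; rewrite lee_fin mul1r (le_trans _ (expR_ge1Dx _))//.
  by rewrite lerDr.
Qed.

Let vol_int w : (sigmaY2 sigma Y T w)%:E = \int[leb]_(u in `[0%R, T]) (vol u w ^+ 2)%:E.
Proof.
rewrite sigmaY2_volatility /Rintegral fineK//; apply: integrable_fin_num => //.
apply: continuous_itv_integrable; exact: (volatility_sqr_continuous T0 alpha0 B_fbm sigmaB Y_OU).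
Qed.

Lemma step_approximations : exists nM : nat -> nat * nat, forall j,
  L2dist P T (elem_proc (upart T (nM j).1) (step_xi T vol (nM j).2%:R (nM j).1)) vol
    < (j.+1%:R^-1)%:E.
Proof.
have F2 : \int[P]_w \int[leb]_(u in `[0%R, T]) (vol u w ^+ 2)%:E < +oo.
  by under eq_integral do rewrite -vol_int; exact: sigmaY2_fin.
have ex j : exists nM : nat * nat,
    L2dist P T (elem_proc (upart T nM.1) (step_xi T vol nM.2%:R nM.1)) vol < (j.+1%:R^-1)%:E.
  have j0 : (0 < j.+1%:R^-1 :> R)%R by rewrite invr_gt0.
  have [n [M HnM]] := L2_step_approx T0 (fun t _ => mvol t) cvol vol_le0 vol_ge0 F2 j0.
  by exists (n, M).
by have [nM HnM] := boolp.choice ex; exists nM.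
Qed.

(** Sampling takes place at left endpoints, where [OU_measurable] applies, so these steps built from
    [B] form an admissible sequence to which [I_ito] can be applied. *)
Lemma step_approximations_ito (nM : nat -> nat * nat) :
  (forall j, L2dist P T (elem_proc (upart T (nM j).1) (step_xi T vol (nM j).2%:R (nM j).1)) vol
    < (j.+1%:R^-1)%:E) ->
  ito_approx P (joint_filtration W B) (fun s w => sigma (Y s w)) T
    (fun j => upart T (nM j).1) (fun j => step_xi T vol (nM j).2%:R (nM j).1).
Proof.
move=> HnM; split => [j|].
  set n := (nM j).1; set M := (nM j).2.
  split; first exact: itv_partition_upart.
  move=> i; rewrite size_upart ltnS => i_n; split.
    exists M%:R => w; rewrite ger0_norm ?le_min ?vol_ge0 ?ler0n//.
    by rewrite /step_xi ge_min lexx orbT.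
  move=> A mA.
  have tT := node_upart_itv (ltW T0) (leqW i_n : (i <= n.+1)%N).
  set t := node 0 (upart T n) i in tT *.
  pose G := proc_events (fun u => B u : Omega -> R) `[0%R, t].
  have mxi : measurable_fun (setT : set (g_sigma_algebraType
     (proc_events (fun u => W u : Omega -> R) `[0%R, t] `|` G))) (step_xi T vol M%:R n i).
    apply: measurable_minr => //.
    apply: (measurableT_comp (measurable_condition_B sigmaB)).
    apply: (@measurable_fun_sub_sigma _ _ G).
      by apply: subset_trans (@sub_sigma_algebra _ _ _); exact: subsetUr.
    by rewrite clamp_id//; exact: (OU_measurable T0 alpha0 B_fbm Y_OU tT).
  by have := mxi measurableT A mA; rewrite setTI.
have E j : \int[P]_w \int[leb]_(u in `[0%R, T])
    ((elem_proc (upart T (nM j).1) (step_xi T vol (nM j).2%:R (nM j).1) u w - sigma (Y u w)) ^+ 2)%:E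
  = L2dist P T (elem_proc (upart T (nM j).1) (step_xi T vol (nM j).2%:R (nM j).1)) vol.
  apply: eq_integral => w _; apply: eq_integral => u; rewrite inE/= in_itv/= => uT.
  by rewrite /vol /volatility clamp_id.
under eq_fun do rewrite E.
apply: (@squeeze_cvge _ _ _ _ (cst 0) _ (fun j => (j.+1%:R^-1)%:E)).
- apply: nearW => j; rewrite (ltW (HnM j)) andbT.
  by apply: integral_ge0 => w _; apply: integral_ge0 => u _; rewrite lee_fin sqr_ge0.
- exact: cvg_cst.
- apply: cvg_EFin; first exact: nearW.
  exact: cvg_harmonic.
Qed.

(** A single pair serves both distances, to the Ito integral and to the volatility, because the two
    sides of the law identity are compared through the same step process. *)
Lemma approx_pair (e : R) : (0 < e)%R -> exists n M : nat,
  \int[P]_w ((elem_int (fun t => W t : Omega -> R) (upart T n) (step_xi T vol M%:R n) w - I w) ^+ 2)%:E <= e%:E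
  /\ L2dist P T (elem_proc (upart T n) (step_xi T vol M%:R n)) vol <= e%:E.
Proof.
move=> e0; have [nM HnM] := step_approximations.
have small : \forall j \near \oo, \int[P]_w ((elem_int (fun t => W t : Omega -> R) (upart T (nM j).1)
    (step_xi T vol (nM j).2%:R (nM j).1) w - I w) ^+ 2)%:E < e%:E.
  have : nbhs (0 : \bar R) [set x : \bar R | x < e%:E].
    by apply: open_nbhs_nbhs; split; [exact: open_ereal_lt_ereal|rewrite /= lte_fin].
  by move=> /(I_ito (step_approximations_ito HnM)).
have large : \forall j \near \oo, (j.+1%:R^-1 <= e :> R)%R.
  have : \forall j \near \oo, (j.+1%:R^-1 < e :> R)%R.
    exact: (@cvgr_lt _ _ _ _ _ _ (@cvg_harmonic R) e e0).
  by apply: filterS => j /ltW.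
have [j [/ltW h1 h2]] := filter_ex (filterI small large).
exists (nM j).1, (nM j).2; split => //.
by rewrite (le_trans (ltW (HnM j)))// lee_fin.
Qed.

Variable U : Omega -> R.
Hypothesis mU : measurable_fun (setT : set (g_sigma_algebraType Bsig)) U.

Let mU' : measurable_fun [set: Omega] U.
Proof. exact: mG. Qed.

Let V := sigmaY2 sigma Y T.
Let mV : measurable_fun [set: Omega] V.
Proof. exact: (sigmaY2_measurable T0 alpha0 B_fbm sigmaB Y_OU). Qed.

Let msqrt (Z : Omega -> R) : measurable_fun [set: Omega] Z ->
  measurable_fun [set: Omega * measurableTypeR R] (fun p : Omega * measurableTypeR R => (U p.1 + Num.sqrt (Z p.1) * p.2)%R).
Proof.
move=> mZ; apply: measurable_funD; first exact: (measurableT_comp mU').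
apply: measurable_funM => //.
apply: (measurableT_comp (f := @Num.sqrt R)); last exact: (measurableT_comp mZ).
by apply: continuous_measurable_fun; exact: sqrt_continuous.
Qed.

Let Q := P \x stdN.

Let Q1 : Q [set: Omega * measurableTypeR R] = 1.
Proof.
have h : P setT * stdN (setT : set (measurableTypeR R)) = 1.
  by rewrite (probability_setT P) (probability_setT stdN) mule1.
by rewrite -[RHS]h -setXTT; exact: product_measure1E.
Qed.

Lemma mixture_step (n M : nat) (h : R -> R) :
  measurable_fun [set: R] h -> (forall x, 0 <= h x)%R ->
  let xi := step_xi T vol M%:R n in
  let Vn := fun w => (\sum_(i < n.+1) xi i w ^+ 2 * (node 0 (upart T n) i.+1 - node 0 (upart T n) i))%R in
  measurable_fun [set: Omega] Vn /\
  \int[P]_w (h (U w + elem_int (fun t => W t : Omega -> R) (upart T n) xi w))%:E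
  = \int[Q]_p (h (U p.1 + Num.sqrt (Vn p.1) * p.2))%:E.
Proof.
move=> mh h0 xi Vn.
have mxi i : measurable_fun (setT : set (g_sigma_algebraType Bsig)) (xi i).
  apply: measurable_minr => //.
  exact: (volatility_measurable T0 alpha0 B_fbm sigmaB Y_OU).
have mVn : measurable_fun [set: Omega] Vn.
  apply: measurable_sum => i; apply: measurable_funM => //; apply: measurable_funX.
  exact: mG.
split => //.
transitivity (\int[P]_w \int[stdN]_z (h (U w + Num.sqrt (Vn w) * z))%:E).
  rewrite -(elem_int_mixture W_wiener WB_indep (n := n.+1) (x := node 0 (upart T n)) (xi := xi) (U := U)
     (psi := fun y => (h y)%:E)) => //.
  - by apply: eq_integral => w _; rewrite /elem_int size_upart.
  - move=> i; rewrite ltnS => i_n; rewrite -subr_gt0 (node_upartB T i_n) divr_gt0//.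
  - by have /andP[] := node_upart_itv (ltW T0) (leqnn n.+1).
  - by move=> i w; rewrite le_min vol_ge0 ler0n.
  - exact/measurable_EFinP.
rewrite /Q fubini_tonelli1//; last by move=> p; rewrite lee_fin.
by apply/measurable_EFinP; apply: measurableT_comp => //; exact: msqrt.
Qed.

(** Integrating out the normal variable, of second moment 1, leaves the squared difference of the
    L^2(0, T) norms of the two paths, which [sqrt_integral_dist] controls. *)
Lemma sqrt_variance_dist (n M : nat) :
  let xi := step_xi T vol M%:R n in
  let Vn := fun w => (\sum_(i < n.+1) xi i w ^+ 2 * (node 0 (upart T n) i.+1 - node 0 (upart T n) i))%R in
  measurable_fun [set: Omega] Vn ->
  \int[Q]_p (((U p.1 + Num.sqrt (Vn p.1) * p.2) - (U p.1 + Num.sqrt (V p.1) * p.2)) ^+ 2)%:E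
  <= L2dist P T (elem_proc (upart T n) xi) vol.
Proof.
move=> xi Vn mVn.
rewrite /Q fubini_tonelli1; last 2 first.
- by apply/measurable_EFinP; apply: measurable_funX; apply: measurable_funB; exact: msqrt.
- by move=> p; rewrite lee_fin sqr_ge0.
have Qw w : fubini_F stdN (fun p : Omega * measurableTypeR R =>
    (((U p.1 + Num.sqrt (Vn p.1) * p.2) - (U p.1 + Num.sqrt (V p.1) * p.2)) ^+ 2)%:E) w
   = ((Num.sqrt (Vn w) - Num.sqrt (V w)) ^+ 2)%:E.
  rewrite /fubini_F /=.
  transitivity (\int[stdN]_z ((0 + (Num.sqrt (Vn w) - Num.sqrt (V w)) * z) ^+ 2)%:E).
    by apply: eq_integral => z _; congr (_ ^+ 2)%:E; ring.
  by rewrite gauss_second_moment expr0n/= add0r.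
under eq_integral do rewrite Qw.
have mxi i : measurable_fun [set: Omega] (xi i).
  by apply: measurable_minr => //; exact: mvol.
have jep : jmeas (elem_proc (upart T n) xi) by exact: elem_proc_jmeas.
have jvol : jmeas vol by exact: (volatility_joint T0 alpha0 B_fbm sigmaB Y_OU).
apply: ge0_le_integral => //.
- by move=> w _; rewrite lee_fin sqr_ge0.
- apply/measurable_EFinP; apply: measurable_funX; apply: measurable_funB.
    by apply: measurableT_comp => //; apply: continuous_measurable_fun; exact: sqrt_continuous.
  by apply: measurableT_comp => //; apply: continuous_measurable_fun; exact: sqrt_continuous.
- have mD : measurable_fun setT (fun p : R * Omega => if p.1 \in `]0%R, T] then
      ((elem_proc (upart T n) xi p.1 p.2 - vol p.1 p.2) ^+ 2)%:E else 0).
    by apply: jmeas_restrict; apply/measurable_EFinP; apply: measurable_funX; apply: measurable_funB; [exact: jep|exact: jvol].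
  have := @measurable_fun_fubini_tonelli_G _ _ _ _ R leb _ mD.
  have pos (p : R * Omega) : 0 <= (if p.1 \in `]0%R, T] then
      ((elem_proc (upart T n) xi p.1 p.2 - vol p.1 p.2) ^+ 2)%:E else 0).
    by case: ifP => // _; rewrite lee_fin sqr_ge0.
  move=> /(_ pos); apply: eq_measurable_fun => w _.
  rewrite /fubini_G -(@integral_itv_obnd_cbnd R 0%R (BRight T) (fun u => ((elem_proc (upart T n) xi u w - vol u w) ^+ 2)%:E)).
    by rewrite [RHS]integral_mkcond; apply: eq_integral => u _; rewrite patchE mem_setE.
  apply: measurable_funTS; apply/measurable_EFinP; apply: measurable_funX; apply: measurable_funB.
    exact: (measurableT_comp jep (pair2_measurable w)).
  exact: (measurableT_comp jvol (pair2_measurable w)).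
move=> w _.
have mep : measurable_fun [set: R] (fun u => elem_proc (upart T n) xi u w).
  exact: (measurableT_comp jep (pair2_measurable w)).
have mvw : measurable_fun [set: R] (fun u => vol u w).
  exact: (measurableT_comp jvol (pair2_measurable w)).
have ivol : leb.-integrable `[0%R, T] (EFin \o (fun u => vol u w ^+ 2)%R).
  by apply: continuous_itv_integrable; exact: (volatility_sqr_continuous T0 alpha0 B_fbm sigmaB Y_OU).
have iep : leb.-integrable `[0%R, T] (EFin \o (fun u => elem_proc (upart T n) xi u w ^+ 2)%R).
  have mT : measurable (`[0%R, T]%classic : set (measurableTypeR R)) by exact: measurable_itv.
  apply/integrableP; split; first by apply: measurable_funTS; apply/measurable_EFinP; exact: measurable_funX.
  apply: (@le_lt_trans _ _ (\int[leb]_(u in `[0%R, T]) (M%:R ^+ 2)%:E)); last first.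
    rewrite integral_cst//; have L : leb (`[0%R, T]%classic : set (measurableTypeR R)) = T%:E.
      by rewrite lebesgue_measure_itv/= lte_fin T0 oppr0 adde0.
    by rewrite [X in _ * X]L -EFinM ltry.
  apply: ge0_le_integral => //.
  - apply: measurable_funTS; apply: measurableT_comp => //; apply/measurable_EFinP; exact: measurable_funX.
  - move=> u; rewrite /= in_itv/= => /andP[u0 uT].
    rewrite lee_fin ger0_norm ?sqr_ge0//.
    rewrite -(real_normK (num_real (elem_proc _ _ _ _))) ler_sqr ?nnegrE//.
    (* At time 0 the step process is 0, since its intervals are open on the left. *)
    move: u0; rewrite le_eqVlt => /predU1P[<-|u0].
      rewrite /elem_proc big1 ?normr0// => i _; rewrite indicE memNset ?mulr0//= in_itv/=.
      have i_n : (i <= n.+1)%N by rewrite -(size_upart T n) ltnW.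
      by have /andP[a0 _] := node_upart_itv (ltW T0) i_n; rewrite ltNge a0.
    have [//|i [_ _ ->]] := @elem_proc_upart _ _ Omega T T0 n xi u w _.
      by rewrite u0.
    rewrite ger0_norm ?le_min ?vol_ge0 ?ler0n//.
    by rewrite /xi /step_xi ge_min lexx orbT.
have := sqrt_integral_dist mep mvw iep ivol.
rewrite (elem_proc_sqr_integral T0 n xi w) -sigmaY2_volatility => h.
have h' : ((Num.sqrt (Vn w) - Num.sqrt (V w)) ^+ 2)%:E <=
    (\int[leb]_(u in `[0%R, T]) ((elem_proc (upart T n) xi u w - vol u w) ^+ 2))%R%:E.
  by rewrite lee_fin.
apply: (le_trans h'); apply: fine_le_id.
by apply: integral_ge0 => u _; rewrite lee_fin sqr_ge0.
Qed.

(** For Lipschitz tests both sides are within 2 L e of the same number, which [mixture_step] writes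
    once with the elementary integral, close to [I], and once as a mixture, close to the one with
    variance [V]. [lipschitz_law_eq] then extends the identity to [psi]. *)
Lemma gaussian_mixture_law (psi : R -> \bar R) : measurable_fun [set: R] psi -> (forall y, 0 <= psi y) ->
  \int[P]_w psi (U w + I w)%R = \int[P]_w \int[stdN]_z psi (U w + Num.sqrt (V w) * z)%R.
Proof.
move=> mpsi psi0.
transitivity (\int[Q]_p psi (U p.1 + Num.sqrt (V p.1) * p.2)%R); last first.
  rewrite /Q fubini_tonelli1//.
  by apply: (measurableT_comp mpsi); exact: msqrt.
have mI : measurable_fun [set: Omega] (I : Omega -> R) by exact: measurable_funPT.
apply: (@lipschitz_law_eq R _ _ _ _ P Q (fun w => U w + I w)%R (fun p => U p.1 + Num.sqrt (V p.1) * p.2)%R) => //.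
- apply: (@le_lt_trans _ _ 1); last exact: ltry.
  by rewrite le_eqVlt; apply/orP; left; apply/eqP; exact: probability_setT.
- apply: (@le_lt_trans _ _ 1); last exact: ltry.
  by rewrite le_eqVlt; apply/orP; left; apply/eqP; exact: Q1.
- exact: measurable_funD.
- exact: msqrt.
move=> h L L0 h01 hL mh.
have h0 x : (0 <= h x)%R by have /andP[] := h01 x.
have L1 : (0 < L + 1)%R by rewrite ltr_wpDl.
have key (e : R) : (0 < e)%R ->
  (\int[P]_w (h (U w + I w))%:E <= \int[Q]_p (h (U p.1 + Num.sqrt (V p.1) * p.2))%:E + (4 * L * e)%:E) /\
  (\int[Q]_p (h (U p.1 + Num.sqrt (V p.1) * p.2))%:E <= \int[P]_w (h (U w + I w))%:E + (4 * L * e)%:E).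
  move=> e0; have e20 : (0 < e ^+ 2)%R by rewrite exprn_gt0.
  (* A squared distance of at most e^2 turns the error of [lipschitz_integral_le] into L e + (L / e)
     e^2 = 2 L e. *)
  have [n [M [HJ HV]]] := approx_pair e20.
  have [mVn E] := mixture_step n M mh h0.
  set xi := step_xi T vol M%:R n in HJ HV mVn E.
  set Vn := fun w => _ in mVn E.
  set J := elem_int _ _ _ in HJ E.
  have mJ : measurable_fun [set: Omega] J.
    apply: measurable_sum => i; apply: measurable_funM.
      by apply: measurable_minr => //; exact: mvol.
    by apply: measurable_funB; exact: measurable_funPT.
  have mUI : measurable_fun [set: Omega] (fun w => U w + I w)%R by exact: measurable_funD.
  have mUJ : measurable_fun [set: Omega] (fun w => U w + J w)%R by exact: measurable_funD.
  have P1 := probability_setT P.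
  have bnd d' (T' : measurableType d') (mu : {measure set T' -> \bar R}) (X X' : T' -> R) :
      mu setT = 1 -> measurable_fun [set: T'] X -> measurable_fun [set: T'] X' ->
      \int[mu]_w ((X w - X' w) ^+ 2)%:E <= (e ^+ 2)%:E ->
      \int[mu]_w (h (X w))%:E <= \int[mu]_w (h (X' w))%:E + (2 * L * e)%:E.
    move=> mu1 mX mX' XX'.
    apply: (le_trans (lipschitz_integral_le mu1 mX mX' mh h0 L0 e0 hL)).
    rewrite -addeA leeD2l// (@le_trans _ _ ((L * e)%:E + (L / e)%:E * (e ^+ 2)%:E))//.
      by rewrite leeD2l// lee_wpmul2l// lee_fin divr_ge0// ltW.
    rewrite -EFinM -EFinD lee_fin (_ : L / e * e ^+ 2 = L * e)%R; first by lra.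
    by field; rewrite gt_eqF.
  have symm d' (T' : measurableType d') (mu : {measure set T' -> \bar R}) (X X' : T' -> R) :
      \int[mu]_w ((X w - X' w) ^+ 2)%:E = \int[mu]_w ((X' w - X w) ^+ 2)%:E.
    by apply: eq_integral => w _; rewrite -sqrrN opprB.
  have dJ : \int[P]_w (((U w + J w) - (U w + I w)) ^+ 2)%:E <= (e ^+ 2)%:E.
    rewrite (le_trans _ HJ)// le_eqVlt; apply/orP; left; apply/eqP.
    by apply: eq_integral => w _; congr (_ ^+ 2)%:E; ring.
  have dV := le_trans (sqrt_variance_dist mVn) HV.
  have mX1 := msqrt mVn; have mX2 := msqrt mV.
  have a1 := bnd _ _ P _ _ P1 mUJ mUI dJ.
  rewrite symm in dJ.
  have a2 := bnd _ _ P _ _ P1 mUI mUJ dJ.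
  have b1 := bnd _ _ Q _ _ Q1 mX1 mX2 dV.
  rewrite symm in dV.
  have b2 := bnd _ _ Q _ _ Q1 mX2 mX1 dV.
  rewrite -E in b1 b2.
  have -> : ((4 * L * e)%:E = (2 * L * e)%:E + (2 * L * e)%:E)%E by rewrite -EFinD; congr EFin; lra.
  rewrite !addeA; split.
    by rewrite (le_trans a2)// leeD2r.
  by rewrite (le_trans b2)// leeD2r.
(* Rescaling by [L + 1] instead of [L] covers L = 0. *)
have conv (e : R) : (0 < e)%R -> (0 < e / (4 * (L + 1)) :> R)%R /\ (4 * L * (e / (4 * (L + 1))) <= e)%R.
  move=> e0; split; first by rewrite divr_gt0// mulr_gt0.
  have -> : (4 * L * (e / (4 * (L + 1))) = L * e / (L + 1))%R by field; rewrite gt_eqF.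
  by rewrite ler_pdivrMr// mulrC ler_pM2l// lerDl.
apply/eqP; rewrite eq_le; apply/andP; split; apply/lee_addgt0Pr => e e0;
  have [e'0 e'e] := conv e e0; have [k1 k2] := key _ e'0.
  by rewrite (le_trans k1)// leeD2l// lee_fin.
by rewrite (le_trans k2)// leeD2l// lee_fin.
Qed.

End log_price_law.

(** At x = exp(y) the polynomial bound becomes 1 + exp(p y) <= 2 exp(p |y|), the growth on which all
    bounds for [G] rest. *)
Lemma condition_A_growth {R : realType} (f : R -> R) : condition_A f ->
  [/\ measurable_fun [set: R] (fun y => f (expR y)), (forall y, 0 <= f (expR y)) &
    exists C p : R, [/\ 0 <= C, 0 <= p & forall y, f (expR y) <= C * expR (p * `|y|)]].
Proof.
move=> [f0 mf [C [p [C0 p0 fC]]] _]; split.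
- have mI : measurable (`[0, +oo[%classic : set (measurableTypeR R)) by exact: measurable_itv.
  have sI : expR @` [set: R] `<=` `[0, +oo[ by move=> _ [x _ <-]; rewrite /= in_itv/= expR_ge0.
  exact: (measurable_comp (mI : measurable (`[0, +oo[%classic : set R)) sI mf (@measurable_expR R)).
- by move=> y; rewrite f0// expR_ge0.
- exists (2 * C), p; split; [by rewrite mulr_ge0// ltW|exact: ltW|move=> y].
  apply: (le_trans (fC _ (expR_ge0 y))); rewrite -mulrA mulrCA ler_pM2l//.
  rewrite /powR gt_eqF ?expR_gt0// expRK.
  have h1 : 1 <= expR (p * `|y|) by rewrite -expR0 ler_expR mulr_ge0// ltW.
  have h2 : expR (p * y) <= expR (p * `|y|) by rewrite ler_expR ler_pM2l// ler_norm.
  lra.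
Qed.

(** By |m| <= |q| + V / 2 and (u + 1)^2 / 2 <= u^2 + 1, the bound of [primitive_gss_bound] is a
    constant times an exponential of [V]. Its rate grows with the payoff exponent [a], hence the
    need for exponential moments of every order. *)
Lemma gauss_bound_le {R : realType} (a q V s m : R) : 0 <= a -> 0 <= s -> s ^+ 2 = V ->
  m = q - 2^-1 * V ->
  expR ((a + 1) * `|m|) * expR (((a + 1) * s + 1) ^+ 2 / 2) <=
  expR ((a + 1) * `|q| + 1) * expR (((a + 1) / 2 + (a + 1) ^+ 2) * V).
Proof.
move=> a0 s0 sV ->; rewrite -!expRD ler_expR.
have V0 : 0 <= V by rewrite -sV sqr_ge0.
have h1 : `|q - 2^-1 * V| <= `|q| + 2^-1 * V.
  by rewrite (le_trans (ler_normB _ _))// lerD2l ger0_norm// mulr_ge0.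
have a1 : 0 <= a + 1 by rewrite addr_ge0.
have h2 := ler_wpM2l a1 h1.
have h3 : ((a + 1) * s + 1) ^+ 2 / 2 <= (a + 1) ^+ 2 * V + 1.
  rewrite -sV; have := sqr_ge0 ((a + 1) * s - 1); nra.
lra.
Qed.

(** The inverse of [s] is rewritten as the real power -1, a measurable function; positivity of [s]
    identifies the two. *)
Lemma measurable_payoff_kernel_comp {R : realType} d (T : measurableType d) (x m s : T -> R) :
  measurable_fun [set: T] x -> measurable_fun [set: T] m -> measurable_fun [set: T] s ->
  (forall t, 0 < s t) -> measurable_fun [set: T] (fun t => payoff_kernel (m t) (s t) (x t)).
Proof.
move=> mx mm ms s0.
pose i t := s t `^ (- 1).
have mi : measurable_fun [set: T] i by apply: (measurableT_comp (measurable_powR _)).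
rewrite (_ : (fun t => _) = fun t => (x t - m t) * i t ^+ 3 * expR (- ((x t - m t) ^+ 2 * (2^-1 * i t ^+ 2)))).
  have md : measurable_fun [set: T] (fun t => x t - m t) by exact: measurable_funB.
  apply: measurable_funM; first by apply: measurable_funM => //; exact: measurable_funX.
  apply: measurableT_comp => //; apply: measurable_funN; apply: measurable_funM; first exact: measurable_funX.
  by apply: measurable_funM => //; exact: measurable_funX.
apply/funext => t; rewrite /payoff_kernel /i powR_inv1 ?(ltW (s0 t))//.
by rewrite !exprVn (invfM 2).
Qed.

Unset Implicit Arguments.
Set Strict Implicit.

Theorem theorem5p2 (R : realType) (d : measure_display)
    (Omega : measurableType d) (P : probability Omega R)
    (T H b alpha S0 Y0 : R)
    (T_gt0 : 0 < T) (H_range : 2^-1 < H < 1) (alpha_gt0 : 0 < alpha)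
    (S0_gt0 : 0 < S0)
    (W B : R -> {RV P >-> R})
    (W_wiener : wiener T W) (B_fbm : fbm T H B)
    (WB_indep : indep_processes P (fun t => W t : Omega -> R)
                  (fun t => B t : Omega -> R) `[0, T])
    (sigma : R -> R) (sigmaB : condition_B sigma)
    (Y : R -> Omega -> R) (Y_OU : fractional_OU T alpha Y0 B Y)
    (I : R -> {RV P >-> R})
    (I_ito : forall t : R, 0 <= t <= T ->
       is_ito_integral (joint_filtration W B) (fun t => W t : Omega -> R)
         (fun s w => sigma (Y s w)) t (I t))
    (S X : R -> Omega -> R)
    (S_def : forall (t : R) w, 0 <= t <= T ->
       S t w = S0 * expR (b * t + I t w - 2^-1 * sigmaY2 sigma Y t w))
    (X_def : forall (t : R) w, 0 <= t <= T -> X t w = ln (S t w))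
    (f : R -> R) (fA : condition_A f)
    (Delta_gt0 : {ae P, forall w, 0 < DeltaYZ T sigma Y w}) :
  let g := fun y : R => f (expR y) in
  let G := primitive0 g in
  let s := sigmaY T sigma Y in
  let m := mY T b S0 sigma Y in
  ('E_P[fun w => g (X T w)]
   = ((2 * pi) `^ (- 2^-1))%R%:E *
     \int[lebesgue_measure]_(x in [set: R])
       ((G x)%:E *
        'E_P[(fun w => (x - m w) / s w ^+ 3
                      * expR (- ((x - m w) ^+ 2 / (2 * s w ^+ 2))))%R]))%E
  /\
  (((2 * pi) `^ (- 2^-1))%R%:E *
     \int[lebesgue_measure]_(x in [set: R])
       ((G x)%:E *
        'E_P[(fun w => (x - m w) / s w ^+ 3
                      * expR (- ((x - m w) ^+ 2 / (2 * s w ^+ 2))))%R])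
   = ((2 * pi) `^ (- 2^-1))%R%:E *
     \int[P]_w
       ((s w)^-1%R%:E *
        \int[lebesgue_measure]_(x in [set: R])
          (G (x * s w + m w) * x * expR (- (x ^+ 2 / 2)))%R%:E))%E.
Proof.
move=> g G s m.
have H0 : 0 < H by case/andP: H_range => h _; exact: lt_trans h.
have TT : 0 <= T <= T by rewrite lexx ltW.
have [mg g0 [C [a [C0 a0 g_le]]]] := condition_A_growth fA.
have [v v0 V_ge] := sigmaY2_ge T_gt0 alpha_gt0 B_fbm sigmaB Y_OU.
pose V := sigmaY2 sigma Y T.
have V0 w : 0 < V w by exact: lt_le_trans (V_ge w).
have s_gt0 w : 0 < s w by rewrite sqrtr_gt0 V0.
have s2 w : s w ^+ 2 = V w by rewrite sqr_sqrtr// ltW// V0.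
pose q := ln S0 + b * T.
have mE w : m w = q - 2^-1 * V w by [].
have mV : measurable_fun [set: Omega] V := sigmaY2_measurable T_gt0 alpha_gt0 B_fbm sigmaB Y_OU.
have ms : measurable_fun [set: Omega] s.
  by apply: measurableT_comp => //; apply: continuous_measurable_fun; exact: sqrt_continuous.
have mm : measurable_fun [set: Omega] m.
  by apply: measurable_funB => //; exact: measurable_funM.
have mG : measurable_fun [set: R] G := measurable_primitive0 mg g0 C0 a0 g_le.
pose c0 : R := (2 * pi) `^ (- 2^-1).
have c00 : 0 < c0 := c0_gt0.
(* [N w] plays the role of the conditional expectation of the payoff given [B], and [A w] is the
   integrand of the last expression. They differ by the factor [c0], so [A] inherits measurability
   and nonnegativity from [N], although [G] may take both signs. *)
pose N (w : Omega) := (\int[@normal_prob R 0 1]_z (g (m w + s w * z))%:E)%E.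
pose A (w : Omega) := ((s w)^-1%:E * \int[lebesgue_measure]_x (G (x * s w + m w) * x * expR (- (x ^+ 2 / 2)))%:E)%E.
have NA w : N w = (c0%:E * A w)%E by exact: (payoff_ibp mg g0 C0 a0 g_le (m w) (s_gt0 w)).
have N0 w : (0 <= N w)%E by apply: integral_ge0 => z _; rewrite lee_fin; exact: g0.
have AN w : A w = (c0^-1%:E * N w)%E.
  by rewrite NA muleA -EFinM mulVf ?gt_eqF// mul1e.
have A0 w : (0 <= A w)%E by rewrite AN mule_ge0// lee_fin invr_ge0 ltW.
have mN : measurable_fun [set: Omega] N.
  apply: (@measurable_fun_fubini_tonelli_F _ _ Omega (measurableTypeR R) R (@normal_prob R 0 1)
    (fun p => (g (m p.1 + s p.1 * p.2))%:E)).
    apply/measurable_EFinP; apply: (measurableT_comp mg).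
    apply: measurable_funD; first exact: (measurableT_comp mm).
    by apply: measurable_funM => //; exact: (measurableT_comp ms).
  by move=> p; rewrite lee_fin; exact: g0.
have mA : measurable_fun [set: Omega] A.
  rewrite (_ : A = fun w => (c0^-1%:E * N w)%E); last exact/funext.
  exact: emeasurable_funM.
have EX : ('E_P[fun w => g (X T w)] = \int[P]_w N w)%E.
  rewrite expectation.unlock.
  transitivity (\int[P]_w ((fun y => (g y)%:E) (m w + I T w)%R))%E.
    apply: eq_integral => w _; rewrite X_def// S_def//; congr (g _)%:E.
    by rewrite lnM ?posrE ?expR_gt0// expRK mE /q /V; ring.
  (* [m] is the offset of the mixture, X_T = m_Y + I_T, and depends on [B] through sigma_Y^2. *)
  have mU : measurable_fun (setT : set (g_sigma_algebraType
      (proc_events (fun u => B u : Omega -> R) `[0, T]))) m.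
    apply: measurable_funB => //; apply: measurable_funM => //.
    exact: (sigmaY2_measurable_sigma T_gt0 alpha_gt0 B_fbm sigmaB Y_OU).
  have mgE : measurable_fun [set: R] (fun y => (g y)%:E) by exact/measurable_EFinP.
  apply: (gaussian_mixture_law T_gt0 H0 alpha_gt0 W_wiener B_fbm WB_indep sigmaB Y_OU (I_ito T TT).2 mU mgE).
  by move=> y; rewrite lee_fin; exact: g0.
have EA : (\int[P]_w N w = c0%:E * \int[P]_w A w)%E.
  under eq_integral do rewrite NA.
  by rewrite ge0_integralZl// lee_fin ltW.
(* The lower bound on sigma makes the kernel bounded, so its expectation is finite for each [x] and
   [G x] can be moved under it. *)
have ker_le x w : `|payoff_kernel (m w) (s w) x| <= v^-1.
  apply: (le_trans (payoff_kernel_le _ _ (s_gt0 w))).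
  by rewrite -exprVn exprVn s2 lef_pV2 ?posrE ?V_ge.
have mker x : measurable_fun [set: Omega] (fun w => payoff_kernel (m w) (s w) x).
  exact: measurable_payoff_kernel_comp.
have iker x : P.-integrable setT (fun w => (payoff_kernel (m w) (s w) x)%:E).
  apply/integrableP; split; first exact/measurable_EFinP.
  apply: (@le_lt_trans _ _ (\int[P]_w (v^-1)%:E)%E).
    apply: ge0_le_integral => //.
    - by apply: measurableT_comp => //; exact/measurable_EFinP.
    - by move=> w _; rewrite lee_fin ker_le.
  by rewrite integral_cst//= probability_setT mule1 ltry.
pose K (p : measurableTypeR R * Omega) : \bar R := (G p.1 * payoff_kernel (m p.2) (s p.2) p.1)%:E.
have mK : measurable_fun [set: measurableTypeR R * Omega] K.
  apply/measurable_EFinP; apply: measurable_funM; first exact: (measurableT_comp mG).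
  by apply: measurable_payoff_kernel_comp => //; [exact: (measurableT_comp mm)|exact: (measurableT_comp ms)].
pose cst1 : R := (Num.sqrt v)^-1 * (C * (c0^-1 * (2 * expR ((a + 1) * `|q| + 1)))).
pose cst2 : R := (a + 1) / 2 + (a + 1) ^+ 2.
(* [cst2] is the rate in [gauss_bound_le]; [cst1] collects the deterministic factors, with the
   inverse of [s w] bounded through [v]. *)
have K_abs w : (\int[lebesgue_measure]_x `|K (x, w)| <= (cst1 * expR (cst2 * V w))%:E)%E.
  rewrite (_ : (\int[_]_x _)%E = (\int[lebesgue_measure]_x `|(G x * payoff_kernel (m w) (s w) x)%:E|)%E)//.
  rewrite (payoff_affine_abs mg g0 C0 a0 g_le (m w) (s_gt0 w)).
  have sv : (s w)^-1 <= (Num.sqrt v)^-1.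
    by rewrite lef_pV2 ?posrE ?sqrtr_gt0// ler_sqrt// ltW.
  have si0 : 0 <= (s w)^-1 by rewrite invr_ge0 ltW.
  apply: (@le_trans _ _ ((s w)^-1%:E * (C * expR ((a + 1) * `|m w|) *
     (c0^-1 * (2 * expR (((a + 1) * s w + 1) ^+ 2 / 2))))%:E)%E).
    by rewrite lee_wpmul2l ?lee_fin//; exact: (primitive_gss_bound mg g0 C0 a0 g_le (m w) (s_gt0 w)).
  rewrite -EFinM lee_fin.
  have h := gauss_bound_le a0 (ltW (s_gt0 w)) (s2 w) (mE w).
  have h' : C * expR ((a + 1) * `|m w|) * (c0^-1 * (2 * expR (((a + 1) * s w + 1) ^+ 2 / 2))) <=
     C * (c0^-1 * 2) * (expR ((a + 1) * `|q| + 1) * expR (cst2 * V w)).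
    rewrite (_ : C * expR ((a + 1) * `|m w|) * _ = C * (c0^-1 * 2) *
       (expR ((a + 1) * `|m w|) * expR (((a + 1) * s w + 1) ^+ 2 / 2))); last by ring.
    by rewrite ler_wpM2l// mulr_ge0// mulr_ge0// invr_ge0 ltW.
  rewrite (_ : cst1 * _ = (Num.sqrt v)^-1 * (C * (c0^-1 * 2) * (expR ((a + 1) * `|q| + 1) * expR (cst2 * V w)))); last first.
    by rewrite /cst1; ring.
  by apply: ler_pM => //; rewrite !mulr_ge0 ?expR_ge0// invr_ge0 ltW.
have cst2_ge0 : 0 <= cst2 by rewrite addr_ge0 ?sqr_ge0// divr_ge0// addr_ge0.
have cst1_ge0 : 0 <= cst1.
  by rewrite !mulr_ge0 ?expR_ge0 ?invr_ge0 ?sqrtr_ge0// ltW.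
have iK : (lebesgue_measure \x P)%E.-integrable setT K.
  (* Absolute integrability is checked with the [x]-integral inside, where the bound is explicit;
     the exponential moment of order [cst2] handles the expectation. *)
  apply/(integrable21ltyP _ _ mK).
  apply: (@le_lt_trans _ _ (\int[P]_w (cst1%:E * (expR (cst2 * V w))%:E))%E).
    apply: ge0_le_integral => //.
    - by move=> w _; apply: integral_ge0.
    - apply: (measurable_fun_fubini_tonelli_G (fun p => `|K p|%E)) => //.
      exact: measurableT_comp.
    - by apply: emeasurable_funM => //; apply/measurable_EFinP; apply: measurableT_comp => //; exact: measurable_funM.
  rewrite ge0_integralZl//; last first.
    by apply/measurable_EFinP; apply: measurableT_comp => //; exact: measurable_funM.
  rewrite lte_mul_pinfty ?lee_fin//.
  exact: (expR_sigmaY2_integrable T_gt0 H0 alpha_gt0 B_fbm sigmaB Y_OU cst2_ge0).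
have EK : (\int[lebesgue_measure]_(x in [set: R]) ((G x)%:E *
    'E_P[(fun w => (x - m w) / s w ^+ 3 * expR (- ((x - m w) ^+ 2 / (2 * s w ^+ 2))))%R])
   = \int[P]_w A w)%E.
  transitivity (\int[lebesgue_measure]_x \int[P]_w K (x, w))%E.
    apply: eq_integral => x _; rewrite expectation.unlock /K /=.
    rewrite -[LHS](integralZl measurableT (iker x)).
    by apply: eq_integral => w _; rewrite EFinM.
  rewrite (Fubini iK); apply: eq_integral => w _.
  exact: (payoff_affine mg g0 C0 a0 g_le (m w) (s_gt0 w)).
by rewrite EK EX EA.
Qed.
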